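(* Let $G$ be a (discrete) group and let $q\colon(K;\varphi)\to(L;\psi)$ be an open, topologically ergodic extension of topological dynamical systems with relative discrete spectrum over a Stonean space $L$. Then there are (i) an open compact group bundle $p\colon H\to L_{\mathrm{fix}}$, (ii) a core-free closed subgroup bundle $p|_U\colon U\to L_{\mathrm{fix}}$, and (iii) an ergodic relative cocycle $c\colon G\times L\to H$, such that $q$ is isomorphic to the induced relative skew-product extension $q_c\colon(L\times_{L_{\mathrm{fix}}}H/U;\varphi_c)\to(L;\psi)$.
   Context: All compact spaces are Hausdorff; $G$ is a fixed group with the discrete topology; function spaces are complex-valued. A Stonean space is an extremally disconnected compact space. Topological dynamics. A topological dynamical system $(K;\varphi)$ is a compact space $K$ with a group homomorphism $\varphi\colon G\to\mathrm{Homeo}(K)$, $t\mapsto\varphi_t$. An extension $q\colon(K;\varphi)\to(L;\psi)$ is a continuous surjection $q\colon K\to L$ with $q\circ\varphi_t=\psi_t\circ q$ for all $t$; it is open if $q$ is an open map. Extensions $q_i\colon(K_i;\varphi_i)\to(L;\psi)$ are isomorphic if there is an equivariant homeomorphism $\Phi\colon K_1\to K_2$ with $q_2\circ\Phi=q_1$. $(T_\varphi)_tf=f\circ\varphi_{t^{-1}}$ on $\mathrm{C}(K)$ and $\mathrm{fix}(T_\varphi)=\{f\in\mathrm{C}(K):(T_\varphi)_tf=f\ \forall t\}$. $L_{\mathrm{fix}}$ is the Gelfand space of $\mathrm{fix}(T_\psi)$, and $q_{\mathrm{fix}}\colon L\to L_{\mathrm{fix}}$ is the continuous surjection induced by $\mathrm{fix}(T_\psi)\hookrightarrow\mathrm{C}(L)$.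 $q$ is topologically ergodic if $\{f\circ q:f\in\mathrm{fix}(T_\psi)\}=\mathrm{fix}(T_\varphi)$. $\mathrm{C}(K)$ is a $\mathrm{C}(L)$-module via $f\cdot g=(f\circ q)g$. An open extension $q$ over a Stonean space $L$ has relative discrete spectrum if $\mathrm{C}(K)$ is generated as a C*-algebra by its finitely generated, projective, closed, $T_\varphi$-invariant $\mathrm{C}(L)$-submodules. Bundles. A compact group bundle over a compact space $M$ is a continuous surjection $p\colon H\to M$ from a compact space $H$ such that every fiber $H_m=p^{-1}(m)$ is a group and the maps $H\times_MH\to H$, $(x,y)\mapsto xy$ (with $H\times_MH=\{(x,y):p(x)=p(y)\}$), $x\mapsto x^{-1}$, and $m\mapsto1_{H_m}$ are continuous; it is open if $p$ is an open map. A closed subgroup bundle is a restriction $p|_U\colon U\to M$ to a closed subset $U\subseteq H$ such that $U_m=U\cap H_m$ is a subgroup of $H_m$ for all $m$; it is core-free if for every $m$ the only normal subgroup of $H_m$ contained in $U_m$ is the trivial one. $H/U=\bigcup_mH_m/U_m$ carries the quotient topology; the class of $x$ is $xU$. Relative skew-products. A relative cocycle is a continuous map $c\colon G\times L\to H$ with $p(c(t,l))=q_{\mathrm{fix}}(l)$ and $c(t_1t_2,l)=c(t_1,\psi_{t_2}(l))c(t_2,l)$ for all $t,t_1,t_2\in G$, $l\in L$. The relative skew-product system is $L\times_{L_{\mathrm{fix}}}H/U$ (pairs $(l,xU)$ with $q_{\mathrm{fix}}(l)=p(x)$) with $(\varphi_c)_t(l,xU)=(\psi_t(l),c(t,l)xU)$,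 and $q_c(l,xU)=l$. Ergodic cocycles. Let $\mathcal{G}=(L\times_{L_{\mathrm{fix}}}L)\times_{L_{\mathrm{fix}}}H=\{(l_1,l_2,x)\in L\times L\times H:q_{\mathrm{fix}}(l_1)=q_{\mathrm{fix}}(l_2)=p(x)\}$ with the partially defined multiplication $(l,l_2,x)\cdot(l_1,l,y)=(l_1,l_2,xy)$. A subsemigroupoid is a subset closed under this multiplication. A relative cocycle $c$ is ergodic if the smallest closed subsemigroupoid of $\mathcal{G}$ containing $\{(l,\psi_t(l),c(t,l)):l\in L,t\in G\}$ is all of $\mathcal{G}$. *)

(* Defs.v *)
From HB Require Import structures.
From mathcomp Require Import all_boot all_order all_algebra.
From mathcomp Require Import all_classical all_reals.
From mathcomp Require Import topology normedtype.
From mathcomp Require Import complex.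

Set Implicit Arguments.
Unset Strict Implicit.
Unset Printing Implicit Defensive.

Import Order.TTheory GRing.Theory Num.Theory.
Import numFieldNormedType.Exports.
Local Open Scope classical_set_scope.
Local Open Scope ring_scope.
Local Open Scope quotient_scope.

(* Packed as a numClosedFieldType because the library attaches the norm
   topology to such packed types, but not to the bare type R[i]. *)
Definition cplx (R : realType) : numClosedFieldType := R[i].

(* C(T) is the zero ring when T is empty, hence comPzRing below. *)
Notation cfun R T := (continuousType T (cplx R)).

Section cfun_ring.
Context (R : realType) (T : topologicalType).

Definition continuous_pred : {pred T -> cplx R} :=
  mem [set f : T -> cplx R | continuous f].

Definition cfun_Sub (f : T -> cplx R) (fP : f \in continuous_pred) :
  cfun R T := mkcts (set_mem fP).

Lemma cfun_rect (P : cfun R T -> Type) :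
  (forall f (fP : f \in continuous_pred), P (cfun_Sub fP)) ->
  forall u : cfun R T, P u.
Proof.
move=> PSub u.
have uP : (u : T -> cplx R) \in continuous_pred.
  by rewrite inE; exact: cts_fun.
suff -> : u = cfun_Sub uP by exact: PSub.
exact/continuousEP.
Qed.

Lemma cfun_valP f (fP : f \in continuous_pred) :
  cfun_Sub fP = f :> (T -> cplx R).
Proof. by []. Qed.

HB.instance Definition _ := isSub.Build _ _ (cfun R T) cfun_rect cfun_valP.

Lemma cfun_subring_closed : subring_closed continuous_pred.
Proof.
split=> [|f g /set_mem cf /set_mem cg|f g /set_mem cf /set_mem cg];
  apply/mem_set => x.
- exact: cst_continuous.
- by apply: cvgB; [exact: cf|exact: cg].
- by apply: cvgM; [exact: cf|exact: cg].
Qed.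

HB.instance Definition _ := GRing.SubChoice_isSubComPzRing.Build
  (T -> cplx R) continuous_pred (cfun R T) cfun_subring_closed.

End cfun_ring.

Section topology_notions.

Definition compact_hausdorff (T : topologicalType) : Prop :=
  compact [set: T] /\ hausdorff_space T.

Definition stonean (T : topologicalType) : Prop :=
  compact_hausdorff T /\ forall A : set T, open A -> open (closure A).

Definition open_map (S T : topologicalType) (f : S -> T) : Prop :=
  forall A : set S, open A -> open (f @` A).

Definition homeomorphism (S T : topologicalType) (f : S -> T) : Prop :=
  continuous f /\
  exists g : T -> S, [/\ continuous g, cancel f g & cancel g f].

End topology_notions.

Section dynamics.
Context (G : groupType).

Definition dynamical_system (K : topologicalType) (phi : G -> K -> K) : Prop :=
  [/\ compact_hausdorff K,
      forall t, homeomorphism (phi t) &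
      forall s t x, phi (s * t)%g x = phi s (phi t x)].

Definition extension (K L : topologicalType) (phi : G -> K -> K)
    (psi : G -> L -> L) (q : K -> L) : Prop :=
  [/\ continuous q,
      forall l, exists k, q k = l &
      forall t k, q (phi t k) = psi t (q k)].

Definition extension_isomorphic (K1 K2 L : topologicalType)
    (phi1 : G -> K1 -> K1) (q1 : K1 -> L)
    (phi2 : G -> K2 -> K2) (q2 : K2 -> L) : Prop :=
  exists Phi : K1 -> K2,
    [/\ homeomorphism Phi,
        forall t k, Phi (phi1 t k) = phi2 t (Phi k) &
        forall k, q2 (Phi k) = q1 k].

Variable R : realType.

Definition fixed_functions (K : topologicalType) (phi : G -> K -> K) :
    set (K -> cplx R) :=
  [set f | continuous f /\ forall t, f \o phi (t^-1)%g = f].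

Definition topologically_ergodic (K L : topologicalType) (phi : G -> K -> K)
    (psi : G -> L -> L) (q : K -> L) : Prop :=
  [set f \o q | f in fixed_functions psi] = fixed_functions phi.

End dynamics.

Arguments fixed_functions {G} R {K} phi.

Section discrete_spectrum.
Context (R : realType) (G : groupType) (K L : topologicalType).
Context (phi : G -> K -> K) (q : K -> L).
Implicit Types M A : set (K -> cplx R).

(* C(K) is complete, so closed subsets of C(K) for the supremum norm are the
   subsets of C(K) closed for uniform convergence of arbitrary functions. *)
Definition uniformly_closed A : Prop := closed (A : set {uniform K -> cplx R}).

Definition submodule M : Prop :=
  [/\ M `<=` [set g | continuous g],
      M 0,
      forall g h, M g -> M h -> M (g + h) &
      forall (a : cfun R L) g, M g -> M ((a \o q) * g)].

Definition finitely_generated M : Prop :=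
  exists (n : nat) (e : 'I_n -> K -> cplx R),
    (forall i, M (e i)) /\
    forall g, M g -> exists a : 'I_n -> cfun R L,
      g = \sum_(i < n) (a i \o q) * e i.

(* C(L)-linear maps M -> B are represented by functions on K -> C whose values
   outside M are irrelevant. *)
Definition linear_on M (B : lmodType (cfun R L)) (f : (K -> cplx R) -> B) :
    Prop :=
  (forall g h, M g -> M h -> f (g + h) = f g + f h) /\
  (forall (a : cfun R L) g, M g -> f ((a \o q) * g) = a *: f g).

Definition projective M : Prop :=
  forall (A B : lmodType (cfun R L)) (p : {linear A -> B})
      (f : (K -> cplx R) -> B),
    (forall b, exists a, p a = b) -> linear_on M f ->
    exists h : (K -> cplx R) -> A,
      linear_on M h /\ forall g, M g -> p (h g) = f g.

Definition invariant M : Prop :=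
  forall t g, M g -> M (g \o phi (t^-1)%g).

Definition cstar_subalgebra A : Prop :=
  [/\ A `<=` [set f | continuous f],
      A 0,
      forall (a : cplx R) f g, A f -> A g -> A (a *: f + g),
      forall f g, A f -> A g -> A (f * g) &
      (forall f, A f -> A (fun x => (f x)^*)) /\ uniformly_closed A].

Definition discrete_spectrum_module M : Prop :=
  [/\ submodule M, finitely_generated M, projective M, uniformly_closed M &
      invariant M].

Definition relative_discrete_spectrum : Prop :=
  smallest cstar_subalgebra (\bigcup_(M in discrete_spectrum_module) M) =
  [set f | continuous f].

End discrete_spectrum.

Section gelfand.
Context (R : realType) (T : topologicalType).

(* The algebra operations on A are those of functions T -> C, hence the
   relational form of linearity and multiplicativity. *)
Definition characters (A : set (T -> cplx R)) : set {ptws A -> cplx R} :=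
  [set chi | [/\ exists f, chi f != 0,
      forall (a : cplx R) (f g h : A),
        \val h = a *: \val f + \val g -> chi h = a * chi f + chi g &
      forall f g h : A, \val h = \val f * \val g -> chi h = chi f * chi g]].

Arguments characters : clear implicits.

(* The weak-* topology is the topology of pointwise convergence. *)
Definition gelfand_space (A : set (T -> cplx R)) : topologicalType :=
  set_type (characters A).

End gelfand.

Arguments characters {R T} A.
Arguments gelfand_space {R T} A.

Section fixed_factor.
Context (R : realType) (G : groupType) (L : topologicalType).
Variable psi : G -> L -> L.

Definition fixed_factor : topologicalType :=
  gelfand_space (fixed_functions R psi).

Lemma eval_character (l : L) :
  characters (fixed_functions R psi) (fun f => \val f l).
Proof.
split.
- have onefix : fixed_functions R psi (cst 1).
    by split=> // x; exact: cst_continuous.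
  pose one : fixed_functions R psi := Sub (cst 1) (mem_set onefix).
  by exists one; rewrite /= oner_neq0.
- by move=> a f g h ->.
- by move=> f g h ->.
Qed.

(* The map of Gelfand spaces induced by the inclusion of the fixed algebra in
   C(L): l, viewed as evaluation at l, is restricted to the fixed algebra. *)
Definition fixed_factor_map (l : L) : fixed_factor :=
  exist (fun chi => chi \in characters _) _ (mem_set (eval_character l)).

Lemma fixed_factor_mapE (t : G) (l : L) :
  fixed_factor_map (psi t l) = fixed_factor_map l.
Proof.
apply: val_inj; apply/funext => f /=.
have [_ /(_ t^-1%g)] := set_valP f.
by rewrite invgK => /(congr1 (@^~ l)).
Qed.

End fixed_factor.

Section bundles.

(* The operations are total functions; mul x y is meaningless unless x and y
   lie in the same fiber. *)
Record group_bundle (M : topologicalType) := GroupBundle {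
  gb_space :> topologicalType;
  gb_proj : gb_space -> M;
  gb_mul : gb_space -> gb_space -> gb_space;
  gb_inv : gb_space -> gb_space;
  gb_one : M -> gb_space;
  gb_compact_hausdorff : compact_hausdorff gb_space;
  gb_proj_continuous : continuous gb_proj;
  gb_proj_surjective : forall m, exists x, gb_proj x = m;
  gb_proj_mul : forall x y, gb_proj x = gb_proj y ->
    gb_proj (gb_mul x y) = gb_proj x;
  gb_proj_inv : forall x, gb_proj (gb_inv x) = gb_proj x;
  gb_proj_one : forall m, gb_proj (gb_one m) = m;
  gb_mulA : forall x y z, gb_proj x = gb_proj y -> gb_proj y = gb_proj z ->
    gb_mul x (gb_mul y z) = gb_mul (gb_mul x y) z;
  gb_mul1 : forall x, gb_mul (gb_one (gb_proj x)) x = x;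
  gb_mulr1 : forall x, gb_mul x (gb_one (gb_proj x)) = x;
  gb_mulV : forall x, gb_mul (gb_inv x) x = gb_one (gb_proj x);
  gb_mulrV : forall x, gb_mul x (gb_inv x) = gb_one (gb_proj x);
  gb_mul_continuous :
    {within [set xy | gb_proj xy.1 = gb_proj xy.2],
      continuous (fun xy : gb_space * gb_space => gb_mul xy.1 xy.2)};
  gb_inv_continuous : continuous gb_inv;
  gb_one_continuous : continuous gb_one
}.

Variables (M : topologicalType) (H : group_bundle M).
Local Notation p := (@gb_proj M H).
Local Notation mul := (@gb_mul M H).
Local Notation inv := (@gb_inv M H).
Local Notation one := (@gb_one M H).

Definition fiberwise_subgroup (U : set H) : Prop :=
  [/\ forall m, U (one m),
      forall x y, p x = p y -> U x -> U y -> U (mul x y) &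
      forall x, U x -> U (inv x)].

Record subgroup_bundle := SubgroupBundle {
  sb_set :> set H;
  sb_closed : closed sb_set;
  sb_subgroup : fiberwise_subgroup sb_set
}.

Definition normal_subgroup (m : M) (N : set H) : Prop :=
  [/\ N `<=` p @^-1` [set m],
      N (one m),
      forall x y, N x -> N y -> N (mul x y),
      forall x, N x -> N (inv x) &
      forall h x, p h = m -> N x -> N (mul (mul h x) (inv h))].

Definition core_free (U : subgroup_bundle) : Prop :=
  forall m (N : set H), normal_subgroup m N -> N `<=` U -> N = [set one m].

Variable U : subgroup_bundle.

Definition coset_rel (x y : H) : bool :=
  `[< p x = p y /\ sb_set U (mul (inv x) y) >].

Lemma coset_rel_refl : reflexive coset_rel.
Proof.
by move=> x; apply/asboolP; split=> //; rewrite gb_mulV; case: (sb_subgroup U).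
Qed.

Lemma gb_invK (x : H) : inv (inv x) = x.
Proof.
rewrite -[LHS]gb_mulr1 !gb_proj_inv -gb_mulV gb_mulA ?gb_proj_inv//.
by rewrite gb_mulV gb_proj_inv gb_mul1.
Qed.

Lemma gb_invM (x y : H) : p x = p y -> inv (mul x y) = mul (inv y) (inv x).
Proof.
move=> xy; have pxy := gb_proj_mul xy.
have xyV : mul (mul x y) (mul (inv y) (inv x)) = one (p x).
  rewrite gb_mulA ?gb_proj_inv ?pxy// -(@gb_mulA _ _ x) ?gb_proj_inv//.
  by rewrite gb_mulrV -xy gb_mulr1 gb_mulrV.
have pyx : p (mul (inv y) (inv x)) = p x.
  by rewrite gb_proj_mul ?gb_proj_inv.
rewrite -[LHS]gb_mulr1 gb_proj_inv pxy -xyV.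
by rewrite gb_mulA ?gb_proj_inv ?pyx ?pxy// gb_mulV pxy -[X in one X]pyx gb_mul1.
Qed.

Lemma coset_rel_sym : symmetric coset_rel.
Proof.
have sub x y : coset_rel x y -> coset_rel y x.
  move=> /asboolP[xy Uxy]; apply/asboolP; split=> //.
  have [_ _ /(_ _ Uxy)] := sb_subgroup U.
  by rewrite gb_invM ?gb_proj_inv// gb_invK.
by move=> x y; apply/idP/idP; exact: sub.
Qed.

Lemma coset_rel_trans : transitive coset_rel.
Proof.
move=> y x z /asboolP[xy Uxy] /asboolP[yz Uyz]; apply/asboolP.
split; first by rewrite xy.
have [_ /(_ _ _ _ Uxy Uyz) + _] := sb_subgroup U.
rewrite !gb_proj_mul ?gb_proj_inv// => /(_ xy).
rewrite -gb_mulA ?gb_proj_inv ?gb_proj_mul ?gb_proj_inv//.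
by rewrite (@gb_mulA _ _ y) ?gb_proj_inv// gb_mulrV yz gb_mul1.
Qed.

Canonical coset_equiv : equiv_rel H :=
  EquivRel coset_rel coset_rel_refl coset_rel_sym coset_rel_trans.

(* H/U with the quotient topology; a class is accessed through the
   representative [repr z]. *)
Definition coset_space : topologicalType :=
  quotient_topology {eq_quot coset_equiv}.

Definition coset (x : H) : coset_space := \pi_{eq_quot coset_equiv} x.
Definition coset_repr (z : coset_space) : H :=
  repr (z : {eq_quot coset_equiv}).
Definition coset_proj (z : coset_space) : M := p (coset_repr z).
Definition coset_act (h : H) (z : coset_space) : coset_space :=
  coset (mul h (coset_repr z)).

Lemma coset_eqP (x y : H) :
  coset x = coset y <-> p x = p y /\ sb_set U (mul (inv x) y).
Proof.
split=> [/(@eqmodP _ coset_equiv) /asboolP//|xy].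
by apply/(@eqmodP _ coset_equiv)/asboolP.
Qed.

Lemma coset_reprK (z : coset_space) : coset (coset_repr z) = z.
Proof. exact: reprK. Qed.

Lemma coset_projE (x : H) : coset_proj (coset x) = p x.
Proof. by have /coset_eqP[] := coset_reprK (coset x). Qed.

Lemma coset_actE (h x : H) : p h = p x ->
  coset_act h (coset x) = coset (mul h x).
Proof.
move=> hx; have /coset_eqP[] := coset_reprK (coset x).
set y := coset_repr _ => yx Uyx; apply/coset_eqP.
have hy : p h = p y by rewrite hx yx.
rewrite !gb_proj_mul//; split=> //.
rewrite gb_invM// -gb_mulA ?gb_proj_inv ?gb_proj_mul//.
by rewrite (@gb_mulA _ _ (inv h)) ?gb_proj_inv// gb_mulV hx gb_mul1.
Qed.

End bundles.

Section skew_products.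
Context (R : realType) (G : groupType) (L : topologicalType).
Variables (psi : G -> L -> L) (H : group_bundle (fixed_factor R psi)).
Local Notation qfix := (@fixed_factor_map R G L psi).
Local Notation p := (@gb_proj _ H).
Local Notation mul := (@gb_mul _ H).

(* G is discrete, so joint continuity on G * L is continuity in L. *)
Record relative_cocycle := RelativeCocycle {
  rc_fun :> G -> L -> H;
  rc_continuous : forall t, continuous (rc_fun t);
  rc_proj : forall t l, p (rc_fun t l) = qfix l;
  rc_cocycle : forall t1 t2 l,
    rc_fun (t1 * t2)%g l = mul (rc_fun t1 (psi t2 l)) (rc_fun t2 l)
}.

Variables (U : subgroup_bundle H) (c : relative_cocycle).

Definition skew_set : set (L * coset_space U) :=
  [set lz | qfix lz.1 = coset_proj lz.2].

Definition skew_space : topologicalType := set_type skew_set.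

Lemma skew_act_subproof (t : G) (w : skew_space) :
  skew_set (psi t (\val w).1, coset_act (c t (\val w).1) (\val w).2).
Proof.
have := set_valP w; rewrite /skew_set /= /coset_act coset_projE => wE.
by rewrite fixed_factor_mapE gb_proj_mul rc_proj.
Qed.

Definition skew_act (t : G) (w : skew_space) : skew_space :=
  exist (fun lz => lz \in skew_set) _ (mem_set (skew_act_subproof t w)).

Definition skew_proj (w : skew_space) : L := (\val w).1.

Definition ergodicity_groupoid : set (L * L * H) :=
  [set z | qfix z.1.1 = p z.2 /\ qfix z.1.2 = p z.2].

(* The groupoid is closed in L * L * H since the Gelfand space is Hausdorff,
   so relatively closed and closed subsets of it coincide. *)
Definition closed_subsemigroupoid (S : set (L * L * H)) : Prop :=
  [/\ S `<=` ergodicity_groupoid,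
      closed S &
      forall l l1 l2 x y, S (l, l2, x) -> S (l1, l, y) -> S (l1, l2, mul x y)].

Definition ergodic_cocycle : Prop :=
  smallest closed_subsemigroupoid
    [set z | exists l t, z = (l, psi t l, c t l)] = ergodicity_groupoid.

End skew_products.

Arguments skew_space {R G L psi H} U.
Arguments skew_act {R G L psi H} U c t w.
Arguments skew_proj {R G L psi H} U w.

(* Main.v *)
Require Import Defs.
From HB Require Import structures.
From mathcomp Require Import all_boot all_order all_algebra.
From mathcomp Require Import all_classical all_reals.
From mathcomp Require Import topology normedtype.
From mathcomp Require Import realfun complex ring lra.

(* The modules generating C(K) are finitely generated, projective and closed, so the
   coefficients of their elements are bounded on each fibre in terms of the sup norm;
   hence the unit balls of the modules define continuous invariant pseudometrics on
   K x_L K, which separate the points of each fibre.  The isometric bijections between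
   fibres of q then form a compact groupoid, in which the restrictions of the phi_t
   generate a closed subsemigroupoid E.  As L is Stonean, so is L_fix, and the orbit
   relation is dense in L x_{L_fix} L, whence E is transitive over L_fix.  Gleason's
   theorem provides continuous sections sigma of L -> L_fix and tau of the isometries
   in E from the fibre over sigma (q_fix l) to the fibre over l.  Take for H the
   isotropy groups of E at the points sigma m, put
   c (t, l) = tau (psi_t l)^-1 phi_t (tau l), and let U consist of the stabilizers of
   continuously chosen base points.  Minimality of E makes c ergodic, ergodicity of c
   makes H open over L_fix, and openness of H together with topological ergodicity of
   q makes H transitive on the fibres over the points sigma m. *)

Set Implicit Arguments.
Unset Strict Implicit.
Unset Printing Implicit Defensive.

Import Order.TTheory GRing.Theory Num.Theory.
Import numFieldNormedType.Exports.
Local Open Scope classical_set_scope.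
Local Open Scope ring_scope.

(** * Compact spaces *)

Section compact_tools.

(** A pointwise limit of the maps [phi t] between varying fibres need be neither continuous nor
    injective, so the closure of the action is in general no groupoid. Pseudometrics for which every
    [phi t] is a fibrewise isometry remove this obstacle: being continuous and separating the points
    of each fibre, they make the isometry relation closed, limits invertible, and composition and
    evaluation jointly continuous. Their continuity is where the algebra enters. Projectivity gives
    coefficient functionals with values in C(L), and their boundedness replaces the unit ball of a
    module by a compact set of coefficient vectors, so that a supremum over the ball can be treated
    by the maximum theorem. No space is assumed metrizable. Continuous choices come only from the
    extremal disconnectedness of the base, and continuity of maps defined by existence and
    uniqueness comes from closed graphs in compact spaces. *)

Lemma closed_image (X Y : topologicalType) (f : X -> Y) (A : set X) :
  compact [set: X] -> hausdorff_space Y -> continuous f -> closed A ->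
  closed (f @` A).
Proof.
move=> cX hY cf cA; apply: compact_closed => //.
apply: continuous_compact; first exact: continuous_subspaceT.
exact: subclosed_compact cX _.
Qed.

Lemma proj_closed (X Y : topologicalType) (C : set (X * Y)) :
  compact [set: Y] -> closed C -> closed (fst @` C).
Proof.
move=> cY cC; rewrite -[fst @` C]setCK; apply: open_closedC; rewrite openE => x /= nx.
have nC y : ~ C (x, y) by move=> Cxy; apply: nx; exists (x, y).
have /compact_near_coveringP ncY := cY.
have : \forall x' \near x, [set: Y] `<=` (fun y => ~ C (x', y)).
  apply: ncY => y _; have : nbhs (x, y) (~` C).
    by apply: open_nbhs_nbhs; split; [exact: closed_openC|exact: nC].
  by case=> -[A B] [/= Ax By] AB; exists (B, A) => // -[y' x'] [/= ? ?];
    exact: (AB (x', y')).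
rewrite /interior; apply: filterS.
by move=> x' sub [[? y] /= Cxy ?]; apply: (sub y I); subst x'.
Qed.

Lemma within_continuousP (X Y : topologicalType) (D : set X) (f : X -> Y) :
  (forall x W, D x -> nbhs (f x) W -> \forall x' \near x, D x' -> W (f x')) <->
  {within D, continuous f}.
Proof.
rewrite subspace_continuousP; split=> [H x Dx W Wfx|H x W Dx Wfx]; exact: H.
Qed.

(** Closed graph theorem for a compact target: the part of [C] whose second coordinate avoids an
    open neighbourhood of [f x] projects to a closed set missing [x]. The set [C] has to be a graph
    only over [D]. *)
Lemma closed_graph_continuous (X Y : topologicalType) (D : set X) (f : X -> Y)
    (C : set (X * Y)) :
  compact [set: Y] -> closed C -> (forall x, D x -> C (x, f x)) ->
  (forall x y, D x -> C (x, y) -> y = f x) -> {within D, continuous f}.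
Proof.
move=> cY cC Cf Cuniq; apply/within_continuousP => x W Dx.
rewrite nbhsE => -[W0 [oW0 W0fx] W0W].
have cE : closed (fst @` (C `&` (snd @^-1` (~` W0)))).
  apply: proj_closed => //; apply: closedI => //.
  by apply: preimage_closed => [z _|]; [exact: cvg_snd|exact: open_closedC].
have : nbhs x (~` (fst @` (C `&` (snd @^-1` (~` W0))))).
  apply: open_nbhs_nbhs; split; first exact: closed_openC.
  by move=> [[? y] [/= Cxy nW] ?]; subst; apply: nW; rewrite (Cuniq _ _ Dx Cxy).
apply: filterS => x' nE Dx'; apply: W0W; apply: contrapT => nW.
by apply: nE; exists (x', f x') => //; split => //; exact: Cf.
Qed.

Lemma within_continuous_at (X Y Z : topologicalType) (D : set X) (f : X -> Y)
    (g : Z -> X) :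
  {within D, continuous f} -> continuous g -> (forall z, D (g z)) ->
  continuous (f \o g).
Proof.
move=> /within_continuousP cf cg Dg z W Wfz.
have := cf _ _ (Dg z) Wfz => H; have := cg z _ H.
by rewrite /nbhs /=; apply: filterS => z'; apply.
Qed.

Lemma within_continuous_comp2 (X Y Z : topologicalType) (D : set X) (f : X -> Y)
    (E : set Z) (g : Z -> X) :
  {within D, continuous f} -> {within E, continuous g} ->
  (forall z, E z -> D (g z)) ->
  {within E, continuous (f \o g)}.
Proof.
move=> /within_continuousP cf /within_continuousP cg Dg.
apply/within_continuousP => z W Ez Wfz.
have := cg z _ Ez (cf _ _ (Dg z Ez) Wfz); apply: filterS => z' H Ez'.
by apply: (H Ez'); exact: Dg.
Qed.

Lemma within_continuous_eq_closed (X Y : topologicalType) (D : set X)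
    (f g : X -> Y) :
  hausdorff_space Y -> closed D -> {within D, continuous f} ->
  {within D, continuous g} -> closed [set x | D x /\ f x = g x].
Proof.
move=> hY cD /within_continuousP cf /within_continuousP cg.
rewrite -[X in closed X]setCK; apply: open_closedC; rewrite openE => x /= nx.
have [Dx|nDx] := pselect (D x); last first.
  have : nbhs x (~` D) by apply: open_nbhs_nbhs; split => //; exact: closed_openC.
  by apply: filterS => x' nDx' [].
have : f x != g x by apply/eqP => ?; apply: nx.
move: hY; rewrite open_hausdorff =>
  /[apply] -[[A B] /= [/set_mem Af /set_mem Bg]] [oA oB AB].
have := cg x B Dx (open_nbhs_nbhs (conj oB Bg)).
apply: filterS2 (cf x A Dx (open_nbhs_nbhs (conj oA Af))) => x' Ax' Bx' [Dx' fg].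
have : (A `&` B) (f x') by split; [exact: Ax'|rewrite fg; exact: Bx'].
by rewrite (eqP AB).
Qed.

Section sup_fiber.
Context (R : realType) (Y Z : topologicalType) (D : set Y) (C : set (Y * Z)).
Variable g : Y * Z -> R.
Hypothesis cZ : compact [set: Z].
Hypothesis cC : closed C.
Hypothesis C_nonempty : forall y, D y -> exists z, C (y, z).
Hypothesis C_open : forall y z W, D y -> C (y, z) -> nbhs z W ->
  \forall y' \near y, D y' -> exists2 z', W z' & C (y', z').
Hypothesis cg : {within C, continuous g}.

Definition sup_fiber (y : Y) : R := sup [set g (y, z) | z in [set z | C (y, z)]].

Let upper_ctn y a : (forall z, C (y, z) -> g (y, z) < a) ->
  \forall y' \near y, forall z, C (y', z) -> g (y', z) < a.
Proof.
move=> Ha; have /compact_near_coveringP ncZ := cZ.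
have : \forall y' \near y, [set: Z] `<=` (fun z => C (y', z) -> g (y', z) < a).
  apply: ncZ => z _.
  suff : \forall yz \near (y, z), C yz -> g yz < a.
    by case=> -[A B] [/= Ay Bz] AB; exists (B, A) => // -[z' y'] [/= ? ?];
      exact: (AB (y', z')).
  have [Cyz|nC] := pselect (C (y, z)).
    have /within_continuousP := cg => /(_ _ [set x | x < a] Cyz); apply.
    by apply: open_nbhs_nbhs; split; [exact: open_lt|exact: Ha].
  have : nbhs (y, z) (~` C) by apply: open_nbhs_nbhs; split => //; exact: closed_openC.
  by apply: filterS.
by apply: filterS => y' sub z Cz; exact: sub.
Qed.

Lemma has_sup_fiber y : D y -> has_sup [set g (y, z) | z in [set z | C (y, z)]].
Proof.
move=> Dy; split; first by have [z Cz] := C_nonempty Dy; exists (g (y, z)), z.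
have /compact_near_coveringP ncZ := cZ.
(* The bound [M] runs along the filter at infinity, so compactness merges the local bounds into
   one. *)
have Hz : forall z, [set: Z] z -> \forall z' \near z & M \near pinfty_nbhs R, C (y,
  z') -> g (y, z') < M.
  move=> z _.
  have [Cyz|nC] := pselect (C (y, z)); last first.
    have : nbhs (y, z) (~` C) by apply: open_nbhs_nbhs; split => //; exact: closed_openC.
    case=> -[A B] [/= Ay Bz] AB; exists (B, setT); first by split => //; exact: filterT.
    by move=> [z' M] [/= Bz' _] Cyz'; case: (AB (y, z')) => //; split => //;
      exact: nbhs_singleton.
  have /within_continuousP := cg =>
    /(_ _ [set x | x < g (y, z) + 1] Cyz) [|[A B] [/= Ay Bz] AB].
    by apply: open_nbhs_nbhs; split; [exact: open_lt|rewrite /= ltrDl].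
  exists (B, [set M | g (y, z) + 1 < M]).
    by split => //=; exists (g (y, z) + 1); split => //; exact: num_real.
  move=> [z' M] [/= Bz' lM] Cz'; apply: lt_trans lM.
  by apply: (AB (y, z')) => //; split => //; exact: nbhs_singleton.
have [M [_ HM]] : \forall M \near pinfty_nbhs R, [set: Z] `<=` (fun z =>
  C (y, z) -> g (y, z) < M).
  exact: ncZ.
exists (M + 1) => _ [z /= Cz <-].
by apply/ltW; apply: (HM (M + 1)) => //; rewrite ltrDl.
Qed.

Lemma sup_fiber_ge y z : D y -> C (y, z) -> g (y, z) <= sup_fiber y.
Proof. by move=> Dy Cz; apply: (sup_upper_bound (has_sup_fiber Dy)); exists z. Qed.

Lemma sup_fiber_le y a : D y -> (forall z, C (y, z) -> g (y, z) <= a) -> sup_fiber y <= a.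
Proof.
move=> Dy Ha; apply: ge_sup; first by have [z Cz] := C_nonempty Dy; exists (g (y, z)), z.
by move=> _ [z Cz <-]; exact: Ha.
Qed.

(** Berge's maximum theorem. Compactness of [Z] gives the upper estimate, and [C_open] the lower
    one, by moving a nearly maximal point into nearby fibres. *)
Lemma sup_fiber_continuous : {within D, continuous sup_fiber}.
Proof.
apply/subspace_continuousP => y Dy; apply/cvgrPdist_le => e e0.
have up : \forall y' \near y, forall z, C (y', z) -> g (y', z) < sup_fiber y + e.
  by apply: upper_ctn => z Cz; apply: le_lt_trans (sup_fiber_ge Dy Cz) _; rewrite ltrDl.
have [_ [z Cz <-] lz] := sup_adherent e0 (has_sup_fiber Dy).
have /within_continuousP := cg =>
  /(_ _ [set x | sup_fiber y - e < x] Cz) [|[A B] [/= Ay Bz] AB].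
  by apply: open_nbhs_nbhs; split; [exact: open_gt|].
have := C_open Dy Cz Bz; rewrite near_withinE => op.
near=> y' => Dy'.
have [z' Bz' Cz'] : exists2 z', B z' & C (y', z') by apply: (near op y').
have h1 : sup_fiber y - e < g (y', z') by apply: (AB (y', z')) => //; split=> //=;
  near: y'.
have h2 : sup_fiber y' <= sup_fiber y + e.
  by apply: sup_fiber_le => // z'' Cz''; apply/ltW; move: z'' Cz''; near: y'.
have h3 := sup_fiber_ge Dy' Cz'.
have h4 : - e <= sup_fiber y - sup_fiber y' by rewrite lerBrDr; lra.
have h5 : sup_fiber y - sup_fiber y' <= e by rewrite lerBlDr; lra.
by rewrite ler_norml; apply/andP.
Unshelve. all: by end_near. Qed.

End sup_fiber.

End compact_tools.

(** * Stonean spaces *)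

Section stonean_spaces.

Lemma compact_hausdorff_shrink (X : topologicalType) (x : X) (W : set X) :
  compact_hausdorff X -> nbhs x W ->
  exists V, [/\ open V, V x & closure V `<=` W].
Proof.
move=> [cX hX] Wx; have := @compact_regular X x setT hX cX.
rewrite /filter_from /=; move=> /(_ filterT W Wx) [V Vx VW].
exists V°; split; first exact: open_interior.
  exact: Vx.
by apply: subset_trans VW; apply: closure_subset; exact: interior_subset.
Qed.

Lemma stonean_clopen_nbhs (L : topologicalType) (l : L) (W : set L) :
  stonean L -> nbhs l W -> exists N, [/\ clopen N, N l & N `<=` W].
Proof.
move=> [cL sL] /(compact_hausdorff_shrink cL) [V [oV Vl VW]].
exists (closure V); split => //; last exact: subset_closure.
by split; [exact: sL|exact: closed_closure].
Qed.

(** Since [closure B] is open, disjointness passes to the closures one side at a time. Injectivity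
    in Gleason's theorem rests on this. *)
Lemma stonean_disjoint_closure (L : topologicalType) (A B : set L) :
  stonean L -> open A -> open B -> A `&` B = set0 ->
  closure A `&` closure B = set0.
Proof.
move=> [_ sL] oA oB AB.
have AcB : A `&` closure B = set0.
  rewrite -subset0 => x [Ax /(_ _ (open_nbhs_nbhs (conj oA Ax)))] [y [By Ay]].
  by suff : set0 y by []; rewrite -AB; split.
rewrite -subset0 => x [+ clB] => /(_ _ (open_nbhs_nbhs (conj (sL _ oB) clB))) [y].
by rewrite AcB.
Qed.

(* Gleason's theorem: f is irreducible, hence injective over the Stonean space L,
   on a closed subset of Z minimal among those mapping onto L. *)
Lemma stonean_section (X L : topologicalType) (f : X -> L) (Z : set X) :
  stonean L -> compact_hausdorff X -> continuous f -> closed Z ->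
  (forall l, exists2 x, Z x & f x = l) ->
  exists u : L -> X, [/\ continuous u, forall l, Z (u l) & cancel u f].
Proof.
move=> sL [cX hX] cf cZ Zf; have [[cL hL] _] := sL.
(* Zorn's lemma is applied to the open sets whose removal from [Z] keeps [f] onto; removing a
   maximal one leaves a minimal closed set. *)
pose P (O : set X) := open O /\ forall l, exists2 x, Z x /\ ~ O x & f x = l.
have [|O [[oO ontoO] maxO]] := @Zorn_bigcup X P.
  move=> F FP totF; split; first by apply: bigcup_open => O /FP[].
  move=> l; apply: contrapT => nl.
  have cFl : closed (Z `&` f @^-1` [set l]).
    apply: closedI => //; apply: preimage_closed => //.
    by apply: accessible_closed_set1; exact: hausdorff_accessible.
  have [[O0 FO0]|F0] := pselect (F !=set0); last first.
    have [x Zx fx] := Zf l; apply: nl; exists x => //; split => // -[O FO].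
    by case: F0; exists O.
  have /compact_near_coveringP cpt : compact (Z `&` f @^-1` [set l]).
    exact: subclosed_compact cX _.
  (* The tails of the chain form a filter, along which compactness turns a cover of the fibre over
     [l] by the union into a cover by one member. *)
  pose Fil : set_system (set X) :=
    filter_from F (fun O => [set O' | F O' /\ O `<=` O']).
  have FilF : Filter Fil.
    apply: filter_from_filter; first by exists O0.
    move=> A B FA FB; have [AB|BA] := totF _ _ FA FB.
      by exists B => // C [FC BC]; split; split => //; exact: subset_trans BC.
    by exists A => // C [FC sAC]; split; split => //; exact: subset_trans sAC.
  have [|O FO HO] := cpt _ Fil (fun O x => O x) FilF.
    move=> x [Zx fx].
    have [O FO Ox] : exists2 O, F O & O x.
      apply: contrapT => nx; apply: nl; exists x => //; split => //.
    exists (O, [set O' | F O' /\ O `<=` O']) => /=.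
      split; last by exists O.
      by apply: open_nbhs_nbhs; split => //; have [] := FP _ FO.
    by move=> [x' O'] /= [Ox' [_ OO']]; exact: OO'.
  have [x [Zx nOx] fx] := (FP _ FO).2 l.
  by apply: nOx; apply: (HO O) => //; split.
pose Z' := Z `\` O.
have cZ' : closed Z' by apply: closedI => //; exact: open_closedC.
(* Irreducibility: arbitrarily near [f z] there are points whose whole fibre in [Z'] lies in [B].
   Otherwise [O] could be enlarged by the part of [B] over a neighbourhood of [f z]. *)
have dense (B : set X) z : open B -> Z' z -> B z ->
    closure (~` (f @` (Z' `\` B))) (f z).
  move=> oB [Zz nOz] Bz N; rewrite nbhsE => -[N0 [oN0 N0fz] N0N].
  have oBN : open (B `&` f @^-1` N0) by apply: openI => //; apply: open_comp.
  have : ~ P (O `|` (B `&` f @^-1` N0)).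
    apply: maxO; split; first exact: subsetUl.
    by move=> /(_ z); apply: contra_not nOz; apply; right.
  move=> /not_andP[|/existsNP[l nl]]; first by case; exact: openU.
  exists l; split.
    move=> [x [[Zx nOx] nBx] fx]; apply: nl; exists x => //; split => //.
    by case=> // -[].
  have [x [Zx nOx] fx] := ontoO l.
  apply: N0N; apply: contrapT => nN0; apply: nl; exists x => //; split => //.
  by case=> // -[_]; rewrite /= fx.
have injZ' x y : Z' x -> Z' y -> f x = f y -> x = y.
  move=> Z'x Z'y fxy; apply: contrapT => /eqP xy.
  move: hX; rewrite open_hausdorff =>
    /(_ _ _ xy) [[A B] /= [/set_mem Ax /set_mem By]] [oA oB /eqP AB].
  have op C : open C -> open (~` (f @` (Z' `\` C))).
    by move=> oC; apply: closed_openC; apply: closed_image => //; apply: closedI => //;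
      exact: open_closedC.
  (* The points whose whole fibre in [Z'] lies in [A], and those for [B], form disjoint open sets,
     but by [dense] both closures contain [f x]. *)
  have := stonean_disjoint_closure sL (op A oA) (op B oB).
  rewrite -!subset0 => H; apply: (H _ (f x)).
    move=> l [nA nB]; have [z [Zz nOz] fz] := ontoO l.
    have Az : A z by apply: contrapT => nAz; apply: nA; exists z.
    have Bz : B z by apply: contrapT => nBz; apply: nB; exists z.
    by suff : set0 z by []; rewrite -AB; split.
  by split; [exact: dense|rewrite fxy; exact: dense].
have [u uP] : {u : L -> X & forall l, Z' (u l) /\ f (u l) = l}.
  by apply: (@choice _ _ (fun l x => Z' x /\ f x = l)) => l;
    have [x Z'x fx] := ontoO l; exists x.
exists u; split; last 2 first.
- by move=> l; have [[]] := uP l.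
- by move=> l; have [] := uP l.
have : {within setT, continuous u}.
  apply: (@closed_graph_continuous _ _ setT u [set lx | Z' lx.2 /\ f lx.2 = lx.1]) => //.
  - apply: within_continuous_eq_closed => //.
    + by apply: preimage_closed => // z _; exact: cvg_snd.
    + by apply: continuous_subspaceT => z; apply: continuous_comp;
      [exact: cvg_snd|exact: cf].
    + by apply: continuous_subspaceT => z; exact: cvg_fst.
  - by move=> l _ /=; exact: uP.
  - by move=> l x _ /= [Z'x fx]; have [Z'u fu] := uP l; apply: injZ' => //; rewrite fu.
by rewrite continuous_subspace_setT.
Qed.

End stonean_spaces.

(** * The fixed factor *)

Section dynamical_systems.
Context (G : groupType) (K : topologicalType) (phi : G -> K -> K).
Hypothesis phi_system : dynamical_system phi.

Lemma action1 x : phi 1%g x = x.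
Proof.
have [_ /(_ 1%g) [_ [g [_ gK _]]] phiM] := phi_system.
by rewrite -[LHS]gK -[RHS]gK -phiM mulg1.
Qed.

Lemma actionK t : cancel (phi t) (phi t^-1%g).
Proof.
by move=> x; have [_ _ phiM] := phi_system; rewrite -phiM mulVg action1.
Qed.

Lemma actionKV t : cancel (phi t^-1%g) (phi t).
Proof.
by move=> x; have [_ _ phiM] := phi_system; rewrite -phiM mulgV action1.
Qed.

Lemma action_continuous t : continuous (phi t).
Proof. by have [_ /(_ t) []] := phi_system. Qed.

Lemma action_open t (A : set K) : open A -> open (phi t @` A).
Proof.
move=> oA; have -> : phi t @` A = phi t^-1%g @^-1` A.
  rewrite eqEsubset; split=> [_ [x Ax <-]|x Ax]; first by rewrite /= actionK.
  by exists (phi t^-1%g x) => //; rewrite actionKV.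
by apply: open_comp => // x _; exact: action_continuous.
Qed.

End dynamical_systems.

Lemma ptws_continuous (X V : topologicalType) (A : Type)
    (f : X -> {ptws A -> V}) :
  (forall a, continuous (fun x => f x a)) -> continuous f.
Proof.
move=> cf x; apply/cvg_sup => a; move: x.
apply/(@continuousP _ (initial_topology (@^~ a))) => B [C oC E]; rewrite -E.
by have := open_comp (fun x _ => cf a x) oC.
Qed.

Lemma ptws_eval_continuous (V : topologicalType) (A : eqType) (a : A) :
  continuous (fun f : {ptws A -> V} => f a).
Proof. exact: (@proj_continuous A (fun=> V) a). Qed.

Lemma set_type_val_continuous (T : topologicalType) (A : set T) :
  continuous (\val : set_type A -> T).
Proof. exact: initial_continuous. Qed.

Lemma set_type_hausdorff (T : topologicalType) (A : set T) :
  hausdorff_space T -> hausdorff_space (set_type A).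
Proof.
move=> hT x y xy; apply: val_inj; apply: hT => U V Ux Vy.
have cval : continuous (\val : set_type A -> T) by exact: initial_continuous.
have [z [Uz Vz]] := xy _ _ (cval x _ Ux) (cval y _ Vy).
by exists (\val z).
Qed.

Lemma set_type_compact (T : topologicalType) (A : set T) :
  compact A -> compact [set: set_type A].
Proof.
move=> /compact_near_coveringP cA; apply/compact_near_coveringP => I F P FF H.
have := cA I F (fun i x => forall Ax : x \in A, P i (exist _ x Ax)) FF _.
have H' : forall x : T, A x -> \forall x' \near x & i \near F, forall Ax : x' \in A,
  P i (exist _ x' Ax).
  move=> x Ax; have [[U V] /= [Ux FV] UV] := H (exist _ x (mem_set Ax)) Logic.I.
  case: Ux => W [[W' oW' W'W] /= Wx] WU.
  exists (W', V) => /=.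
    by split => //; apply: open_nbhs_nbhs; split => //; move: Wx; rewrite -W'W.
  move=> [x' i] /= [W'x' Vi] Ax'; apply: (UV (_, i)); split => //=.
  by apply: WU; rewrite -W'W.
move=> /(_ H'); apply: filterS => i sub [x Ax] _; apply: sub; exact: set_mem.
Qed.

Lemma norm_preserving_continuous (R : realType) (f : cplx R -> cplx R) :
  (forall z z', `|f z - f z'| = `|z - z'|) -> continuous f.
Proof.
move=> fE z W /nbhs_ballP[e e0 We]; apply/nbhs_ballP; exists e => // z' zz'.
by apply: We; move: zz'; rewrite -!(@ball_normE (cplx R) (cplx R)) /= fE.
Qed.

Lemma conjC_continuous (R : realType) : continuous (Num.conj : cplx R -> cplx R).
Proof.
by apply: norm_preserving_continuous => z z'; rewrite -rmorphB norm_conjC.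
Qed.

Section fixed_factor_topology.
Context (R : realType) (G : groupType) (L : topologicalType) (psi : G -> L -> L).
Hypothesis psi_system : dynamical_system psi.
Local Notation M := (fixed_factor R psi).
Local Notation qfix := (@fixed_factor_map R G L psi).
Local Notation fix_psi := (fixed_functions R psi).

Lemma fixed_factor_map_eqP l l' :
  (qfix l = qfix l') <-> (forall f, fix_psi f -> f l = f l').
Proof.
split=> [/(congr1 val) /= H f fixf|H].
  by have := congr1 (fun chi => chi (Sub f (mem_set fixf))) H.
by apply: val_inj; apply/funext => f /=; apply: H; exact: set_valP.
Qed.

Lemma fixed_factor_map_continuous : continuous qfix.
Proof.
apply: continuous_comp_initial; apply: ptws_continuous => f l.
by have [cf _] := set_valP f; exact: cf.
Qed.

Lemma fixed_functions_cst a : fix_psi (fun=> a).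
Proof. by split=> // l; exact: cst_continuous. Qed.

Lemma fixed_functionsD f g : fix_psi f -> fix_psi g -> fix_psi (f + g).
Proof.
move=> [cf ff] [cg gg]; split=> [l|t]; first exact: cvgD (cf l) (cg l).
by rewrite -[in RHS](ff t) -[in RHS](gg t).
Qed.

Lemma fixed_functionsM f g : fix_psi f -> fix_psi g -> fix_psi (f * g).
Proof.
move=> [cf ff] [cg gg]; split=> [l|t]; first exact: cvgM (cf l) (cg l).
by rewrite -[in RHS](ff t) -[in RHS](gg t).
Qed.

Lemma fixed_functions_conj f : fix_psi f -> fix_psi (fun l => (f l)^*).
Proof.
move=> [cf ff]; split=> [l|t].
  by apply: continuous_comp; [exact: cf|exact: conjC_continuous].
by apply/funext => l /=; rewrite -{2}(ff t).
Qed.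

Lemma fixed_functionsV f : fix_psi f -> (forall l, f l != 0) ->
  fix_psi (fun l => (f l)^-1).
Proof.
move=> [cf ff] f0; split=> [l|t]; first by apply: cvgV => //; exact: cf.
by apply/funext => l /=; rewrite -{2}(ff t).
Qed.

(* A character of the fixed algebra is the evaluation at any common zero of the
   nonnegative functions in its kernel. *)
Lemma fixed_factor_map_surjective (m : M) : exists l, qfix l = m.
Proof.
have [[cL _] _ _] := psi_system.
case: m => chi chiP; have [[f0 chif0] chiL chiM] := set_mem chiP.
pose S f (fixf : fix_psi f) : set_type fix_psi := Sub f (mem_set fixf).
pose J := [set h | exists fixh : fix_psi h, chi (S h fixh) = 0 /\ forall l, 0 <= h l].
have chi1 : chi (S _ (fixed_functions_cst 1)) = 1.
  apply: (mulfI chif0); rewrite mulr1 -(chiM f0 (S _ (fixed_functions_cst 1)) f0) //.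
  by rewrite /= mulr1.
have chiC a (fixa : fix_psi (fun=> a)) : chi (S _ fixa) = a.
  have chi00 (fix0 : fix_psi (fun=> 0)) : chi (S _ fix0) = 0.
    have := chiL 1 (S _ fix0) (S _ fix0) (S _ fix0) _.
    rewrite /= scale1r addr0 mul1r => /(_ erefl) /eqP.
    by rewrite -subr_eq0 opprD addrA subrr add0r oppr_eq0 => /eqP.
  have E : \val (S _ fixa) = a *: \val (S _ (fixed_functions_cst 1)) + \val (S _
    (fixed_functions_cst 0)).
    apply/funext => l /=.
    by transitivity (a * 1 + 0); [rewrite mulr1 addr0|].
  by rewrite (chiL _ _ _ _ E) chi1 chi00 mulr1 addr0.
have chiD f g (fixf : fix_psi f) (fixg : fix_psi g) (fixfg : fix_psi (f + g)) :
    chi (S _ fixfg) = chi (S _ fixf) + chi (S _ fixg).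
  by rewrite (chiL 1 (S _ fixf) (S _ fixg)) ?mul1r//= scale1r.
(* Without a zero, [h] would be invertible in the fixed algebra, where a character cannot vanish. *)
have J0 h : J h -> exists l, h l = 0.
  move=> [fixh [chih h0]]; apply: contrapT => nz.
  have hl0 l : h l != 0 by apply/eqP => hl; apply: nz; exists l.
  have := chiM (S _ fixh) (S _ (fixed_functionsV fixh hl0)) (S _ (fixed_functions_cst
    1)) _.
  rewrite chi1 chih mul0r => /(_ _)/eqP; rewrite oner_eq0 => H; apply/notF/H.
  by apply/funext => l; transitivity (h l * (h l)^-1); [rewrite mulfV|].
have JD h1 h2 : J h1 -> J h2 -> J (h1 + h2).
  move=> [fix1 [chi_h1 pos1]] [fix2 [chi_h2 pos2]].
  exists (fixed_functionsD fix1 fix2); rewrite chiD chi_h1 chi_h2 addr0.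
  by split=> // l; rewrite addr_ge0.
(* By nonnegativity a zero of a sum is a common zero, so the zero sets form a filter base. *)
pose F : set_system L := filter_from J (fun h => [set l | h l = 0]).
have FF : ProperFilter F.
  apply: filter_from_proper; last by move=> h /J0.
  apply: filter_from_filter.
    by exists (fun=> 0), (fixed_functions_cst 0); split.
  move=> h1 h2 J1 J2; exists (h1 + h2); first exact: JD.
  move=> l /eqP /=; have [_ [_ /(_ l) p1]] := J1; have [_ [_ /(_ l) p2]] := J2.
  by rewrite [(_ + _) l]/(h1 l + h2 l) paddr_eq0// => /andP[/eqP ? /eqP ?].
have [l [_ clF]] := cL F FF filterT.
exists l; apply: val_inj; apply/funext => -[f fP] /=.
have fixf := set_mem fP.
pose g := f + (fun=> - chi (S _ fixf)).
have fixg : fix_psi g by apply: fixed_functionsD => //; exact: fixed_functions_cst.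
have chig : chi (S _ fixg) = 0 by rewrite (chiD f _ fixf (fixed_functions_cst _)) chiC
  subrr.
(* The squared modulus of [f - chi f] is a nonnegative function in the kernel, so it vanishes at
   [l], whence [f l = chi f]. *)
pose h := g * (fun l => (g l)^*).
have fixh : fix_psi h by apply: fixed_functionsM => //; exact: fixed_functions_conj.
have Jh : J h.
  exists fixh; split.
    by rewrite (chiM (S _ fixg) (S _ (fixed_functions_conj fixg)))// chig mul0r.
  by move=> l'; rewrite /h [(_ * _) l']/(g l' * (g l')^*) mul_conjC_ge0.
have clh : closed [set l | h l = 0].
  have := within_continuous_eq_closed (@norm_hausdorff _ _) closedT
    (continuous_subspaceT fixh.1) (continuous_subspaceT (fixed_functions_cst 0).1).
  by congr closed; rewrite eqEsubset; split=> [l' []|l'] /=.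
have : h l = 0.
  apply: clh => N Nl; apply: (clF _ N _ Nl).
  by exists h.
rewrite /h [(_ * _) l]/(g l * (g l)^*) => /eqP; rewrite mul_conjC_eq0 => /eqP.
rewrite /g [(_ + _) l]/(f l + - chi (S _ fixf)) => /eqP; rewrite subr_eq0 => /eqP ->.
by congr chi; apply: val_inj.
Qed.

Lemma fixed_factor_compact_hausdorff : compact_hausdorff M.
Proof.
have [[cL _] _ _] := psi_system; split; last first.
  apply: set_type_hausdorff; apply: (@hausdorff_product _ (fun=> cplx R)) => f.
  exact: norm_hausdorff.
have -> : [set: M] = qfix @` setT.
  by rewrite eqEsubset; split=> // m _; have [l ?] := fixed_factor_map_surjective m;
    exists l.
apply: continuous_compact => //; apply: continuous_subspaceT.
exact: fixed_factor_map_continuous.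
Qed.

(** The indicator function of [C] is continuous and fixed, and fixed functions do not separate [l]
    from [l']. Forward invariance yields backward invariance through the inverse group element. *)
Lemma clopen_invariant_saturated (C : set L) : clopen C ->
  (forall t l, C l -> C (psi t l)) ->
  forall l l', qfix l = qfix l' -> C l -> C l'.
Proof.
move=> [oC cC] Cinv l l' /fixed_factor_map_eqP ll' Cl.
pose f l := if `[< C l >] then 1 else 0 : cplx R.
have fixf : fix_psi f.
  split=> [x|t].
    have [Cx|nCx] := pselect (C x).
      suff near_f : \forall y \near x, f y = f x by apply: cvg_near_cst.
      have : nbhs x C by apply: open_nbhs_nbhs.
      by apply: filterS => y Cy; rewrite /f !asboolT.
    suff near_f : \forall y \near x, f y = f x by apply: cvg_near_cst.
    have : nbhs x (~` C) by apply: open_nbhs_nbhs; split => //; exact: closed_openC.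
    by apply: filterS => y nCy; rewrite /f !asboolF.
  apply/funext => x; rewrite /f /=; congr (if _ then _ else _).
  apply/asbool_equiv_eq; split=> [Cx|]; last exact: Cinv.
  by rewrite -[x](actionKV psi_system t); exact: Cinv.
have := ll' _ fixf; rewrite /f asboolT//; case: asboolP => // _ /eqP.
by rewrite oner_eq0.
Qed.

Hypothesis L_stonean : stonean L.

(** The closure makes the union of the translates of an open [V] clopen, as [L] is Stonean; by the
    previous lemma it is then a union of fibres of [qfix]. *)
Let saturation (V : set L) : set L := closure (\bigcup_t (psi t @` V)).

Let saturation_clopen V : open V -> clopen (saturation V).
Proof.
move=> oV; split; last exact: closed_closure.
apply: L_stonean.2; apply: bigcup_open => t _; exact: action_open.
Qed.

Let saturation_invariant V t l : saturation V l -> saturation V (psi t l).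
Proof.
move=> Vl N Nl; have [l' [[s _ [x Vx xl']] Nl']] :=
  Vl _ (action_continuous psi_system Nl).
exists (psi t l'); split => //; exists (t * s)%g => //; exists x => //.
by have [_ _ ->] := psi_system; rewrite xl'.
Qed.

Let sub_saturation V : V `<=` saturation V.
Proof.
move=> l Vl; apply: subset_closure; exists 1%g => //; exists l => //.
exact: (action1 psi_system).
Qed.

(** The saturation of an open neighbourhood of [l1] contains [l2], so [V2] meets one of the
    translates whose closure it is. *)
Lemma orbit_relation_dense l1 l2 (V1 V2 : set L) : qfix l1 = qfix l2 ->
  nbhs l1 V1 -> nbhs l2 V2 -> exists t a, V1 a /\ V2 (psi t a).
Proof.
rewrite (nbhsE l1) => l12 [V [oV Vl1] VV1] V2l2.
have := clopen_invariant_saturated (saturation_clopen oV) (@saturation_invariant V) l12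
  (sub_saturation Vl1).
move=> /(_ _ V2l2) [_ [[t _ [x Vx <-]] V2x]].
by exists t, x; split => //; exact: VV1.
Qed.

(** A clopen [N] and its saturation have the same image, since the points mapped into the image of
    [N] form a closed set containing all translates. The saturation is clopen and a union of fibres,
    so the complement of its image is the closed image of its complement. *)
Lemma fixed_factor_map_open : open_map qfix.
Proof.
move=> V oV; rewrite openE => _ [l Vl <-].
have [N [clN Nl NV]] := stonean_clopen_nbhs L_stonean (open_nbhs_nbhs (conj oV Vl)).
have [[cL hL] _] := L_stonean; have [cM hM] := fixed_factor_compact_hausdorff.
have cqf := fixed_factor_map_continuous.
have E : qfix @` N = qfix @` saturation N.
  rewrite eqEsubset; split; first by apply: image_subset; exact: sub_saturation.
  have cN : closed (qfix @^-1` (qfix @` N)).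
    by apply: preimage_closed => [? _|]; [exact: cqf|apply: closed_image => //;
      case: clN].
  move=> _ [x satx <-]; have : closure (qfix @^-1` (qfix @` N)) x.
    move: x satx; apply: closure_subset => _ [t _ [y Ny <-]].
    by exists y => //; rewrite fixed_factor_mapE.
  by move=> /cN.
have oE : open (qfix @` N).
  rewrite E -[X in open X]setCK; apply: closed_openC.
  have -> : ~` (qfix @` saturation N) = qfix @` (~` saturation N).
    rewrite eqEsubset; split=> m.
      have [x xm] := fixed_factor_map_surjective m; rewrite -xm => nm.
      by exists x => // satx; apply: nm; exists x.
    move=> [x nx <-] [y saty yx]; apply: nx.
    exact: (clopen_invariant_saturated (saturation_clopen clN.1) (@saturation_invariant
      N) yx).
  by apply: closed_image => //; apply: open_closedC; case: (saturation_clopen clN.1).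
have : nbhs (qfix l) (qfix @` N) by apply: open_nbhs_nbhs; split => //; exists l.
by apply: filterS; exact: image_subset.
Qed.

(** As [qfix] is open, closures can be computed upstairs, where they are open, and pushed down
    again. *)
Lemma fixed_factor_stonean : stonean M.
Proof.
split; first exact: fixed_factor_compact_hausdorff.
move=> A oA.
have -> : closure A = qfix @` (closure (qfix @^-1` A)).
  rewrite eqEsubset; split=> m.
    have [l <-] := fixed_factor_map_surjective m => Al; exists l => // N.
    rewrite nbhsE => -[N0 [oN0 N0l] N0N].
    have [|m' [Am' [x N0x xm']]] := Al (qfix @` N0).
      by apply: open_nbhs_nbhs; split; [exact: fixed_factor_map_open|exists l].
    by exists x; split; [rewrite /= xm'|exact: N0N].
  move=> [l Al <-] N Nl; have [x [Ax Nx]] := Al _ (fixed_factor_map_continuous Nl).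
  by exists (qfix x).
apply: fixed_factor_map_open; apply: L_stonean.2; apply: open_comp => // x _.
exact: fixed_factor_map_continuous.
Qed.

End fixed_factor_topology.

Lemma eq_closed (X Y : topologicalType) (f g : X -> Y) :
  hausdorff_space Y -> continuous f -> continuous g ->
  closed [set x | f x = g x].
Proof.
move=> hY cf cg.
have := within_continuous_eq_closed hY closedT (continuous_subspaceT cf)
  (continuous_subspaceT cg).
by congr closed; rewrite eqEsubset; split=> [x []|x].
Qed.

Lemma pair_continuous (X Y Z : topologicalType) (f : X -> Y) (g : X -> Z) :
  continuous f -> continuous g -> continuous (fun x => (f x, g x)).
Proof. by move=> cf cg x; apply: cvg_pair; [exact: cf|exact: cg]. Qed.

Lemma continuous_fst (X Y : topologicalType) : continuous (@fst X Y).
Proof. by move=> x; exact: cvg_fst. Qed.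

Lemma continuous_snd (X Y : topologicalType) : continuous (@snd X Y).
Proof. by move=> x; exact: cvg_snd. Qed.

Lemma comp_continuous (X Y Z : topologicalType) (f : X -> Y) (g : Y -> Z) :
  continuous f -> continuous g -> continuous (fun x => g (f x)).
Proof. by move=> cf cg x; apply: continuous_comp; [exact: cf|exact: cg]. Qed.

Lemma id_continuous (X : topologicalType) : continuous (fun x : X => x).
Proof. by move=> x; exact: cvg_id. Qed.

Lemma prod_hausdorff (X Y : topologicalType) :
  hausdorff_space X -> hausdorff_space Y -> hausdorff_space (X * Y)%type.
Proof.
move=> hX hY [x y] [x' y'] H; congr (_, _).
  apply: hX => A B Ax Bx.
  have [[a b] [/= Aa Ba]] := H _ _ (@continuous_fst X Y (x,
    y) A Ax) (@continuous_fst X Y (x', y') B Bx).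
  by exists a.
apply: hY => A B Ay By.
have [[a b] [/= Aa Ba]] := H _ _ (@continuous_snd X Y (x,
  y) A Ay) (@continuous_snd X Y (x', y') B By).
by exists b.
Qed.

Lemma within_pair_continuous (X Y Z : topologicalType) (D : set X) (f : X -> Y)
    (g : X -> Z) : {within D, continuous f} -> {within D, continuous g} ->
  {within D, continuous (fun x => (f x, g x))}.
Proof.
move=> /within_continuousP cf /within_continuousP cg; apply/within_continuousP.
move=> x W Dx [[W1 W2] /= [W1f W2g] W12].
apply: filterS2 (cf x W1 Dx W1f) (cg x W2 Dx W2g) => x' W1x' W2x' Dx'.
by apply: W12; split; [exact: W1x'|exact: W2x'].
Qed.

Lemma real_complex_continuous (R : realType) :
  continuous (fun x : R => x%:C%C : cplx R).
Proof.
move=> x W /nbhs_ballP[e e0 We].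
have eR : 0 < complex.Re e by move: e0; rewrite /= ltcE => /andP[].
have eE : e = (complex.Re e)%:C%C.
  by move: e0; rewrite /= ltcE => /andP[/eqP]; case: (e) => a b /= ->.
apply/nbhs_ballP; exists (complex.Re e) => // y.
rewrite -(@ball_normE R R) /= => xy; apply: We.
rewrite -(@ball_normE (cplx R) (cplx R)) /= -rmorphB /= eE.
by rewrite normc_def /= expr0n /= addr0 sqrtr_sqr ltcR.
Qed.

(** * Pseudometrics from projective modules *)

Section complex_modulus.
Context (R : realType).
Implicit Types z : cplx R.

(** The norm of [cplx R] takes its values in [cplx R]; suprema and estimates require the
    corresponding element of [R]. *)
Definition modulus z : R := complex.Re `|z|.

Lemma modulusE z : (modulus z)%:C%C = `|z|.
Proof. by rewrite /modulus normc_def. Qed.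

Lemma modulus_ge0 z : 0 <= modulus z.
Proof. by rewrite -lecR modulusE normr_ge0. Qed.

Lemma modulusM z z' : modulus (z * z') = modulus z * modulus z'.
Proof. by apply: complexI; rewrite rmorphM /= !modulusE normrM. Qed.

Lemma modulusD z z' : modulus (z + z') <= modulus z + modulus z'.
Proof. by rewrite -lecR rmorphD /= !modulusE ler_normD. Qed.

Lemma modulusN z : modulus (- z) = modulus z.
Proof. by apply: complexI; rewrite !modulusE normrN. Qed.

Lemma modulus_eq0 z : (modulus z == 0) = (z == 0).
Proof. by rewrite -(inj_eq (@complexI R)) modulusE normr_eq0. Qed.

Lemma modulus0 : modulus 0 = 0.
Proof. by apply/eqP; rewrite modulus_eq0. Qed.

Lemma modulusV z : modulus z^-1 = (modulus z)^-1.
Proof. by apply: complexI; rewrite modulusE normfV fmorphV /= modulusE. Qed.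

Lemma modulus_real (a : R) : 0 <= a -> modulus (a%:C%C) = a.
Proof. by move=> a0; apply: complexI; rewrite modulusE ger0_norm// lecR. Qed.

Lemma modulusB_eq0 z z' : modulus (z - z') = 0 -> z = z'.
Proof. by move=> /eqP; rewrite modulus_eq0 subr_eq0 => /eqP. Qed.

Lemma ball_modulus z z' (e : R) : ball z (e%:C%C) z' <-> modulus (z - z') < e.
Proof. by rewrite -(@ball_normE (cplx R) (cplx R)) /= -modulusE ltcR. Qed.

Lemma gt0_complexE (e : cplx R) : 0 < e -> exists2 a : R, 0 < a & e = a%:C%C.
Proof.
by case: e => a b; rewrite ltcE /= => /andP[/eqP b0 a0]; exists a => //;
  congr (_ +i* _)%C.
Qed.

Lemma nbhs_modulusP z W :
  nbhs z W <-> exists2 e : R, 0 < e & forall z', modulus (z - z') < e -> W z'.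
Proof.
split=> [/nbhs_ballP[_ /= /gt0_complexE[e e0 ->] eW]|[e e0 eW]].
  by exists e => // z' /ball_modulus; exact: eW.
by apply/nbhs_ballP; exists (e%:C%C) => [|z' /ball_modulus]; [rewrite /= ltcR|exact: eW].
Qed.

Lemma modulus_continuous : continuous modulus.
Proof.
move=> z W /nbhs_ballP[e /= e0 eW]; apply/nbhs_modulusP; exists e => // z' zz'.
apply: eW; rewrite -(@ball_normE R R) /=; apply: le_lt_trans zz'.
have sym : modulus (z' - z) = modulus (z - z') by rewrite -modulusN opprB.
have h1 := modulusD (z - z') z'; have h2 := modulusD (z' - z) z.
rewrite !subrK in h1 h2; rewrite ler_norml; apply/andP; split; lra.
Qed.

Lemma modulus_ball_compact (B : R) : compact [set z | modulus z <= B].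
Proof.
pose f (ab : R * R) : cplx R := ab.1%:C%C + 'i * ab.2%:C%C.
have cf : continuous f.
  have c1 := comp_continuous (@continuous_fst R R) (@real_complex_continuous R).
  have c2 := comp_continuous (@continuous_snd R R) (@real_complex_continuous R).
  by move=> ab; apply: cvgD; [exact: c1|apply: cvgM; [exact: cvg_cst|exact: c2]].
have : compact (f @` (`[- B, B] `*` `[- B, B])).
  apply: continuous_compact; first exact: continuous_subspaceT.
  by apply: compact_setX; exact: segment_compact.
move=> cim; apply: (subclosed_compact _ cim).
  by have /continuous_closedP/(_ _ (@closed_le R B)) := modulus_continuous.
move=> [a b] /= ab; exists (a, b) => //=; last first.
  by rewrite /f /= (_ : 'i = 'i%C)//; apply/eqP;
    rewrite eq_complex /= !(mul0r, mul1r, mulr0, addr0, add0r, subr0) !eqxx.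
have [ha hb] : `|a| <= B /\ `|b| <= B.
  have sq (c : R) : c ^+ 2 <= a ^+ 2 + b ^+ 2 -> `|c| <= B.
    move=> cab; apply: le_trans ab; rewrite /modulus normc_def /= -sqrtr_sqr.
    by rewrite ler_wsqrtr.
  by split; apply: sq; rewrite ?lerDl ?lerDr sqr_ge0.
by split; rewrite /= in_itv /= -ler_norml.
Qed.

End complex_modulus.

Lemma sum_continuous (R : realType) (X : topologicalType) n (f : 'I_n -> X -> cplx R) :
  (forall i, continuous (f i)) -> continuous (fun x => \sum_(i < n) f i x).
Proof.
by move=> cf; apply: continuous_big => // ; exact: add_continuous.
Qed.

Section uniform_closure.
Context (R : realType) (T : topologicalType).

Lemma uniform_closureP (A : set (T -> cplx R)) f :
  closure (A : set {uniform T -> cplx R}) f <->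
  forall e : R, 0 < e -> exists2 g, A g & forall x, modulus (f x - g x) < e.
Proof.
split=> [clA e e0|H W /uniform_nbhs [E [entE EW]]].
  pose W : set {uniform T -> cplx R} := [set h | forall y,
    [set: T] y -> [set zz | ball zz.1 (e%:C%C) zz.2] (f y, h y)].
  have [|g [Ag Wg]] := clA W.
    apply/uniform_nbhs; exists [set zz | ball zz.1 (e%:C%C) zz.2]; split => //.
    rewrite -entourage_ballE; exists (e%:C%C) => //=; by rewrite ltcR.
  by exists g => // x; apply/ball_modulus; exact: (Wg x).
move: entE; rewrite -entourage_ballE => -[_ /= /gt0_complexE[e e0 ->] eE].
have [g Ag fg] := H _ e0.
exists g; split => //; apply: EW => y _; apply: (eE (f y, g y)) => /=.
by apply/ball_modulus; exact: fg.
Qed.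

(** Supplies the closedness of the C*-subalgebra used in [discrete_spectrum_separates]. *)
Lemma uniform_limit_eq (x y : T) :
  uniformly_closed [set f : T -> cplx R | continuous f /\ f x = f y].
Proof.
move=> f /uniform_closureP clf; split.
  move=> z W /nbhs_modulusP[e e0 eW].
  have e3 : 0 < e / 3 by rewrite divr_gt0.
  have [g [cg _] fg] := clf _ e3.
  have gB : nbhs (g z) [set w | modulus (g z - w) < e / 3].
    by apply/nbhs_modulusP; exists (e / 3).
  have : nbhs z [set z' | modulus (g z - g z') < e / 3] := cg z _ gB.
  apply: filterS => z' /= gz; apply: eW.
  have -> : f z - f z' = (f z - g z) + (g z - g z') + (- (f z' - g z')).
    by ring.
  have h1 := modulusD (f z - g z + (g z - g z')) (- (f z' - g z')).
  have h2 := modulusD (f z - g z) (g z - g z').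
  have := fg z; have := fg z'; rewrite modulusN in h1; lra.
apply: modulusB_eq0; apply/eqP; rewrite eq_le modulus_ge0 andbT.
apply/ler_addgt0Pr => e e0; rewrite add0r.
have e2 : 0 < e / 2 by rewrite divr_gt0.
have [g [_ gxy] fg] := clf _ e2.
have -> : f x - f y = (f x - g x) + (- (f y - g y)) by rewrite gxy opprB addrA subrK.
have := modulusD (f x - g x) (- (f y - g y)); rewrite modulusN.
have := fg x; have := fg y; lra.
Qed.

End uniform_closure.

(** * Coefficient functionals of a projective module *)

Section projective_modules.
Context (R : realType) (K L : topologicalType) (q : K -> L).
Implicit Types M : set (K -> cplx R).

(** The alias records [subM], from which the instances below take the closure properties of [M]. *)
Definition module_of M (subM : submodule q M) : Type := set_type M.

Section module_structure.
Variables (M : set (K -> cplx R)) (subM : submodule q M).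
Local Notation V := (module_of subM).

HB.instance Definition _ := gen_eqMixin V.
HB.instance Definition _ := gen_choiceMixin V.

Let M0 : M 0. Proof. by case: subM. Qed.
Let MD g h : M g -> M h -> M (g + h). Proof. by case: subM => _ _ + _; apply. Qed.
Let MZ (a : cfun R L) g : M g -> M ((a \o q) * g). Proof. by case: subM => _ _ _;
  apply. Qed.
Let MN g : M g -> M (- g).
Proof.
move=> Mg; have := MZ (-1) Mg; congr M; apply/funext => k.
by transitivity (- 1 * g k); rewrite // mulN1r.
Qed.

Definition module_elt g (Mg : M g) : V := Sub g (mem_set Mg).
Definition module_fun (x : V) : K -> cplx R := \val (x : set_type M).

Lemma module_funP x : M (module_fun x).
Proof. exact: set_valP. Qed.

Lemma module_fun_inj : injective module_fun.
Proof. exact: val_inj. Qed.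

Let add (x y : V) : V := module_elt (MD (module_funP x) (module_funP y)).
Let opp (x : V) : V := module_elt (MN (module_funP x)).
Let zero : V := module_elt M0.
Let scale (a : cfun R L) (x : V) : V := module_elt (MZ a (module_funP x)).

Let addA : associative add.
Proof. by move=> x y z; apply: module_fun_inj; exact: addrA. Qed.
Let addC : commutative add.
Proof. by move=> x y; apply: module_fun_inj; exact: addrC. Qed.
Let add0 : left_id zero add.
Proof. by move=> x; apply: module_fun_inj; exact: add0r. Qed.
Let addN : left_inverse zero opp add.
Proof. by move=> x; apply: module_fun_inj; exact: addNr. Qed.

HB.instance Definition _ := GRing.isZmodule.Build V addA addC add0 addN.

Let scaleA a b x : scale a (scale b x) = scale (a * b) x.
Proof. by apply: module_fun_inj; apply/funext => k; exact: mulrA. Qed.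
Let scale1 : left_id 1 scale.
Proof. by move=> x; apply: module_fun_inj; apply/funext => k; exact: mul1r. Qed.
Let scaleDr : right_distributive scale +%R.
Proof. by move=> a x y; apply: module_fun_inj; apply/funext => k; exact: mulrDr. Qed.
Let scaleDl x : {morph scale^~ x : a b / a + b}.
Proof. by move=> a b; apply: module_fun_inj; apply/funext => k; exact: mulrDl. Qed.

HB.instance Definition _ := GRing.Zmodule_isLmodule.Build (cfun R L) V
  scaleA scale1 scaleDr scaleDl.

Lemma module_funD (x y : V) : module_fun (x + y) = module_fun x + module_fun y.
Proof. by []. Qed.

Lemma module_funZ a (x : V) : module_fun (a *: x) = (a \o q) * module_fun x.
Proof. by []. Qed.

Lemma module_fun_sum n (x : 'I_n -> V) :
  module_fun (\sum_(i < n) x i) = \sum_(i < n) module_fun (x i).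
Proof.
elim: n x => [|n IH] x; first by rewrite !big_ord0.
by rewrite !big_ord_recr /= module_funD IH.
Qed.

Section generators.
Variables (n : nat) (e : 'I_n -> K -> cplx R).
Hypothesis Me : forall i, M (e i).

Definition combination (a : 'rV[cfun R L]_n) : V :=
  \sum_(i < n) a 0 i *: module_elt (Me i).

Lemma combination_linear : linear combination.
Proof.
move=> a u v; rewrite /combination scaler_sumr -big_split; apply: eq_bigr => i _.
by rewrite !mxE scalerDl scalerA.
Qed.

HB.instance Definition _ := GRing.isLinear.Build (cfun R L) 'rV[cfun R L]_n V
  *:%R combination combination_linear.

Lemma combinationE a :
  module_fun (combination a) = \sum_(i < n) (a 0 i \o q) * e i.
Proof. by rewrite module_fun_sum. Qed.

End generators.
End module_structure.

(** Projectivity lifts the identity of [M] through the surjection from the free module given by the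
    generators; the coordinates of the lift are [s]. *)
Lemma projective_splitting M n (e : 'I_n -> K -> cplx R) :
  submodule q M -> (forall i, M (e i)) ->
  (forall g, M g -> exists a : 'I_n -> cfun R L, g = \sum_(i < n) (a i \o q) * e i) ->
  projective q M ->
  exists s : (K -> cplx R) -> 'I_n -> cfun R L,
    [/\ forall g h i l, M g -> M h -> s (g + h) i l = s g i l + s h i l,
        forall (a : cfun R L) g i l, M g -> s ((a \o q) * g) i l = a l * s g i l &
        forall g k, M g -> g k = \sum_(i < n) s g i (q k) * e i k].
Proof.
move=> subM Me eM projM.
(* The identity of [M], extended by the irrelevant value 0. *)
pose f g : module_of subM := if pselect (M g) is left Mg then module_elt subM Mg else 0.
have fE g : M g -> module_fun (f g) = g by rewrite /f; case: pselect.
have [||h [[hD hZ] hE]] := projM 'rV[cfun R L]_n (module_of subM) (combination subM Me) f.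
- move=> b; have [a ba] := eM _ (module_funP b).
  exists (\row_i a i); apply: module_fun_inj; rewrite combinationE ba.
  by apply: eq_bigr => i _; rewrite mxE.
- have [_ _ MD MZ] := subM; split=> [g g' Mg Mg'|a g Mg]; apply: module_fun_inj.
    by rewrite module_funD !fE//; exact: MD.
  by rewrite module_funZ !fE//; exact: MZ.
exists (fun g i => h g 0 i); split.
- by move=> g g' i l Mg Mg'; rewrite hD// mxE.
- by move=> a g i l Mg; rewrite hZ// mxE.
move=> g k Mg; rewrite -{1}(fE g Mg) -hE// combinationE fct_sumE.
by apply: eq_bigr.
Qed.

End projective_modules.

Section fiber_sup.
Context (R : realType) (K L Y : topologicalType) (q : K -> L) (b : Y -> L).
Hypotheses (cK : compact [set: K]) (hL : hausdorff_space L).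
Hypotheses (cq : continuous q) (q_surj : forall l, exists k, q k = l).
Hypotheses (q_open : open_map q) (cb : continuous b).
Variable F : Y * K -> R.
Hypothesis cF : continuous F.

Let C : set (Y * K) := [set yz | q yz.2 = b yz.1].

Let C_closed : closed C.
Proof.
apply: eq_closed => //; first exact: comp_continuous (@continuous_snd _ _) cq.
exact: comp_continuous (@continuous_fst _ _) cb.
Qed.

Let C_nonempty y : setT y -> exists z, C (y, z).
Proof. by move=> _; have [k ?] := q_surj (b y); exists k. Qed.

Let C_open y z W : setT y -> C (y, z) -> nbhs z W ->
  \forall y' \near y, setT y' -> exists2 z', W z' & C (y', z').
Proof.
move=> _ /= yz; rewrite nbhsE => -[V [oV Vz] VW].
have nb : nbhs (b y) (q @` V) by apply: open_nbhs_nbhs; split; [exact: q_open|exists z].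
have : nbhs y (b @^-1` (q @` V)) := cb nb.
by apply: filterS => y' [z' Vz' zy'] _; exists z' => //; exact: VW.
Qed.

Definition fiber_sup : Y -> R := sup_fiber C F.

(** The lower hemicontinuity that the maximum theorem asks for is the openness of [q]. *)
Lemma fiber_sup_continuous : continuous fiber_sup.
Proof.
have := sup_fiber_continuous cK C_closed C_nonempty C_open (continuous_subspaceT cF).
move=> /within_continuousP cs k W Wk; have := cs k W Logic.I Wk.
by apply: filterS => k'; apply.
Qed.

Lemma fiber_sup_ge y z : q z = b y -> F (y, z) <= fiber_sup y.
Proof.
by move=> yz; apply: (sup_fiber_ge cK C_closed C_nonempty (continuous_subspaceT cF)).
Qed.

Lemma fiber_sup_le y a : (forall z, q z = b y -> F (y, z) <= a) -> fiber_sup y <= a.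
Proof. by move=> H; apply: (sup_fiber_le C_nonempty). Qed.

End fiber_sup.

(** * Bounded coefficients and the pseudometric of a module *)

Section module_metric.
Context (R : realType) (K L : topologicalType) (q : K -> L).
Hypotheses (chK : compact_hausdorff K) (chL : compact_hausdorff L).
Hypotheses (cq : continuous q) (q_surj : forall l, exists k, q k = l).
Hypothesis (q_open : open_map q).
Variable M : set (K -> cplx R).
Hypotheses (subM : submodule q M) (closedM : uniformly_closed M).
Variables (n : nat) (e : 'I_n -> K -> cplx R).
Hypothesis Me : forall i, M (e i).

Let cK : compact [set: K]. Proof. by case: chK. Qed.
Let cL : compact [set: L]. Proof. by case: chL. Qed.
Let hL : hausdorff_space L. Proof. by case: chL. Qed.
Let Mcont g : M g -> continuous g. Proof. by case: subM => + _ _ _; apply. Qed.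
Let MD g h : M g -> M h -> M (g + h). Proof. by case: subM => _ _ + _; apply. Qed.
Let MZ (a : cfun R L) g : M g -> M ((a \o q) * g). Proof. by case: subM => _ _ _;
  apply. Qed.
Let M0 : M 0. Proof. by case: subM. Qed.

Definition fiber_norm (g : K -> cplx R) : L -> R :=
  fiber_sup q id (fun lz => modulus (g lz.2)).

Let fiber_norm_ge g z : M g -> modulus (g z) <= fiber_norm g (q z).
Proof.
move=> Mg; have cF : continuous (fun lz : L * K => modulus (g lz.2)).
  apply: comp_continuous (@modulus_continuous R).
  exact: comp_continuous (@continuous_snd _ _) (Mcont Mg).
exact: (@fiber_sup_ge R K L L q id cK hL cq q_surj (@id_continuous L) _ cF (q z) z).
Qed.

Let fiber_norm_le g l a : (forall z,
  q z = l -> modulus (g z) <= a) -> fiber_norm g l <= a.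
Proof. by move=> H; apply: fiber_sup_le. Qed.

Let fiber_norm_continuous g : M g -> continuous (fiber_norm g).
Proof.
move=> Mg; apply: (fiber_sup_continuous cK hL cq q_surj q_open (@id_continuous L)).
apply: comp_continuous (@modulus_continuous R).
exact: comp_continuous (@continuous_snd _ _) (Mcont Mg).
Qed.

Let fiber_norm_ge0 g l : M g -> 0 <= fiber_norm g l.
Proof.
move=> Mg; have [k <-] := q_surj l.
by apply: le_trans (fiber_norm_ge _ Mg); exact: modulus_ge0.
Qed.

Variable s : (K -> cplx R) -> 'I_n -> cfun R L.
Hypothesis sD : forall g h i l, M g -> M h -> s (g + h) i l = s g i l + s h i l.
Hypothesis sZ : forall (a : cfun R L) g i l, M g -> s ((a \o q) * g) i l = a l * s g i l.
Hypothesis sE : forall g k, M g -> g k = \sum_(i < n) s g i (q k) * e i k.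

(* With nu the fibrewise norm of g, the function h = g / sqrt nu is a uniform limit
   of elements of M (it is 0 where nu = 0), and g = sqrt nu * h. *)
Lemma splitting_local g l i : M g -> (forall z, q z = l -> g z = 0) -> s g i l = 0.
Proof.
move=> Mg g0; pose nu := fiber_norm g.
have snu l' : 0 <= Num.sqrt (nu l') by exact: sqrtr_ge0.
have csq : continuous (fun l => Num.sqrt (nu l)).
  exact: comp_continuous (fiber_norm_continuous Mg) (@sqrt_continuous R).
have csqC : continuous (fun l => (Num.sqrt (nu l))%:C%C : cplx R).
  exact: comp_continuous csq (@real_complex_continuous R).
pose h k := (Num.sqrt (nu (q k)))%:C%C^-1 * g k.
have Mh : M h.
  have hM : closure (M : set {uniform K -> cplx R}) h.
    apply/uniform_closureP => eps eps0.
    (* The approximants [g / (sqrt nu + eps)] lie in [M], their scalar factor being continuous on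
       [L]. Since [|g| <= nu], they differ from [h] by less than [eps], also where [nu] vanishes. *)
    have cinv : continuous (fun l => (Num.sqrt (nu l) + eps)^-1%:C%C : cplx R).
      apply: comp_continuous (@real_complex_continuous R) => x.
      apply: cvgV; first by rewrite gt_eqF// ltr_wpDl.
      by apply: cvgD; [exact: csq|exact: cvg_cst].
    pose a : cfun R L := mkcts cinv.
    exists ((a \o q) * g); first exact: MZ.
    move=> k; set r := Num.sqrt (nu (q k)).
    have -> : h k - ((a \o q) * g) k = ((r^-1 - (r + eps)^-1)%:C)%C * g k.
      by rewrite rmorphB /= fmorphV mulrBl.
    have gk : modulus (g k) <= r ^+ 2.
      by rewrite sqr_sqrtr ?fiber_norm_ge0//; exact: fiber_norm_ge.
    have [r0|r0] := eqVneq r 0.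
      have -> : g k = 0.
        by apply/eqP; rewrite -modulus_eq0 eq_le modulus_ge0 (le_trans gk)// r0 expr0n.
      by rewrite mulr0 modulus0.
    have rp : 0 < r by rewrite lt_def r0 snu.
    have rep : 0 < r + eps by rewrite addr_gt0.
    have dp : 0 <= r^-1 - (r + eps)^-1.
      by rewrite subr_ge0 lef_pV2 ?posrE// lerDl ltW.
    rewrite modulusM modulus_real//.
    apply: (le_lt_trans (ler_wpM2l dp gk)).
    have -> : (r^-1 - (r + eps)^-1) * r ^+ 2 = eps * (r / (r + eps)).
      by field; rewrite gt_eqF//= gt_eqF.
    by rewrite gtr_pMr// ltr_pdivrMr// mul1r ltrDl.
  exact: (closedM hM).
pose a : cfun R L := mkcts csqC.
have gE : g = (a \o q) * h.
  apply/funext => k; transitivity ((Num.sqrt (nu (q k)))%:C%C * h k) => //.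
  have [s0|s0] := eqVneq (Num.sqrt (nu (q k))) 0.
    rewrite s0 mul0r; apply/eqP; rewrite -modulus_eq0 eq_le modulus_ge0 andbT.
    by apply: (le_trans (fiber_norm_ge _ Mg)); rewrite -sqrtr_eq0 s0.
  by rewrite /h mulVKf//; apply/eqP => -[s0']; rewrite s0' eqxx in s0.
rewrite {1}gE sZ// [a l](_ : _ = 0) ?mul0r//.
have -> : a l = (Num.sqrt (nu l))%:C%C by [].
congr (_%:C)%C; apply/eqP; rewrite sqrtr_eq0; apply: fiber_norm_le => z zl.
by rewrite g0// modulus0.
Qed.

Let comb (v : 'I_n -> cplx R) : K -> cplx R := fun k => \sum_(i < n) v i * e i k.

Let Msum m (a : 'I_m -> cfun R L) (f : 'I_m -> K -> cplx R) :
  (forall i, M (f i)) -> M (\sum_(i < m) (a i \o q) * f i).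
Proof.
move=> Mf; elim: m a f Mf => [|m IH] a f Mf; first by rewrite big_ord0.
by rewrite big_ord_recr; apply: MD; [exact: IH|exact: MZ].
Qed.

Let combE v : comb v = \sum_(i < n) ((mkcts (@cst_continuous L (cplx R) (v i)) :
  cfun R L) \o q) * e i.
Proof. by apply/funext => k; rewrite fct_sumE. Qed.

Let Mcomb v : M (comb v).
Proof. by rewrite combE; exact: Msum. Qed.

Let s_comb m (a : 'I_m -> cfun R L) (f : 'I_m -> K -> cplx R) i l :
  (forall i, M (f i)) ->
  s (\sum_(j < m) (a j \o q) * f j) i l = \sum_(j < m) a j l * s (f j) i l.
Proof.
move=> Mf; elim: m a f Mf => [|m IH] a f Mf.
  rewrite !big_ord0; have := sZ 0 i l M0.
  have -> : ((0 : cfun R L) \o q) * 0 = 0 :> (K -> cplx R).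
    by apply/funext => k; exact: mul0r.
  by move=> ->; exact: mul0r.
by rewrite !big_ord_recr sD ?IH ?sZ//; [exact: Msum|exact: MZ].
Qed.

(** Bounded coefficient vectors with the product topology, compact by Tychonoff; they parametrize
    elements of [M] over a fibre. *)
Let coef_ball (r : R) : topologicalType :=
  set_type [set v : {ptws 'I_n -> cplx R} | forall i, modulus (v i) <= r].

Let coef_ball_compact r : compact [set: coef_ball r].
Proof.
apply: set_type_compact.
exact: (@tychonoff 'I_n (fun=> cplx R) (fun=> [set z | modulus z <= r]) (fun=>
  @modulus_ball_compact R r)).
Qed.

Let coef r (v : coef_ball r) (i : 'I_n) : cplx R := (\val v : {ptws 'I_n -> cplx R}) i.

Let coef_continuous r i : continuous (fun v : coef_ball r => coef v i).
Proof.
exact: (comp_continuous (@set_type_val_continuous _ _) (@ptws_eval_continuous _ _ i)).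
Qed.

Let coef_le r (v : coef_ball r) i : modulus (coef v i) <= r.
Proof. exact: (set_mem (svalP v)). Qed.

Let coef_sub r (v : 'I_n -> cplx R) : (forall i, modulus (v i) <= r) ->
  {w : coef_ball r | coef w = v}.
Proof.
move=> vr; have vP : [set v : {ptws 'I_n -> cplx R} | forall i,
  modulus (v i) <= r] v by [].
by exists (Sub (v : {ptws 'I_n -> cplx R}) (mem_set vP)).
Qed.

Let comb_norm r : L * coef_ball r -> R :=
  fiber_sup q fst (fun vz : (L * coef_ball r) * K => modulus (comb (coef vz.1.2) vz.2)).

Let comb_continuous r : continuous (fun vz : coef_ball r * K => comb (coef vz.1) vz.2).
Proof.
apply: sum_continuous => i vz; apply: cvgM.
  exact: (comp_continuous (@continuous_fst _ _) (@coef_continuous r i)).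
exact: (comp_continuous (@continuous_snd _ _) (Mcont (Me i))).
Qed.

Let comb_modulus_continuous r :
  continuous (fun vz : (L * coef_ball r) * K => modulus (comb (coef vz.1.2) vz.2)).
Proof.
apply: comp_continuous (@modulus_continuous R).
apply: (comp_continuous (f := fun vz : (L * coef_ball r) * K =>
  (vz.1.2, vz.2))) (@comb_continuous r).
apply: pair_continuous; last exact: continuous_snd.
exact: comp_continuous (@continuous_fst _ _) (@continuous_snd _ _).
Qed.

Let comb_norm_continuous r : continuous (@comb_norm r).
Proof.
exact: (fiber_sup_continuous cK hL cq q_surj q_open (@continuous_fst _ _)
  (@comb_modulus_continuous r)).
Qed.

Let comb_norm_ge r l (v : coef_ball r) z : q z = l ->
  modulus (comb (coef v) z) <= comb_norm (l, v).
Proof.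
exact: (@fiber_sup_ge R K L _ q _ cK hL cq q_surj (@continuous_fst _ _) _
  (@comb_modulus_continuous r) (l, v) z).
Qed.

Let comb_norm_le r l (v : coef_ball r) a : (forall z,
  q z = l -> modulus (comb (coef v) z) <= a) ->
  comb_norm (l, v) <= a.
Proof. by move=> H; apply: fiber_sup_le. Qed.

(** Obtained by applying [s] to the expansion of [g]: coefficient vectors of elements of [M] are
    fixed by the matrix of [s] on the generators. *)
Let s_proj g l i : M g -> s g i l = \sum_(j < n) s g j l * s (e j) i l.
Proof.
move=> Mg; rewrite -(s_comb (fun j => s g j))//; congr (s _ i l).
by apply/funext => k; rewrite fct_sumE {1}(sE k Mg).
Qed.

(* On the compact set Q of pairs (l, v) such that v i = 1 and v is fixed by the
   idempotent matrix (s (e k) j l), the norm of the combination with coefficients v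
   is bounded away from 0, by locality of s. *)
Let coefficient_bound i : exists2 B, 0 <= B & forall g l, M g ->
  (forall z, q z = l -> modulus (g z) <= 1) ->
  (forall j, modulus (s g j l) <= modulus (s g i l)) -> modulus (s g i l) <= B.
Proof.
pose Q : set (L * coef_ball 1) := [set lv | coef lv.2 i = 1] `&`
  \bigcap_(j in [set: 'I_n]) [set lv | coef lv.2 j = \sum_(k < n) coef lv.2 k * s (e k)
    j lv.1].
have cQ : closed Q.
  apply: closedI; [|apply: closed_bigI => j _]; apply: eq_closed;
    try exact: norm_hausdorff.
  - exact: (comp_continuous (@continuous_snd _ _) (@coef_continuous 1 i)).
  - exact: cst_continuous.
  - exact: (comp_continuous (@continuous_snd _ _) (@coef_continuous 1 j)).
  - apply: sum_continuous => k vz; apply: cvgM.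
      exact: (comp_continuous (@continuous_snd _ _) (@coef_continuous 1 k)).
    exact: (comp_continuous (@continuous_fst _ _) (@cts_fun _ _ (s (e k) j))).
have cim : closed (@comb_norm 1 @` Q).
  have cLU : compact [set: L * coef_ball 1] by rewrite -setXTT; exact: compact_setX.
  exact: (closed_image cLU (@Rhausdorff R) (@comb_norm_continuous 1) cQ).
(* A combination of norm 0 over [l] has [i]-th coefficient 0 by locality, whereas the fixed-point
   equation makes this coefficient equal to [v i = 1]. *)
have n0 : ~ (@comb_norm 1 @` Q) 0.
  move=> [[l v] [/= vi vP] v0].
  have : s (comb (coef v)) i l = 0.
    apply: splitting_local => // z zl; apply/eqP;
      rewrite -modulus_eq0 eq_le modulus_ge0 andbT.
    by rewrite -v0; exact: comb_norm_ge.
  rewrite combE s_comb//= -[X in X = _](vP i Logic.I) vi => /eqP.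
  by rewrite oner_eq0.
have [d d0 dQ] : exists2 d : R, 0 < d & forall lv, Q lv -> d <= comb_norm lv.
  have : nbhs (0 : R) (~` (@comb_norm 1 @` Q)) by apply: open_nbhs_nbhs; split => //;
    exact: closed_openC.
  move=> /nbhs_ballP[d /= d0 dQ]; exists d => // -[l v] Qlv.
  rewrite leNgt; apply/negP => lt; apply: (dQ (comb_norm (l, v))); last by exists (l, v).
  rewrite -ball_normE /= sub0r normrN ger0_norm//.
  have [k kl] := q_surj l; apply: le_trans (comb_norm_ge v kl); exact: modulus_ge0.
exists d^-1; first by rewrite invr_ge0 ltW.
move=> g l Mg g1 imax.
have [->|si0] := eqVneq (s g i l) 0; first by rewrite modulus0 invr_ge0 ltW.
have msi : 0 < modulus (s g i l) by rewrite lt_def modulus_eq0 si0 modulus_ge0.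
(* Division by the largest coefficient gives a vector in the unit ball with [i]-th entry 1. Its
   combination has norm at most the inverse of that coefficient, and at least [d]. *)
pose v j := s g j l / s g i l.
have [v' v'E] : {w : coef_ball 1 | coef w = v}.
  by apply: coef_sub => j; rewrite /v modulusM modulusV ler_pdivrMr// mul1r.
have Qv : Q (l, v').
  split=> /= [|j _]; first by rewrite v'E /v divff.
  rewrite /= v'E /v (s_proj l j Mg) mulr_suml; apply: eq_bigr => k _.
  by rewrite mulrAC.
have : comb_norm (l, v') <= (modulus (s g i l))^-1.
  apply: comb_norm_le => z zl.
  have -> : comb (coef v') z = g z / s g i l.
    rewrite (sE z Mg) mulr_suml zl; apply: eq_bigr => j _.
    by rewrite v'E /v mulrAC.
  by rewrite modulusM modulusV -[X in _ <= X]mul1r ler_pM2r ?invr_gt0// g1.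
move=> /(le_trans (dQ _ Qv)) dle.
by rewrite -[X in X <= _]invrK lef_pV2 ?posrE ?invr_gt0.
Qed.

Lemma coefficients_bounded : exists2 B, 0 < B & forall g l, M g ->
  (forall z, q z = l -> modulus (g z) <= 1) -> forall i, modulus (s g i l) <= B.
Proof.
have /choice[B HB] : forall i, exists B, 0 <= B /\ forall g l, M g ->
  (forall z, q z = l -> modulus (g z) <= 1) ->
  (forall j, modulus (s g j l) <= modulus (s g i l)) -> modulus (s g i l) <= B.
  by move=> i; have [B] := coefficient_bound i; exists B.
(* The index of the largest coefficient depends on [g] and [l], so the bounds for all indices are
   added; the 1 ensures positivity. *)
exists (1 + \sum_i B i).
  by rewrite ltr_pwDl// sumr_ge0// => i _; case: (HB i).
move=> g l Mg g1 i.
pose i0 := [arg max_(j > i) modulus (s g j l)]%O.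
have i0max j : modulus (s g j l) <= modulus (s g i0 l).
  by rewrite /i0; case: arg_maxP => // k _ /(_ j); apply.
apply: (le_trans (i0max i)); have [_ /(_ g l Mg g1 i0max) H] := HB i0.
apply: (le_trans H); rewrite (bigD1 i0)//= addrCA lerDl addr_ge0//.
by apply: sumr_ge0 => j _; case: (HB j).
Qed.

Variable B : R.
Hypothesis B_gt0 : 0 < B.
Hypothesis sB : forall g l, M g -> (forall z, q z = l -> modulus (g z) <= 1) ->
  forall i, modulus (s g i l) <= B.

Let C : set (K * K * coef_ball B) :=
  [set z | q z.1.1 = q z.1.2 /\ comb_norm (q z.1.1, z.2) <= 1].
Let D : set (K * K) := [set xy | q xy.1 = q xy.2].
Let osc (z : K * K * coef_ball B) : R :=
  modulus (comb (coef z.2) z.1.1 - comb (coef z.2) z.1.2).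

Let c11 : continuous (fun z : K * K * coef_ball B => z.1.1).
Proof. by apply: comp_continuous; exact: continuous_fst. Qed.
Let c12 : continuous (fun z : K * K * coef_ball B => z.1.2).
Proof. by apply: comp_continuous; [exact: continuous_fst|exact: continuous_snd]. Qed.

Let C_closed : closed C.
Proof.
have -> : C = [set z | q z.1.1 = q z.1.2] `&`
    (fun z => comb_norm (q z.1.1, z.2)) @^-1` [set a | a <= 1] by [].
apply: closedI.
  by apply: eq_closed => //; [exact: comp_continuous c11 cq|exact: comp_continuous c12
    cq].
have cn : continuous (fun z : K * K * coef_ball B => comb_norm (q z.1.1, z.2)).
  apply: (comp_continuous _ (@comb_norm_continuous B)).
  by apply: pair_continuous; [exact: comp_continuous c11 cq|exact: continuous_snd].
by have /continuous_closedP/(_ _ (@closed_le R 1)) := cn.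
Qed.

Let C_nonempty xy : D xy -> exists v, C (xy, v).
Proof.
move=> Dxy; have [v vE] : {w : coef_ball B | coef w = fun=> 0}.
  by apply: coef_sub => i; rewrite modulus0 ltW.
exists v; split => //; apply: comb_norm_le => z _.
by rewrite vE [comb _ _]big1 ?modulus0// => i _; rewrite mul0r.
Qed.

Let osc_continuous : continuous osc.
Proof.
apply: comp_continuous (@modulus_continuous R) => z; apply: cvgB.
  apply: (comp_continuous (f := fun z : K * K * coef_ball B =>
    (z.2, z.1.1)) _ (@comb_continuous B)).
  by apply: pair_continuous; [exact: continuous_snd|exact: c11].
apply: (comp_continuous (f := fun z : K * K * coef_ball B =>
  (z.2, z.1.2)) _ (@comb_continuous B)).
by apply: pair_continuous; [exact: continuous_snd|exact: c12].
Qed.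

(* With N the fibrewise norm, dividing the coefficients by 1 + |N - N xy| moves a
   point of C over xy continuously to nearby fibres. *)
Let C_open xy v W : D xy -> C (xy, v) -> nbhs v W ->
  \forall xy' \near xy, D xy' -> exists2 v', W v' & C (xy', v').
Proof.
move=> Dxy [_ /= v1] Wv.
pose N (xy' : K * K) := comb_norm (q xy'.1, v).
(* As [N xy <= 1], the denominator is at least [N xy']; it equals 1 at [xy]. *)
pose rho (xy' : K * K) : R := (1 + `|N xy' - N xy|)^-1.
have pos xy' : 0 < 1 + `|N xy' - N xy| by rewrite ltr_pwDl.
have rho0 xy' : 0 <= rho xy' by rewrite invr_ge0 ltW.
have rho1 xy' : rho xy' <= 1 by rewrite invf_le1// lerDl.
have rhoxy : rho xy = 1 by rewrite /rho subrr normr0 addr0 invr1.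
have crho : continuous rho.
  have cN : continuous N.
    apply: (comp_continuous _ (@comb_norm_continuous B)).
    by apply: pair_continuous; [exact: comp_continuous (@continuous_fst _ _) cq|exact:
      cst_continuous].
  move=> xy'; apply: cvgV; first by rewrite gt_eqF.
  apply: cvgD; first exact: cvg_cst.
  by apply: cvg_norm; apply: cvgB; [exact: cN|exact: cvg_cst].
have sv xy' : {w : coef_ball B | coef w = fun i => (rho xy')%:C%C * coef v i}.
  apply: coef_sub => i; rewrite modulusM modulus_real//.
  by rewrite -[X in _ <= X]mul1r ler_pM// ?modulus_ge0.
pose w xy' := sval (sv xy').
have wE xy' : coef (w xy') = fun i => (rho xy')%:C%C * coef v i := svalP (sv xy').
have wxy : w xy = v.
  by apply: val_inj; have := wE xy; rewrite rhoxy => H; apply/funext => i;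
    have := congr1 (@^~ i) H; rewrite mul1r.
have cw : continuous w.
  apply: continuous_comp_initial; apply: ptws_continuous => i.
  have -> : (fun x => (\val \o w) x i) = (fun xy' => (rho xy')%:C%C * coef v i).
    by apply/funext => xy'; rewrite -[RHS]/((fun i => (rho xy')%:C%C * coef v i) i) -wE.
  by move=> xy'; apply: cvgM; [exact: (comp_continuous crho (@real_complex_continuous
    R))|exact: cvg_cst].
have : nbhs xy (w @^-1` W) by apply: cw; rewrite wxy.
apply: filterS => xy' Ww Dxy'; exists (w xy') => //; split => //=.
apply: comb_norm_le => z zx.
have -> : comb (coef (w xy')) z = (rho xy')%:C%C * comb (coef v) z.
  by rewrite wE /comb mulr_sumr; apply: eq_bigr => i _; rewrite mulrA.
rewrite modulusM modulus_real//;
  apply: (le_trans (ler_wpM2l (rho0 xy') (comb_norm_ge v zx))).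
rewrite /rho ler_pdivrMl// mulr1 -/(N xy').
have : N xy' - N xy <= `|N xy' - N xy| by exact: ler_norm.
by rewrite /N in v1 *; lra.
Qed.

(** The supremum of [|f x - f y|] over the [f] in [M] bounded by 1 on the common fibre of [x] and
    [y], by the two estimates below. Coefficients in the ball of radius [B] suffice for it, which
    makes the range of the supremum compact. *)
Definition module_dist (x y : K) : R := sup_fiber C osc (x, y).

Lemma module_dist_continuous :
  {within [set xy | q xy.1 = q xy.2], continuous (fun xy => module_dist xy.1 xy.2)}.
Proof.
have := sup_fiber_continuous (D :=
  D) (@coef_ball_compact B) C_closed C_nonempty C_open (continuous_subspaceT
    osc_continuous).
by move=> /within_continuousP H; apply/within_continuousP => -[x y]; exact: H.
Qed.

Lemma module_dist_ge f x y : M f -> q x = q y ->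
  (forall z, q z = q x -> modulus (f z) <= 1) -> modulus (f x - f y) <= module_dist x y.
Proof.
move=> Mf xy f1.
have [v vE] : {v : coef_ball B | coef v = fun i => s f i (q x)} by apply: coef_sub;
  exact: sB.
have fE z : q z = q x -> f z = comb (coef v) z by move=> zx; rewrite (sE z Mf) zx vE.
have Cv : C ((x, y), v).
  by split=> //=; apply: comb_norm_le => z zx; rewrite -fE// f1.
have := sup_fiber_ge (D := D) (@coef_ball_compact B) C_closed C_nonempty
  (continuous_subspaceT osc_continuous) (y := (x, y)) (z := v) xy Cv.
by rewrite !fE.
Qed.

Lemma module_dist_le x y a : q x = q y ->
  (forall f, M f -> (forall z, q z = q x -> modulus (f z) <= 1) ->
    modulus (f x - f y) <= a) ->
  module_dist x y <= a.
Proof.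
move=> xy H; apply: (sup_fiber_le C_nonempty (y := (x, y))) => // v [_ /= v1].
apply: H => [|z zx]; first exact: Mcomb.
exact: le_trans (comb_norm_ge v zx) v1.
Qed.

Lemma module_dist_separates f x y : M f -> q x = q y -> module_dist x y = 0 -> f x = f y.
Proof.
(* The constant [c] scales [f] into the unit ball; adding 1 keeps it positive when [f] vanishes on
   the fibre. *)
move=> Mf xy d0; pose c := fiber_norm f (q x) + 1.
have c0 : 0 < c by rewrite ltr_wpDl// fiber_norm_ge0.
pose a : cfun R L := mkcts (@cst_continuous L (cplx R) (c^-1)%:C%C).
have := module_dist_ge (MZ a Mf) xy _; rewrite d0.
have aE z : ((a \o q) * f) z = (c^-1)%:C%C * f z by [].
have H z : q z = q x -> modulus (((a \o q) * f) z) <= 1.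
  move=> zx; rewrite aE modulusM modulus_real ?invr_ge0 ?(ltW c0)//.
  rewrite ler_pdivrMl// mulr1 /c -zx; apply: (le_trans (fiber_norm_ge z Mf)).
  by rewrite lerDl.
move=> /(_ H); rewrite !aE -mulrBr modulusM => le0.
have : (c^-1)%:C%C * (f x - f y) = 0.
  by apply/eqP; rewrite -modulus_eq0 eq_le modulus_ge0 modulusM le0.
move=> /eqP; rewrite mulf_eq0 subr_eq0 => /orP[|/eqP//].
by rewrite -modulus_eq0 modulus_real ?invr_ge0 ?(ltW c0)// invr_eq0 gt_eqF.
Qed.

End module_metric.

(** * Invariant pseudometrics separating the points of each fibre *)

Section discrete_spectrum_metrics.
Context (R : realType) (G : groupType) (K L : topologicalType).
Context (phi : G -> K -> K) (psi : G -> L -> L) (q : K -> L).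
Hypotheses (phi_system : dynamical_system phi) (psi_system : dynamical_system psi).
Hypotheses (q_extension : extension phi psi q) (q_open : open_map q).

(** Everything is read off from the description of [d] as a supremum over fibrewise unit balls.
    Composition with [phi t] preserves [M] and carries the unit ball over [psi t l] into the one
    over [l], whence invariance. *)
Lemma discrete_spectrum_metric (M : set (K -> cplx R)) :
  discrete_spectrum_module phi q M ->
  exists d : K -> K -> R,
    [/\ forall x, d x x = 0,
        forall x y, q x = q y -> d x y = d y x,
        forall x y z, q x = q y -> q y = q z -> d x z <= d x y + d y z,
        {within [set xy | q xy.1 = q xy.2], continuous (fun xy => d xy.1 xy.2)} &
        (forall t x y, q x = q y -> d (phi t x) (phi t y) = d x y) /\
        (forall f x y, M f -> q x = q y -> d x y = 0 -> f x = f y)].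
Proof.
move=> [subM [n [e [Me eM]]] projM closedM invM].
have [s [sD sZ sE]] := projective_splitting subM Me eM projM.
have [chK _ _] := phi_system; have [chL _ _] := psi_system.
have [cq q_surj qE] := q_extension.
have [B B0 sB] := coefficients_bounded chK chL cq q_surj q_open subM closedM Me sD sZ sE.
pose d := module_dist q e B.
have ge := module_dist_ge chK chL cq q_surj q_open subM Me sE B0 sB.
have le := module_dist_le chK chL cq q_surj subM Me B0.
exists d; split.
- move=> x; apply/eqP; rewrite eq_le; apply/andP; split.
    by apply: le => // f _ _; rewrite subrr modulus0.
  have [_ M0 _ _] := subM; apply: (le_trans _ (ge 0 x x M0 erefl _)).
    exact: modulus_ge0.
  by move=> z _; rewrite modulus0.
- have sym x y : q x = q y -> d x y <= d y x.
    move=> xy; apply: le => // f Mf f1; rewrite -modulusN opprB; apply: ge => //.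
    by rewrite -xy.
  by move=> x y xy; apply/eqP; rewrite eq_le !sym.
- move=> x y z xy yz; apply: le; first by rewrite xy.
  move=> f Mf f1; have -> : f x - f z = (f x - f y) + (f y - f z) by rewrite addrA subrK.
  apply: (le_trans (modulusD _ _)); apply: lerD; apply: ge => //.
  by rewrite -xy.
- exact: (module_dist_continuous chK chL cq q_surj q_open subM Me B0).
split; last exact: (module_dist_separates chK chL cq q_surj q_open subM Me sE B0 sB).
have inv t x y : q x = q y -> d (phi t x) (phi t y) <= d x y.
  move=> xy; apply: le; first by rewrite !qE xy.
  move=> f Mf f1; apply: (ge (f \o phi t)) => //.
    by have := invM t^-1%g f Mf; rewrite invgK.
  by move=> z zx; apply: f1; rewrite !qE zx.
move=> t x y xy; apply/eqP; rewrite eq_le inv//=.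
rewrite -{1}[x](actionK phi_system t) -{1}[y](actionK phi_system t).
by apply: inv; rewrite !qE xy.
Qed.

Hypothesis q_discrete : relative_discrete_spectrum R phi q.

(** The continuous functions with equal values at [x] and [y] form a C*-subalgebra containing the
    generating modules, hence all of C(K), which separates points by Urysohn's lemma. *)
Lemma discrete_spectrum_separates x y :
  (forall M f, discrete_spectrum_module phi q M -> M f -> f x = f y :> cplx R) -> x = y.
Proof.
move=> H; apply: contrapT => /eqP xy.
have [[cK hK] _ _] := phi_system.
have eqf (f : K -> cplx R) : continuous f -> f x = f y.
  move=> cf; have : [set f | continuous f] f by [].
  rewrite -q_discrete => /(_ [set f | continuous f /\ f x = f y]) [|//].
  split; last by move=> g [M dM Mg]; split; [case: dM => -[+ _ _ _] _ _ _ _;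
    apply|exact: H dM Mg].
  pose S : set (K -> cplx R) := [set f | continuous f /\ f x = f y].
  have S0 : S (fun=> 0) by split; [move=> z; exact: cvg_cst|].
  have SD a g h : S g -> S h -> S (fun z => a * g z + h z).
    move=> [cg gxy] [ch hxy]; split=> [z|]; last by rewrite gxy hxy.
    by apply: cvgD; [apply: cvgM; [exact: cvg_cst|exact: cg]|exact: ch].
  have SM g h : S g -> S h -> S (fun z => g z * h z).
    move=> [cg gxy] [ch hxy]; split=> [z|]; last by rewrite gxy hxy.
    by apply: cvgM; [exact: cg|exact: ch].
  have SC g : S g -> S (fun z => (g z)^*).
    move=> [cg gxy]; split; last by rewrite gxy.
    exact: comp_continuous cg (@conjC_continuous R).
  rewrite -/S; split; [by move=> g []|exact: S0|exact: SD|exact: SM|].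
  by split; [exact: SC|exact: uniform_limit_eq].
have cl1 z : closed [set z : K] by apply: accessible_closed_set1;
  exact: hausdorff_accessible.
have xy0 : [set x] `&` [set y] = set0.
  by rewrite -subset0 => z [-> yx]; move: xy; rewrite yx eqxx.
have /(normal_separatorP (R := R)) nsep : normal_space K by exact: compact_normal.
have /(@uniform_separatorP _ R) [f [cf _ f0 f1]] := nsep _ _ (cl1 x) (cl1 y) xy0.
have := eqf _ (comp_continuous cf (@real_complex_continuous R)).
have -> : f x = 0 by apply: f0; exists x.
have -> : f y = 1 by apply: f1; exists y.
by move=> [] /eqP; rewrite eq_sym oner_eq0.
Qed.

End discrete_spectrum_metrics.

(** * The groupoid of fibre isometries *)

Section isometry_groupoid.
Context (R : realType) (G : groupType) (K L : topologicalType).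
Context (phi : G -> K -> K) (psi : G -> L -> L) (q : K -> L).
Hypothesis phi_system : dynamical_system phi.
Hypothesis psi_system : dynamical_system psi.
Hypothesis L_stonean : stonean L.
Hypothesis q_extension : extension phi psi q.
Hypothesis q_open : open_map q.

Context (I : Type) (d : I -> K -> K -> R).
Hypothesis d_refl : forall i x, d i x x = 0.
Hypothesis d_sym : forall i x y, q x = q y -> d i x y = d i y x.
Hypothesis d_tri : forall i x y z, q x = q y -> q y = q z ->
  d i x z <= d i x y + d i y z.
Hypothesis d_continuous : forall i,
  {within [set xy | q xy.1 = q xy.2], continuous (fun xy => d i xy.1 xy.2)}.
Hypothesis d_separates : forall x y, q x = q y -> (forall i, d i x y = 0) ->
  x = y.
Hypothesis d_invariant : forall i t x y, q x = q y ->
  d i (phi t x) (phi t y) = d i x y.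

Let cK : compact [set: K]. Proof. by have [[]] := phi_system. Qed.
Let hK : hausdorff_space K. Proof. by have [[]] := phi_system. Qed.
Let cL : compact [set: L]. Proof. by have [[]] := psi_system. Qed.
Let hL : hausdorff_space L. Proof. by have [[]] := psi_system. Qed.
Let cq : continuous q. Proof. by have [] := q_extension. Qed.
Let qE t k : q (phi t k) = psi t (q k). Proof. by have [_ _ ->] := q_extension. Qed.

(** * Continuous sections and the encoding of isometries *)

Definition Sections : set (L -> K) := [set u | continuous u /\ cancel u q].

Let section_continuous (u : Sections) : continuous (\val u).
Proof. by have [] := set_valP u. Qed.

Let sectionK (u : Sections) l : q (\val u l) = l.
Proof. by have [_ ->] := set_valP u. Qed.

(** Gleason's theorem is applied to the closed set that is [closure V] over a clopen neighbourhood
    of [q x] inside [q V], and everything over its complement. *)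
Lemma sections_dense x W : nbhs x W -> exists u : Sections, W (\val u (q x)).
Proof.
move=> /(compact_hausdorff_shrink (conj cK hK)) [V [oV Vx VW]].
have nqV : nbhs (q x) (q @` V) by apply: open_nbhs_nbhs; split; [exact: q_open|exists x].
have [N [clN Nx NV]] := stonean_clopen_nbhs L_stonean nqV.
have [|l|u [cu Zu uq]] := @stonean_section K L q ((closure V `&` q @^-1` N) `|` q @^-1`
  (~` N)) L_stonean (conj cK hK) cq.
- apply: closedU; first by apply: closedI;
  [exact: closed_closure|apply: preimage_closed => [? _|]; [exact: cq|case: clN]].
  by apply: preimage_closed => [? _|]; [exact: cq|apply: open_closedC; case: clN].
- have [Nl|nNl] := pselect (N l).
    have [y Vy yl] := NV l Nl; exists y => //; left; split; first exact: subset_closure.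
    by rewrite /= yl.
  have [_ /(_ l) [y yl] _] := q_extension; exists y => //; right.
  by rewrite /= yl.
have Su : Sections u by [].
exists (Sub u (mem_set Su)) => /=; apply: VW.
by case: (Zu (q x)) => [[]//|]; rewrite /= uq.
Qed.

(** The induction principle for fibres: a closed property has to be checked only at the values of
    sections. *)
Lemma fiber_dense (A : set K) l : closed A -> (forall u : Sections, A (\val u l)) ->
  forall x, q x = l -> A x.
Proof.
move=> cA Au x xl; apply: cA => W Wx.
by have [u Wu] := sections_dense Wx; exists (\val u l); split => //; rewrite -xl.
Qed.

Lemma d_approx i x e : 0 < e -> exists u : Sections, d i (\val u (q x)) x < e.
Proof.
move=> e0.
have : {within [set y | q y = q x], continuous (fun y => d i y x)}.
  apply: (within_continuous_comp2 (@d_continuous i) (g := fun y => (y, x))) => //.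
  by apply: continuous_subspaceT; apply: pair_continuous;
    [exact: id_continuous|exact: cst_continuous].
move=> /within_continuousP cdx.
have [|u Uu] := sections_dense (cdx x [set r | r < e] erefl _).
  by apply: open_nbhs_nbhs; split; [exact: open_lt|rewrite /= d_refl].
by exists u; apply: Uu => //; rewrite /= sectionK.
Qed.

Lemma d_ge0 i x y : q x = q y -> 0 <= d i x y.
Proof.
move=> xy; have := d_tri i xy (esym xy).
by rewrite d_refl (d_sym i (esym xy)) -mulr2n pmulrn_lge0.
Qed.

(** A section value within [e / 2] of [y] is equally close to [y'], so all pseudodistances between
    the two points vanish. *)
Lemma d_section_inj y y' : q y = q y' ->
  (forall i (v : Sections), d i y (\val v (q y)) = d i y' (\val v (q y))) -> y = y'.
Proof.
move=> yy' H; apply: d_separates => // i; apply/eqP; rewrite eq_le d_ge0// andbT.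
apply/ler_addgt0Pr => e e0; rewrite add0r.
have e20 : 0 < e / 2 by rewrite divr_gt0.
have [v dv] := d_approx i y e20.
have qv := sectionK v (q y).
have H1 := d_tri i (esym qv) (etrans qv yy').
have H2 : d i (\val v (q y)) y' = d i (\val v (q y)) y.
  by rewrite d_sym ?qv// -H d_sym ?qv.
have H3 : d i y (\val v (q y)) = d i (\val v (q y)) y by rewrite d_sym ?qv.
by move: H1; rewrite H2 H3; lra.
Qed.

Local Notation KS := {ptws Sections -> K}.

(* An isometry theta from the fibre over l1 to the fibre over l2 is encoded by the
   values of theta and of its inverse on the continuous sections of q, which pass
   through a dense set of points of each fibre.  The adjunction
   d (theta x) y = d x (theta^-1 y) is a closed condition implying that both maps
   are isometric and mutually inverse. *)
Definition isometries : set (L * L * (KS * KS)) :=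
  [set e | [/\ forall u, q (e.2.1 u) = e.1.2, forall v, q (e.2.2 v) = e.1.1 &
    forall i (u v : Sections),
      d i (e.2.1 u) (\val v e.1.2) = d i (\val u e.1.1) (e.2.2 v)]].

Let eval1 (u : Sections) : continuous (fun e : L * L * (KS * KS) => e.2.1 u).
Proof.
apply: (comp_continuous (f := fun e : L * L * (KS * KS) => e.2.1) (g := fun w : KS =>
  w u)); last exact: ptws_eval_continuous.
by apply: comp_continuous; [exact: continuous_snd|exact: continuous_fst].
Qed.

Let eval2 (u : Sections) : continuous (fun e : L * L * (KS * KS) => e.2.2 u).
Proof.
apply: (comp_continuous (f := fun e : L * L * (KS * KS) => e.2.2) (g := fun w : KS =>
  w u)); last exact: ptws_eval_continuous.
by apply: comp_continuous; [exact: continuous_snd|exact: continuous_snd].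
Qed.

Let src0 : continuous (fun e : L * L * (KS * KS) => e.1.1).
Proof. by apply: comp_continuous; [exact: continuous_fst|exact: continuous_fst]. Qed.

Let tgt0 : continuous (fun e : L * L * (KS * KS) => e.1.2).
Proof. by apply: comp_continuous; [exact: continuous_fst|exact: continuous_snd]. Qed.

Lemma isometries_closed : closed isometries.
Proof.
pose E0 : set (L * L * (KS * KS)) :=
  \bigcap_(u in setT) [set e | q (e.2.1 u) = e.1.2] `&`
  \bigcap_(u in setT) [set e | q (e.2.2 u) = e.1.1].
have cE0 : closed E0.
  apply: closedI; apply: closed_bigI => u _; apply: eq_closed => //.
    by apply: comp_continuous; [exact: eval1|exact: cq].
  by apply: comp_continuous; [exact: eval2|exact: cq].
have -> : isometries = \bigcap_(iuv in [set: I * Sections * Sections])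
    [set e | E0 e /\ d iuv.1.1 (e.2.1 iuv.1.2) (\val iuv.2 e.1.2) = d iuv.1.1 (\val
      iuv.1.2 e.1.1) (e.2.2 iuv.2)] `&` E0.
  rewrite eqEsubset; split=> [e [e1 e2 e3]|e [H [e1 e2]]].
    have E0e : E0 e by split=> u _; [exact: e1|exact: e2].
    by split=> // -[[i u] v] _.
  split=> [u|v|i u v]; [exact: e1|exact: e2|].
  by have [] := H (i, u, v) Logic.I.
apply: closedI => //; apply: closed_bigI => -[[i u] v] _ /=.
apply: within_continuous_eq_closed; [exact: Rhausdorff|exact: cE0| |].
  apply: (within_continuous_comp2 (@d_continuous i) (g := fun e : L * L * (KS * KS) =>
    (e.2.1 u, \val v e.1.2))).
    apply: continuous_subspaceT; apply: pair_continuous => //.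
    by apply: comp_continuous; [exact: tgt0|exact: section_continuous].
  by move=> e [e1 e2] /=; rewrite sectionK; exact: e1.
apply: (within_continuous_comp2 (@d_continuous i) (g := fun e : L * L * (KS * KS) =>
  (\val u e.1.1, e.2.2 v))).
  apply: continuous_subspaceT; apply: pair_continuous => //.
  by apply: comp_continuous; [exact: src0|exact: section_continuous].
by move=> e [e1 e2] /=; rewrite sectionK; apply/esym; exact: e2.
Qed.

Definition isometry : topologicalType := set_type isometries.

Lemma isometry_compact_hausdorff : compact_hausdorff isometry.
Proof.
have cKS : compact [set: KS].
  have := @tychonoff Sections (fun=> K) (fun=> setT) (fun=> cK).
  by congr compact; rewrite eqEsubset.
split.
  apply: set_type_compact; apply: (@subclosed_compact _ _ setT) => //.
    exact: isometries_closed.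
  by rewrite -!setXTT; apply: compact_setX; apply: compact_setX.
apply: set_type_hausdorff; apply: prod_hausdorff; apply: prod_hausdorff => //.
  exact: (@hausdorff_product _ (fun=> K)).
exact: (@hausdorff_product _ (fun=> K)).
Qed.

Definition src (e : isometry) : L := (\val e).1.1.
Definition tgt (e : isometry) : L := (\val e).1.2.
Definition iso_fwd (e : isometry) (u : Sections) : K := (\val e).2.1 u.
Definition iso_bwd (e : isometry) (u : Sections) : K := (\val e).2.2 u.

Lemma src_continuous : continuous src.
Proof. exact: comp_continuous (@set_type_val_continuous _ _) src0. Qed.

Lemma tgt_continuous : continuous tgt.
Proof. exact: comp_continuous (@set_type_val_continuous _ _) tgt0. Qed.

Let fwd_continuous u : continuous (iso_fwd^~ u).
Proof. exact: (comp_continuous (@set_type_val_continuous _ isometries) (@eval1 u)). Qed.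

Let bwd_continuous u : continuous (iso_bwd^~ u).
Proof. exact: (comp_continuous (@set_type_val_continuous _ isometries) (@eval2 u)). Qed.

Let isometryP (e : isometry) : isometries (\val e).
Proof. exact: set_mem (svalP e). Qed.

Let q_fwd e u : q (iso_fwd e u) = tgt e.
Proof. by have [h _ _] := isometryP e; exact: h. Qed.

Let q_bwd e u : q (iso_bwd e u) = src e.
Proof. by have [_ h _] := isometryP e; exact: h. Qed.

Let fwd_bwd e i (u v : Sections) :
  d i (iso_fwd e u) (\val v (tgt e)) = d i (\val u (src e)) (iso_bwd e v).
Proof. by have [_ _ h] := isometryP e; exact: h. Qed.

(** The image of a point is described by its distances to the sections, as the adjunction prescribes
    them. These conditions are closed jointly in the point, the isometry and the image, so the
    closed graph theorem applies to [act]. *)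
Definition act_graph : set (K * isometry * K) :=
  [set z | [/\ q z.1.1 = src z.1.2, q z.2 = tgt z.1.2 &
    forall i (v : Sections), d i z.2 (\val v (tgt z.1.2)) = d i z.1.1 (iso_bwd z.1.2 v)]].

Lemma act_graph_closed : closed act_graph.
Proof.
pose E0 : set (K * isometry * K) :=
  [set z | q z.1.1 = src z.1.2] `&` [set z | q z.2 = tgt z.1.2].
have c11 : continuous (fun z : K * isometry * K => z.1.1).
  by apply: comp_continuous; exact: continuous_fst.
have c12 : continuous (fun z : K * isometry * K => z.1.2).
  by apply: comp_continuous; [exact: continuous_fst|exact: continuous_snd].
have c2 : continuous (fun z : K * isometry * K => z.2) by exact: continuous_snd.
have cE0 : closed E0.
  apply: closedI; apply: eq_closed => //.
  - exact: comp_continuous c11 cq.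
  - exact: comp_continuous c12 src_continuous.
  - exact: comp_continuous c2 cq.
  - exact: comp_continuous c12 tgt_continuous.
have -> : act_graph = \bigcap_(iv in [set: I * Sections])
    [set z | E0 z /\ d iv.1 z.2 (\val iv.2 (tgt z.1.2)) = d iv.1 z.1.1 (iso_bwd z.1.2
      iv.2)] `&` E0.
  rewrite eqEsubset; split=> [z [z1 z2 z3]|z [H [z1 z2]]].
    by split=> // -[i v] _.
  by split=> // i v; have [] := H (i, v) Logic.I.
apply: closedI => //; apply: closed_bigI => -[i v] _ /=.
apply: within_continuous_eq_closed; [exact: Rhausdorff|exact: cE0| |].
  apply: (within_continuous_comp2 (@d_continuous i) (g := fun z =>
    (z.2, \val v (tgt z.1.2)))).
    apply: continuous_subspaceT; apply: pair_continuous => //.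
    apply: comp_continuous (@section_continuous v).
    exact: comp_continuous c12 tgt_continuous.
  by move=> z [z1 z2] /=; rewrite sectionK.
apply: (within_continuous_comp2 (@d_continuous i) (g := fun z =>
  (z.1.1, iso_bwd z.1.2 v))).
  apply: continuous_subspaceT; apply: pair_continuous => //.
  exact: comp_continuous c12 (@bwd_continuous v).
by move=> z [z1 z2] /=; rewrite q_bwd.
Qed.

(** The default value [x] is taken when [x] is not over the source of [e]. *)
Definition act (e : isometry) (x : K) : K :=
  xget x [set y | act_graph (x, e, y)].

Lemma act_uniq e x y y' : act_graph (x, e, y) -> act_graph (x, e, y') -> y = y'.
Proof.
move=> [/= _ qy Hy] [/= _ qy' Hy']; apply: d_section_inj; first by rewrite qy.
by move=> i v; rewrite qy Hy Hy'.
Qed.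

(** The points having an image form a closed set, as the projection of a closed subset along the
    compact [K]; this set contains all section values over [src e]. *)
Lemma act_spec e x : q x = src e -> act_graph (x, e, act e x).
Proof.
move=> xe; suff [y Hy] : exists y, act_graph (x, e,
  y) by exact: (@xgetPex _ x [set y | act_graph (x, e, y)] (ex_intro _ y Hy)).
pose A : set (K * K) := [set xy | act_graph (xy.1, e, xy.2)].
have cA : closed A.
  apply: (@preimage_closed _ _ (fun xy : K * K => (xy.1, e, xy.2))) act_graph_closed =>
    z _.
  apply: pair_continuous; last exact: continuous_snd.
  by apply: pair_continuous; [exact: continuous_fst|move=> ?; exact: cvg_cst].
have [u|[x' y] /= Hy xx'] := fiber_dense (proj_closed cK cA) _ xe; last by subst;
  exists y.
exists (\val u (src e), iso_fwd e u) => //.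
by split=> [||i v] /=; [rewrite sectionK|exact: q_fwd|exact: fwd_bwd].
Qed.

Lemma q_act e x : q x = src e -> q (act e x) = tgt e.
Proof. by move=> /act_spec[]. Qed.

Lemma actE e x y : act_graph (x, e, y) -> act e x = y.
Proof. by move=> H; have [xe _ _] := H; exact: act_uniq (act_spec xe) H. Qed.

Lemma act_continuous :
  {within [set xe | q xe.1 = src xe.2], continuous (fun xe => act xe.2 xe.1)}.
Proof.
apply: (closed_graph_continuous cK act_graph_closed) =>
  [[x e] /= /act_spec//|[x e] y /= _ H].
by rewrite (actE H).
Qed.

Lemma act_section e (u : Sections) : act e (\val u (src e)) = iso_fwd e u.
Proof.
by apply: actE; split=> [||i v] /=; [rewrite sectionK|exact: q_fwd|exact: fwd_bwd].
Qed.

Lemma iso_inv_subproof (e : isometry) :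
  isometries (tgt e, src e, ((\val e).2.2, (\val e).2.1)).
Proof.
split=> [u|v|i u v] /=; [exact: q_bwd|exact: q_fwd|].
have := fwd_bwd e i v u; rewrite /iso_fwd /iso_bwd => H.
by rewrite d_sym ?q_bwd ?sectionK// -H d_sym ?q_fwd ?sectionK.
Qed.

Definition iso_inv (e : isometry) : isometry := exist (fun e =>
  e \in isometries) _ (mem_set (iso_inv_subproof e)).

Lemma src_inv e : src (iso_inv e) = tgt e. Proof. by []. Qed.
Lemma tgt_inv e : tgt (iso_inv e) = src e. Proof. by []. Qed.

Lemma iso_invK : involutive iso_inv.
Proof. by move=> e; apply: val_inj => /=; rewrite /src /tgt /=;
  case: e => -[[? ?] [? ?]]. Qed.

Lemma iso_inv_continuous : continuous iso_inv.
Proof.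
apply: continuous_comp_initial.
have cv := @set_type_val_continuous _ isometries.
apply: pair_continuous; first by apply: pair_continuous;
  [exact: tgt_continuous|exact: src_continuous].
have c2 : continuous (fun e : isometry =>
  (\val e).2) := comp_continuous cv (@continuous_snd _ _).
by apply: pair_continuous; [exact: comp_continuous c2 (@continuous_snd _ _)|exact:
  comp_continuous c2 (@continuous_fst _ _)].
Qed.

Lemma act_within e : {within [set x | q x = src e], continuous (act e)}.
Proof.
apply: (within_continuous_comp2 act_continuous (g := fun x => (x, e))) => //.
by apply: continuous_subspaceT; apply: pair_continuous;
  [exact: id_continuous|exact: cst_continuous].
Qed.

Lemma fiber_closed l : closed [set x | q x = l].
Proof. by apply: eq_closed => // x; exact: cvg_cst. Qed.

(** The graph gives the adjunction for section values [y]; both sides are continuous in [y], so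
    density extends it to the fibre. *)
Lemma act_adjoint e i x y : q x = src e -> q y = tgt e ->
  d i (act e x) y = d i x (act (iso_inv e) y).
Proof.
move=> xe ye.
have cA : closed [set y | q y = tgt e /\ d i (act e x) y = d i x (act (iso_inv e) y)].
  apply: within_continuous_eq_closed; [exact: Rhausdorff|exact: fiber_closed| |].
    apply: (within_continuous_comp2 (@d_continuous i) (g := fun y => (act e x, y))).
      by apply: continuous_subspaceT; apply: pair_continuous;
        [exact: cst_continuous|exact: id_continuous].
    by move=> z /= ->; rewrite q_act.
  apply: (within_continuous_comp2 (@d_continuous i) (g := fun y =>
    (x, act (iso_inv e) y))).
    have := @act_within (iso_inv e); rewrite src_inv => /subspace_continuousP cact.
    apply/subspace_continuousP => z Dz; apply: cvg_pair; first exact: cvg_cst.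
    exact: cact.
  by move=> z /= ze; rewrite q_act.
suff cAv : forall v : Sections,
  q (\val v (tgt e)) = tgt e /\ d i (act e x) (\val v (tgt e)) = d i x (act (iso_inv e)
    (\val v (tgt e))).
  by have [] := fiber_dense cA cAv ye.
move=> v; split; first by rewrite sectionK.
have [_ _ /(_ i v) /= ->] := act_spec xe.
by rewrite -[tgt e]/(src (iso_inv e)) act_section.
Qed.

(** Taking [y = act e x] in the adjunction turns the distance from [x] to the round trip into
    [d i y y = 0]. *)
Lemma act_invK e x : q x = src e -> act (iso_inv e) (act e x) = x.
Proof.
move=> xe; apply/esym; apply: d_separates;
  first by rewrite xe (q_act (e := iso_inv e)) ?q_act.
by move=> i; rewrite -act_adjoint ?q_act// d_refl.
Qed.

Lemma act_invKV e x : q x = tgt e -> act e (act (iso_inv e) x) = x.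
Proof. by move=> xe; have := @act_invK (iso_inv e) x xe; rewrite iso_invK. Qed.

(** The backward values are the preimages of section values under the forward map, so they need no
    separate comparison. *)
Lemma isometry_ext e e' : src e = src e' -> tgt e = tgt e' ->
  (forall x, q x = src e -> act e x = act e' x) -> e = e'.
Proof.
move=> ss tt H.
have fE u : iso_fwd e u = iso_fwd e' u.
  by rewrite -!act_section -ss H// sectionK.
have bE u : iso_bwd e u = iso_bwd e' u.
  have bact (e0 : isometry) : iso_bwd e0 u = act (iso_inv e0) (\val u (tgt e0)).
    by rewrite -src_inv act_section.
  have qb : q (iso_bwd e u) = src e' by rewrite q_bwd.
  rewrite -[LHS](act_invK qb) -H ?q_bwd// [in LHS]bact act_invKV ?sectionK//.
  by rewrite bact tt.
apply: val_inj; move: ss tt fE bE; rewrite /src /tgt /iso_fwd /iso_bwd.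
case: (\val e) (\val e') => [[l1 l2] [w w']] [[m1 m2] [v v']] /= -> -> wv wv'.
by congr (_, (_, _)); apply/funext.
Qed.

Lemma isometry_ext_section e e' : src e = src e' -> tgt e = tgt e' ->
  (forall u, iso_fwd e u = iso_fwd e' u) -> e = e'.
Proof.
move=> ss tt H; apply: isometry_ext => // x xe.
have cA : closed [set x | q x = src e /\ act e x = act e' x].
  apply: within_continuous_eq_closed => //; first exact: fiber_closed.
    exact: act_within.
  by rewrite ss; exact: act_within.
have [|_ //] := fiber_dense cA _ xe.
by move=> u; split; [rewrite sectionK|rewrite act_section ss act_section H].
Qed.

Lemma iso_mul_subproof (e2 e1 : isometry) : tgt e1 = src e2 ->
  isometries (src e1, tgt e2, ((fun u => act e2 (iso_fwd e1 u)) : KS,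
    (fun v => act (iso_inv e1) (iso_bwd e2 v)) : KS)).
Proof.
move=> e12; split=> [u|v|i u v] /=.
- by rewrite q_act// q_fwd.
- by rewrite q_act// q_bwd src_inv.
have q1 : q (iso_fwd e1 u) = src e2 by rewrite q_fwd.
have q2 : q (\val v (tgt e2)) = tgt e2 by rewrite sectionK.
rewrite act_adjoint// -(act_section e1) act_adjoint ?sectionK ?q_act// ?src_inv//.
by rewrite -src_inv act_section.
Qed.

(** The value [e1] for non-composable pairs is arbitrary. *)
Definition iso_mul (e2 e1 : isometry) : isometry :=
  if pselect (tgt e1 = src e2) is left e12 then
    exist (fun e => e \in isometries) _ (mem_set (iso_mul_subproof e12))
  else e1.

Lemma src_mul e2 e1 : tgt e1 = src e2 -> src (iso_mul e2 e1) = src e1.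
Proof. by rewrite /iso_mul; case: pselect. Qed.

Lemma tgt_mul e2 e1 : tgt e1 = src e2 -> tgt (iso_mul e2 e1) = tgt e2.
Proof. by rewrite /iso_mul; case: pselect. Qed.

Lemma iso_fwd_mul e2 e1 u : tgt e1 = src e2 ->
  iso_fwd (iso_mul e2 e1) u = act e2 (iso_fwd e1 u).
Proof. by rewrite /iso_mul; case: pselect. Qed.

Lemma iso_bwd_mul e2 e1 u : tgt e1 = src e2 ->
  iso_bwd (iso_mul e2 e1) u = act (iso_inv e1) (iso_bwd e2 u).
Proof. by rewrite /iso_mul; case: pselect. Qed.

Lemma act_mul e2 e1 x : tgt e1 = src e2 -> q x = src e1 ->
  act (iso_mul e2 e1) x = act e2 (act e1 x).
Proof.
move=> e12 xe; apply: actE; split=> /=; first by rewrite src_mul.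
  by rewrite tgt_mul// q_act// q_act.
move=> i v; rewrite tgt_mul// iso_bwd_mul// act_adjoint ?q_act ?sectionK//.
by rewrite act_adjoint ?q_act ?sectionK// -[tgt e2]/(src (iso_inv e2)) act_section.
Qed.

(** Joint continuity of evaluation makes the graph closed: it suffices to prescribe source, target
    and forward values, which determine the product by [isometry_ext_section]. *)
Lemma iso_mul_continuous :
  {within [set e | tgt e.2 = src e.1], continuous (fun e => iso_mul e.1 e.2)}.
Proof.
have [ciso hiso] := isometry_compact_hausdorff.
pose E0 : set (isometry * isometry * isometry) :=
  [set z | tgt z.1.2 = src z.1.1] `&` ([set z | src z.2 = src z.1.2] `&` [set z | tgt
    z.2 = tgt z.1.1]).
have c11 : continuous (fun z : isometry * isometry * isometry => z.1.1).
  by apply: comp_continuous; exact: continuous_fst.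
have c12 : continuous (fun z : isometry * isometry * isometry => z.1.2).
  by apply: comp_continuous; [exact: continuous_fst|exact: continuous_snd].
have c2 : continuous (fun z : isometry * isometry * isometry =>
  z.2) by exact: continuous_snd.
have cE0 : closed E0.
  apply: closedI; last apply: closedI; apply: eq_closed => //.
  - exact: comp_continuous c12 tgt_continuous.
  - exact: comp_continuous c11 src_continuous.
  - exact: comp_continuous c2 src_continuous.
  - exact: comp_continuous c12 src_continuous.
  - exact: comp_continuous c2 tgt_continuous.
  - exact: comp_continuous c11 tgt_continuous.
pose C := E0 `&` \bigcap_(u in [set: Sections])
  [set z | E0 z /\ iso_fwd z.2 u = act z.1.1 (iso_fwd z.1.2 u)].
have cC : closed C.
  apply: closedI => //; apply: closed_bigI => u _;
    apply: within_continuous_eq_closed => //.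
    by apply: continuous_subspaceT; exact: comp_continuous c2 (@fwd_continuous u).
  apply: (within_continuous_comp2 act_continuous (g := fun z =>
    (iso_fwd z.1.2 u, z.1.1))).
    apply: continuous_subspaceT; apply: pair_continuous => //.
    exact: comp_continuous c12 (@fwd_continuous u).
  by move=> z [z1 _] /=; rewrite q_fwd.
apply: (closed_graph_continuous ciso cC).
  move=> [e2 e1] /= e12; rewrite /C.
  have E0e : E0 (e2, e1, iso_mul e2 e1) by split=> //; split;
    rewrite /= ?src_mul ?tgt_mul.
  by split=> // u _; split => //=; rewrite iso_fwd_mul.
move=> [e2 e1] e /= e12 [[_ [/= s t]] H]; apply: isometry_ext_section.
- by rewrite s src_mul.
- by rewrite t tgt_mul.
by move=> u; have [_ /= ->] := H u Logic.I; rewrite iso_fwd_mul.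
Qed.

Lemma iso_one_subproof l :
  isometries (l, l, ((fun u => \val u l) : KS, (fun u => \val u l) : KS)).
Proof. by split=> //= u; rewrite sectionK. Qed.

Definition iso_one (l : L) : isometry :=
  exist (fun e => e \in isometries) _ (mem_set (iso_one_subproof l)).

Lemma act_one l x : q x = l -> act (iso_one l) x = x.
Proof. by move=> xl; apply: actE; split. Qed.

Lemma iso_one_continuous : continuous iso_one.
Proof.
apply: continuous_comp_initial.
apply: pair_continuous; first by apply: pair_continuous; exact: id_continuous.
by apply: pair_continuous; apply: ptws_continuous => u; exact: section_continuous.
Qed.

Lemma iso_phi_subproof t l :
  isometries (l, psi t l, ((fun u => phi t (\val u l)) : KS,
    (fun u => phi t^-1%g (\val u (psi t l))) : KS)).
Proof.
split=> [u|v|i u v] /=.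
- by rewrite qE sectionK.
- by rewrite qE sectionK (actionK psi_system).
have -> : d i (phi t (\val u l)) (\val v (psi t l)) =
    d i (phi t (\val u l)) (phi t (phi t^-1%g (\val v (psi t l)))).
  by rewrite (actionKV phi_system).
by rewrite d_invariant// qE !sectionK (actionK psi_system).
Qed.

Definition iso_phi (t : G) (l : L) : isometry :=
  exist (fun e => e \in isometries) _ (mem_set (iso_phi_subproof t l)).

Lemma src_phi t l : src (iso_phi t l) = l. Proof. by []. Qed.
Lemma tgt_phi t l : tgt (iso_phi t l) = psi t l. Proof. by []. Qed.

Lemma act_phi t l x : q x = l -> act (iso_phi t l) x = phi t x.
Proof.
move=> xl; apply: actE; split=> //=; first by rewrite qE xl.
move=> i v; rewrite /iso_bwd /tgt /=.
rewrite -[RHS](d_invariant i t); last by rewrite qE sectionK (actionK psi_system).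
by rewrite (actionKV phi_system).
Qed.

Lemma iso_phi_continuous t : continuous (iso_phi t).
Proof.
apply: continuous_comp_initial.
have cpsi := action_continuous psi_system.
have cphi := action_continuous phi_system.
apply: pair_continuous; first by apply: pair_continuous;
  [exact: id_continuous|exact: cpsi].
apply: pair_continuous; apply: ptws_continuous => u.
  exact: comp_continuous (@section_continuous u) (cphi t).
exact: comp_continuous (comp_continuous (cpsi t) (@section_continuous u)) (cphi _).
Qed.

Hypothesis q_ergodic : topologically_ergodic R phi psi q.

Lemma iso_mulA e3 e2 e1 : tgt e1 = src e2 -> tgt e2 = src e3 ->
  iso_mul e3 (iso_mul e2 e1) = iso_mul (iso_mul e3 e2) e1.
Proof.
move=> e12 e23; apply: isometry_ext; rewrite ?src_mul ?tgt_mul// ?src_mul//.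
by move=> x xe; rewrite !act_mul ?src_mul ?tgt_mul// ?q_act.
Qed.

Lemma iso_mul1 e : iso_mul (iso_one (tgt e)) e = e.
Proof.
apply: isometry_ext; rewrite ?src_mul ?tgt_mul// => x xe.
by rewrite act_mul// act_one// q_act.
Qed.

Lemma iso_mulr1 e : iso_mul e (iso_one (src e)) = e.
Proof.
apply: isometry_ext; rewrite ?src_mul ?tgt_mul// => x xe.
by rewrite act_mul// act_one.
Qed.

Lemma iso_mulV e : iso_mul (iso_inv e) e = iso_one (src e).
Proof.
apply: isometry_ext; rewrite ?src_mul ?tgt_mul// => x xe.
by rewrite act_mul// act_invK// act_one.
Qed.

Lemma iso_mulrV e : iso_mul e (iso_inv e) = iso_one (tgt e).
Proof. by have := iso_mulV (iso_inv e); rewrite iso_invK. Qed.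

Lemma iso_invM e2 e1 : tgt e1 = src e2 ->
  iso_inv (iso_mul e2 e1) = iso_mul (iso_inv e1) (iso_inv e2).
Proof.
move=> e12; have e12' : tgt (iso_inv e2) = src (iso_inv e1) by rewrite tgt_inv src_inv.
apply: isometry_ext; rewrite ?src_inv ?tgt_inv ?src_mul ?tgt_mul//.
move=> x xe.
have x2 : q (act (iso_inv e2) x) = src e2 by rewrite q_act.
have x1 : q (act (iso_inv e1) (act (iso_inv e2) x)) = src e1 by rewrite q_act// src_inv
  e12.
rewrite (act_mul (e2 := iso_inv e1))//.
have {1}-> : x = act (iso_mul e2 e1) (act (iso_inv e1) (act (iso_inv e2) x)).
  by rewrite act_mul// !act_invKV// x2.
by rewrite act_invK// src_mul.
Qed.

Lemma iso_phi_inv t l : iso_inv (iso_phi t l) = iso_phi t^-1%g (psi t l).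
Proof.
apply: isometry_ext => //; first by rewrite tgt_inv tgt_phi src_phi (actionK psi_system).
move=> x; rewrite src_inv tgt_phi => xl; rewrite act_phi//.
rewrite -{1}[x](actionKV phi_system t) -(act_phi t (l := l)).
  by rewrite act_invK// qE xl (actionK psi_system).
by rewrite qE xl (actionK psi_system).
Qed.

Lemma iso_phi1 l : iso_phi 1%g l = iso_one l.
Proof.
apply: isometry_ext => //; first by rewrite tgt_phi (action1 psi_system).
by move=> x xl; rewrite act_phi// act_one// (action1 phi_system).
Qed.

(** * The enveloping groupoid *)

Definition closed_under_mul (S : set isometry) : Prop :=
  closed S /\ forall e2 e1, tgt e1 = src e2 -> S e2 -> S e1 -> S (iso_mul e2 e1).

(** A fibrewise analogue of the Ellis semigroup of the action. *)
Definition enveloping : set isometry :=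
  smallest closed_under_mul [set e | exists t l, e = iso_phi t l].

Lemma enveloping_closed_under_mul : closed_under_mul enveloping.
Proof.
split; first by apply: closed_bigI => S [[]].
move=> e2 e1 e12 H2 H1 S [[cS mS] gS];
  exact: (mS _ _ e12 (H2 S (conj (conj cS mS) gS)) (H1 S (conj (conj cS mS) gS))).
Qed.

Lemma enveloping_sub S : closed_under_mul S -> (forall t l, S (iso_phi t l)) ->
  enveloping `<=` S.
Proof. by move=> cS gS; apply: smallest_sub => // _ [t [l ->]]. Qed.

Lemma enveloping_phi t l : enveloping (iso_phi t l).
Proof. by move=> S [_]; apply; exists t, l. Qed.

Lemma enveloping_one l : enveloping (iso_one l).
Proof. by rewrite -iso_phi1; exact: enveloping_phi. Qed.

Lemma enveloping_mul e2 e1 : tgt e1 = src e2 -> enveloping e2 -> enveloping e1 ->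
  enveloping (iso_mul e2 e1).
Proof. by have [_] := enveloping_closed_under_mul; apply. Qed.

(** The isometries whose inverse is enveloping form a closed set stable under composition; it
    contains the generators because the inverse of an [iso_phi] is one again. *)
Lemma enveloping_inv e : enveloping e -> enveloping (iso_inv e).
Proof.
suff: enveloping `<=` iso_inv @^-1` enveloping by apply.
apply: enveloping_sub => [|t l]; last by rewrite /= iso_phi_inv; exact: enveloping_phi.
split; first by apply: preimage_closed => [? _|];
  [exact: iso_inv_continuous|case: enveloping_closed_under_mul].
move=> e2 e1 e12 /= H2 H1; rewrite iso_invM//; exact: enveloping_mul.
Qed.

Local Notation M := (fixed_factor R psi).
Local Notation qf := (@fixed_factor_map R G L psi).

Let sM : stonean M. Proof. exact: fixed_factor_stonean. Qed.
Let cM : compact [set: M]. Proof. by have [[]] := sM. Qed.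
Let hM : hausdorff_space M. Proof. by have [[]] := sM. Qed.
Let cqf : continuous qf. Proof. exact: fixed_factor_map_continuous. Qed.

(** The pairs of source and target form a closed set, by compactness, and it contains the dense
    orbit relation. *)
Lemma enveloping_onto l1 l2 : qf l1 = qf l2 ->
  exists e, [/\ enveloping e, src e = l1 & tgt e = l2].
Proof.
move=> l12; have [ciso hiso] := isometry_compact_hausdorff.
have cst : continuous (fun e => (src e, tgt e)).
  by apply: pair_continuous; [exact: src_continuous|exact: tgt_continuous].
have cim := closed_image ciso (prod_hausdorff hL hL) cst enveloping_closed_under_mul.1.
have [|e He [<- <-]] := cim (l1, l2); last by exists e.
move=> W [[V1 V2] /= [V1l V2l] VW].
have [t [a [V1a V2a]]] := orbit_relation_dense psi_system L_stonean l12 V1l V2l.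
exists (a, psi t a); split; last exact: VW.
by exists (iso_phi t a) => //; exact: enveloping_phi.
Qed.

Let sigma_exists : {sigma : M -> L | continuous sigma /\ cancel sigma qf}.
Proof.
apply: cid; have [m|s [cs _ sK]] := stonean_section sM (conj cL hL) cqf closedT;
  last by exists s.
by have [l lm] := fixed_factor_map_surjective psi_system m; exists l.
Qed.

Definition sigma : M -> L := sval sigma_exists.
Let sigma_continuous : continuous sigma. Proof. by have [] := svalP sigma_exists. Qed.
Let sigmaK : cancel sigma qf. Proof. by have [] := svalP sigma_exists. Qed.

Let tau_exists : {tau : L -> isometry | [/\ continuous tau,
  forall l, enveloping (tau l), forall l, src (tau l) = sigma (qf l) &
  forall l, tgt (tau l) = l]}.
Proof.
apply: cid.
have [|l|tau [ctau Htau tauK]] := @stonean_section _ _ tgt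
  (enveloping `&` [set e | src e = sigma (qf (tgt e))]) L_stonean
    isometry_compact_hausdorff tgt_continuous.
- apply: closedI; first exact: enveloping_closed_under_mul.1.
  apply: eq_closed => //; first exact: src_continuous.
  exact: comp_continuous (comp_continuous tgt_continuous cqf) sigma_continuous.
- have [|e [He se te]] := @enveloping_onto (sigma (qf l)) l; first by rewrite sigmaK.
  by exists e => //; split => //; rewrite /= se te.
exists tau; split => // [l|l]; first by have [] := Htau l.
by have [_ /= ->] := Htau l; rewrite tauK.
Qed.

(* tau l identifies the fibre over l with the fibre over the chosen point
   sigma (qf l); the isotropy groups at these points form the bundle H. *)
Definition tau : L -> isometry := sval tau_exists.
Let tau_continuous : continuous tau. Proof. by have [] := svalP tau_exists. Qed.
Let tau_enveloping l : enveloping (tau l). Proof. by have [_ h _ _] :=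
  svalP tau_exists; exact: h. Qed.
Let src_tau l : src (tau l) = sigma (qf l). Proof. by have [_ _ h _] :=
  svalP tau_exists; exact: h. Qed.
Let tgt_tau l : tgt (tau l) = l. Proof. by have [_ _ _ h] := svalP tau_exists;
  exact: h. Qed.

(** * The bundle of isotropy groups *)

Definition isotropy : set isometry :=
  [set e | [/\ enveloping e, tgt e = src e & sigma (qf (src e)) = src e]].

Definition isotropy_space : topologicalType := set_type isotropy.

Lemma isotropy_closed : closed isotropy.
Proof.
have -> : isotropy = enveloping `&` ([set e | tgt e = src e] `&` [set e | sigma (qf
  (src e)) = src e]).
  by rewrite eqEsubset; split=> [e []|e [? []]].
apply: closedI; first exact: enveloping_closed_under_mul.1.
apply: closedI; apply: eq_closed => //.
- exact: tgt_continuous.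
- exact: src_continuous.
- exact: comp_continuous (comp_continuous src_continuous cqf) sigma_continuous.
- exact: src_continuous.
Qed.

Lemma isotropy_compact_hausdorff : compact_hausdorff isotropy_space.
Proof.
have [ciso hiso] := isometry_compact_hausdorff.
split; last exact: set_type_hausdorff.
by apply: set_type_compact; apply: subclosed_compact ciso _ => //; exact: isotropy_closed.
Qed.

Definition iso_val (h : isotropy_space) : isometry := \val h.

Lemma iso_val_continuous : continuous iso_val.
Proof. exact: set_type_val_continuous. Qed.

Lemma iso_valP (h : isotropy_space) : isotropy (iso_val h).
Proof. exact: set_mem (svalP h). Qed.

Definition iso_sub (e : isometry) (He : isotropy e) : isotropy_space :=
  exist (fun e => e \in isotropy) e (mem_set He).

Definition bproj (h : isotropy_space) : M := qf (src (iso_val h)).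

Let src_iso_val h : src (iso_val h) = sigma (bproj h).
Proof. by have [_ _ ->] := iso_valP h. Qed.

Let tgt_iso_val h : tgt (iso_val h) = sigma (bproj h).
Proof. by have [_ -> ->] := iso_valP h. Qed.

Lemma bproj_continuous : continuous bproj.
Proof. exact: comp_continuous (comp_continuous iso_val_continuous src_continuous) cqf.
  Qed.

Lemma isotropy_mul h1 h2 : bproj h1 = bproj h2 ->
  isotropy (iso_mul (iso_val h1) (iso_val h2)).
Proof.
move=> h12; have t21 : tgt (iso_val h2) = src (iso_val h1) by rewrite tgt_iso_val
  src_iso_val h12.
split; rewrite ?src_mul ?tgt_mul//.
- by apply: enveloping_mul => //; [case: (iso_valP h1)|case: (iso_valP h2)].
- by rewrite tgt_iso_val src_iso_val h12.
Qed.

Definition bmul (h1 h2 : isotropy_space) : isotropy_space :=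
  if pselect (bproj h1 = bproj h2) is left h12 then iso_sub (isotropy_mul h12)
  else h1.

Lemma bmul_val h1 h2 : bproj h1 = bproj h2 ->
  iso_val (bmul h1 h2) = iso_mul (iso_val h1) (iso_val h2).
Proof. by rewrite /bmul; case: pselect. Qed.

Lemma isotropy_inv h : isotropy (iso_inv (iso_val h)).
Proof.
split; rewrite ?src_inv ?tgt_inv.
- by apply: enveloping_inv; case: (iso_valP h).
- by rewrite tgt_iso_val src_iso_val.
- by rewrite !tgt_iso_val sigmaK.
Qed.

Definition binv (h : isotropy_space) : isotropy_space := iso_sub (isotropy_inv h).

Lemma isotropy_one m : isotropy (iso_one (sigma m)).
Proof. by split => //; [exact: enveloping_one|rewrite sigmaK]. Qed.

Definition bone (m : M) : isotropy_space := iso_sub (isotropy_one m).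

Lemma composable h1 h2 : bproj h1 = bproj h2 -> tgt (iso_val h2) = src (iso_val h1).
Proof. by move=> h12; rewrite tgt_iso_val src_iso_val h12. Qed.

Lemma bproj_mul h1 h2 : bproj h1 = bproj h2 -> bproj (bmul h1 h2) = bproj h1.
Proof.
move=> h12; have -> : bproj (bmul h1 h2) = qf (src (iso_val (bmul h1 h2))) by [].
by rewrite bmul_val// src_mul; [exact: esym h12|exact: composable].
Qed.

Lemma bproj_inv h : bproj (binv h) = bproj h.
Proof. by rewrite {1}/bproj /= src_inv tgt_iso_val sigmaK. Qed.

Lemma bproj_one m : bproj (bone m) = m.
Proof. by rewrite /bproj /= sigmaK. Qed.

Lemma iso_val_inj : injective iso_val.
Proof. exact: val_inj. Qed.

Lemma within_set_type_continuous (X Y : topologicalType) (D : set X) (A : set Y)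
    (f : X -> set_type A) :
  {within D, continuous (\val \o f)} -> {within D, continuous f}.
Proof.
move=> /within_continuousP cf; apply/within_continuousP =>
  x W Dx [W' [[B oB BW'] /= W'x] W'W].
have Bx : B (\val (f x)) by move: W'x; rewrite -BW'.
have := cf x B Dx (open_nbhs_nbhs (conj oB Bx)).
by apply: filterS => x' H /H Bx'; apply: W'W; rewrite -BW'.
Qed.

Lemma bmul_continuous : {within [set xy | bproj xy.1 = bproj xy.2],
  continuous (fun xy : isotropy_space * isotropy_space => bmul xy.1 xy.2)}.
Proof.
apply: within_set_type_continuous.
have /within_continuousP H : {within [set xy :
  isotropy_space * isotropy_space | bproj xy.1 = bproj xy.2],
    continuous (fun xy => iso_mul (iso_val xy.1) (iso_val xy.2))}.
  apply: (within_continuous_comp2 iso_mul_continuous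
    (g := fun xy : isotropy_space * isotropy_space => (iso_val xy.1, iso_val xy.2))).
    apply: continuous_subspaceT; apply: pair_continuous.
      exact: comp_continuous (@continuous_fst _ _) iso_val_continuous.
    exact: comp_continuous (@continuous_snd _ _) iso_val_continuous.
  by move=> xy /= ?; exact: composable.
apply/within_continuousP => xy W Dxy;
  rewrite /= -[\val _]/(iso_val _) bmul_val// => /(H _ _ Dxy).
by apply: filterS => xy' + Dxy' => /(_ Dxy'); rewrite -[\val _]/(iso_val _) /= bmul_val.
Qed.

Lemma binv_continuous : continuous binv.
Proof.
apply: continuous_comp_initial.
exact: comp_continuous iso_val_continuous iso_inv_continuous.
Qed.

Lemma bone_continuous : continuous bone.
Proof.
apply: continuous_comp_initial.
exact: comp_continuous sigma_continuous iso_one_continuous.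
Qed.

(** Left transparent, so that the projection and operations of [H] reduce to [bproj], [bmul], [binv]
    and [bone]. *)
Definition isotropy_bundle : group_bundle M.
Proof.
refine (@GroupBundle M isotropy_space bproj bmul binv bone isotropy_compact_hausdorff
  bproj_continuous _ bproj_mul bproj_inv bproj_one _ _ _ _ _ bmul_continuous
  binv_continuous bone_continuous).
- by move=> m; exists (bone m); exact: bproj_one.
- move=> x y z xy yz; apply: iso_val_inj.
  have xyz : bproj x = bproj (bmul y z) by rewrite bproj_mul.
  have xyz' : bproj (bmul x y) = bproj z by rewrite bproj_mul// xy.
  rewrite (bmul_val xyz) (bmul_val yz) (bmul_val xyz') (bmul_val xy).
  by rewrite iso_mulA //; exact: composable.
- move=> x; apply: iso_val_inj; rewrite bmul_val ?bproj_one//.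
  by rewrite -[iso_val (bone _)]/(iso_one (sigma (bproj x))) -tgt_iso_val iso_mul1.
- move=> x; apply: iso_val_inj; rewrite bmul_val ?bproj_one//.
  by rewrite -[iso_val (bone _)]/(iso_one (sigma (bproj x))) -src_iso_val iso_mulr1.
- move=> x; apply: iso_val_inj; rewrite bmul_val ?bproj_inv//.
  by rewrite -[iso_val (binv _)]/(iso_inv (iso_val x)) iso_mulV src_iso_val.
- move=> x; apply: iso_val_inj; rewrite bmul_val ?bproj_inv//.
  by rewrite -[iso_val (binv _)]/(iso_inv (iso_val x)) iso_mulrV tgt_iso_val.
Defined.

Local Notation H := isotropy_bundle.

(** * The cocycle, its ergodicity and openness of the bundle *)

Lemma isotropy_cocycle t l : isotropy
  (iso_mul (iso_inv (tau (psi t l))) (iso_mul (iso_phi t l) (tau l))).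
Proof.
have c1 : tgt (tau l) = src (iso_phi t l) by rewrite tgt_tau.
have c2 : tgt (iso_mul (iso_phi t l) (tau l)) = src (iso_inv (tau (psi t l))).
  by rewrite tgt_mul// src_inv tgt_tau.
have s : src (iso_mul (iso_inv (tau (psi t l))) (iso_mul (iso_phi t l) (tau l))) =
  sigma (qf l).
  by rewrite src_mul// src_mul// src_tau.
have tt : tgt (iso_mul (iso_inv (tau (psi t l))) (iso_mul (iso_phi t l) (tau l))) =
  sigma (qf l).
  by rewrite tgt_mul// tgt_inv src_tau fixed_factor_mapE.
split; rewrite ?s ?tt ?sigmaK//.
apply: enveloping_mul => //; first exact: enveloping_inv.
by apply: enveloping_mul => //; exact: enveloping_phi.
Qed.

Definition cocycle_fun (t : G) (l : L) : isotropy_space := iso_sub (isotropy_cocycle t l).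

Lemma bproj_cocycle t l : bproj (cocycle_fun t l) = qf l.
Proof.
rewrite /bproj /= src_mul ?src_mul ?tgt_mul ?src_inv ?tgt_tau//.
by rewrite src_tau sigmaK.
Qed.

Lemma act_cocycle t l x : q x = sigma (qf l) ->
  act (iso_val (cocycle_fun t l)) x =
  act (iso_inv (tau (psi t l))) (phi t (act (tau l) x)).
Proof.
move=> xl; rewrite /= act_mul ?src_mul ?tgt_mul ?src_inv ?tgt_tau// ?src_tau//.
by rewrite act_mul ?tgt_tau ?src_tau// act_phi// q_act ?tgt_tau ?src_tau.
Qed.

Lemma act_tau_cocycle t l x : q x = sigma (qf l) ->
  act (tau (psi t l)) (act (iso_val (cocycle_fun t l)) x) = phi t (act (tau l) x).
Proof.
by move=> xl; rewrite act_cocycle// act_invKV// qE tgt_tau q_act ?tgt_tau ?src_tau.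
Qed.

Lemma cocycle_continuous t : continuous (cocycle_fun t).
Proof.
apply: continuous_comp_initial.
apply: (within_continuous_at iso_mul_continuous (g := fun l =>
  (iso_inv (tau (psi t l)), iso_mul (iso_phi t l) (tau l)))).
  apply: pair_continuous.
    apply: comp_continuous iso_inv_continuous.
    exact: comp_continuous (@action_continuous _ _ _ psi_system t) tau_continuous.
  apply: (within_continuous_at iso_mul_continuous (g := fun l => (iso_phi t l, tau l))).
    by apply: pair_continuous; [exact: iso_phi_continuous|exact: tau_continuous].
  by move=> l /=; rewrite tgt_tau.
by move=> l /=; rewrite tgt_mul ?tgt_tau// src_inv tgt_tau.
Qed.

Lemma act_bmul h1 h2 x : bproj h1 = bproj h2 -> q x = sigma (bproj h2) ->
  act (iso_val (bmul h1 h2)) x = act (iso_val h1) (act (iso_val h2) x).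
Proof.
by move=> h12 xh; rewrite bmul_val// act_mul ?src_iso_val//; rewrite tgt_iso_val h12.
Qed.

Lemma isotropy_ext (h1 h2 : isotropy_space) : bproj h1 = bproj h2 ->
  (forall x, q x = sigma (bproj h1) -> act (iso_val h1) x = act (iso_val h2) x) ->
  h1 = h2.
Proof.
move=> h12 hE; apply: iso_val_inj; apply: isometry_ext.
- by rewrite !src_iso_val h12.
- by rewrite !tgt_iso_val h12.
- by move=> x; rewrite src_iso_val; exact: hE.
Qed.

Lemma cocycle_mul t1 t2 l :
  cocycle_fun (t1 * t2)%g l = bmul (cocycle_fun t1 (psi t2 l)) (cocycle_fun t2 l).
Proof.
have [_ _ psiM] := psi_system; have [_ _ phiM] := phi_system.
have pE : bproj (cocycle_fun t1 (psi t2 l)) = bproj (cocycle_fun t2 l).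
  by rewrite !bproj_cocycle fixed_factor_mapE.
apply: isotropy_ext; first by rewrite bproj_mul// !bproj_cocycle fixed_factor_mapE.
move=> x; rewrite bproj_cocycle => xl.
rewrite act_bmul ?bproj_cocycle ?fixed_factor_mapE// act_cocycle//.
rewrite (@act_cocycle t1 (psi t2 l)); last first.
  by rewrite q_act ?src_iso_val ?tgt_iso_val bproj_cocycle// fixed_factor_mapE.
by rewrite act_tau_cocycle// psiM phiM.
Qed.

Definition cocycle : relative_cocycle H :=
  @RelativeCocycle R G L psi H cocycle_fun cocycle_continuous bproj_cocycle cocycle_mul.

(* This map carries closed subsemigroupoids to closed sets of isometries stable
   under composition, and the cocycle to the restrictions of phi. *)
Definition conj_tau (z : L * L * H) : isometry :=
  iso_mul (tau z.1.2) (iso_mul (iso_val z.2) (iso_inv (tau z.1.1))).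

Local Notation grpd := (@ergodicity_groupoid R G L psi H).

Section conj_tau.
Variable z : L * L * H.
Hypothesis zP : grpd z.

Let z1 : qf z.1.1 = bproj z.2. Proof. by case: zP. Qed.
Let z2 : qf z.1.2 = bproj z.2. Proof. by case: zP. Qed.

Lemma conj_tau_composable1 : tgt (iso_inv (tau z.1.1)) = src (iso_val z.2).
Proof. by rewrite tgt_inv src_tau src_iso_val z1. Qed.

Lemma conj_tau_composable2 :
  tgt (iso_mul (iso_val z.2) (iso_inv (tau z.1.1))) = src (tau z.1.2).
Proof. by rewrite tgt_mul ?conj_tau_composable1// src_tau z2 tgt_iso_val. Qed.

Lemma src_conj_tau : src (conj_tau z) = z.1.1.
Proof.
by rewrite src_mul ?conj_tau_composable2// src_mul ?conj_tau_composable1// src_inv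
  tgt_tau.
Qed.

Lemma tgt_conj_tau : tgt (conj_tau z) = z.1.2.
Proof. by rewrite tgt_mul ?conj_tau_composable2// tgt_tau. Qed.

Lemma act_conj_tau x : q x = z.1.1 ->
  act (conj_tau z) x = act (tau z.1.2) (act (iso_val z.2) (act (iso_inv (tau z.1.1)) x)).
Proof.
move=> xz; rewrite act_mul ?conj_tau_composable2// ?act_mul ?conj_tau_composable1//.
- by rewrite src_inv tgt_tau.
- by rewrite src_mul ?conj_tau_composable1// src_inv tgt_tau.
Qed.

Lemma enveloping_conj_tau : enveloping (conj_tau z).
Proof.
apply: enveloping_mul => //; first exact: conj_tau_composable2.
apply: enveloping_mul => //; first exact: conj_tau_composable1.
  by case: (iso_valP z.2).
exact: enveloping_inv.
Qed.

End conj_tau.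

(** Allows membership to be pulled back from the image of a subsemigroupoid in the proof of
    ergodicity. *)
Lemma conj_tau_inj z z' : grpd z -> grpd z' -> conj_tau z = conj_tau z' -> z = z'.
Proof.
move=> gz gz' zz'.
have e1 : z.1.1 = z'.1.1 by rewrite -(src_conj_tau gz) zz' src_conj_tau.
have e2 : z.1.2 = z'.1.2 by rewrite -(tgt_conj_tau gz) zz' tgt_conj_tau.
have e3 : z.2 = z'.2.
  have p1 : bproj z.2 = qf z.1.1 by case: gz.
  have p1' : bproj z'.2 = qf z'.1.1 by case: gz'.
  have p2 : bproj z.2 = qf z.1.2 by case: gz.
  have p2' : bproj z'.2 = qf z'.1.2 by case: gz'.
  apply: isotropy_ext => [|x xz]; first by rewrite p1 p1' e1.
  have qx : q x = src (tau z.1.1) by rewrite src_tau -p1.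
  have qx' : q x = src (tau z'.1.1) by rewrite -e1.
  have := congr1 (fun e => act e (act (tau z.1.1) x)) zz'.
  rewrite !act_conj_tau ?q_act// ?tgt_tau// -?e1// act_invK// e2 =>
    /(congr1 (act (iso_inv (tau z'.1.2)))).
  have x' : q x = sigma (bproj z'.2) by rewrite qx' src_tau p1'.
  rewrite !act_invK//.
    by rewrite q_act ?tgt_iso_val ?src_tau ?p2'// src_iso_val.
  by rewrite q_act ?tgt_iso_val ?src_tau ?p2 ?e2// src_iso_val.
case: z z' e1 e2 e3 {gz gz' zz'} => [[? ?] ?] [[? ?] ?] /= -> ->.
by move=> ->.
Qed.

Lemma grpd_closed : closed grpd.
Proof.
have -> : grpd = [set z | qf z.1.1 = bproj z.2] `&` [set z | qf z.1.2 = bproj z.2].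
  by rewrite eqEsubset; split=> [z []|z []].
apply: closedI; apply: eq_closed => //.
- exact: comp_continuous (comp_continuous (@continuous_fst _ _) (@continuous_fst _ _))
  cqf.
- exact: comp_continuous (@continuous_snd _ _) bproj_continuous.
- exact: comp_continuous (comp_continuous (@continuous_fst _ _) (@continuous_snd _ _))
  cqf.
- exact: comp_continuous (@continuous_snd _ _) bproj_continuous.
Qed.

Lemma conj_tau_continuous : {within grpd, continuous conj_tau}.
Proof.
have c1 : continuous (fun z : L * L * H =>
  z.1.1) := comp_continuous (@continuous_fst _ _) (@continuous_fst _ _).
have c2 : continuous (fun z : L * L * H =>
  z.1.2) := comp_continuous (@continuous_fst _ _) (@continuous_snd _ _).
have c3 : continuous (fun z : L * L * H => z.2) := @continuous_snd _ _.
have H1 : {within grpd, continuous (fun z =>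
  iso_mul (iso_val z.2) (iso_inv (tau z.1.1)))}.
  apply: (within_continuous_comp2 iso_mul_continuous (g := fun z : L * L * H =>
    (iso_val z.2, iso_inv (tau z.1.1)))).
    apply: continuous_subspaceT; apply: pair_continuous.
      exact: comp_continuous c3 iso_val_continuous.
    exact: comp_continuous (comp_continuous c1 tau_continuous) iso_inv_continuous.
  by move=> z gz /=; exact: conj_tau_composable1.
apply: (within_continuous_comp2 iso_mul_continuous (g := fun z : L * L * H =>
  (tau z.1.2, iso_mul (iso_val z.2) (iso_inv (tau z.1.1))))).
  apply: within_pair_continuous H1.
  apply: continuous_subspaceT; exact: comp_continuous c2 tau_continuous.
by move=> z gz /=; exact: conj_tau_composable2.
Qed.

Lemma conj_tau_mul l l1 l2 (x y : H) : grpd (l, l2, x) -> grpd (l1, l, y) ->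
  iso_mul (conj_tau (l, l2, x)) (conj_tau (l1, l, y)) = conj_tau (l1, l2, bmul x y).
Proof.
move=> gx gy.
have lx : qf l = bproj x by case: gx.
have l2x : qf l2 = bproj x by case: gx.
have l1y : qf l1 = bproj y by case: gy.
have ly : qf l = bproj y by case: gy.
have xy : bproj x = bproj y by rewrite -lx ly.
have gxy : grpd (l1, l2, bmul x y) by split; rewrite /= bproj_mul ?xy// -xy.
have comp : tgt (conj_tau (l1, l, y)) = src (conj_tau (l, l2, x)).
  by rewrite tgt_conj_tau// src_conj_tau.
apply: isometry_ext.
- by rewrite (src_mul comp) !src_conj_tau.
- by rewrite (tgt_mul comp) !tgt_conj_tau.
move=> k; rewrite (src_mul comp) src_conj_tau//= => kl1.
rewrite (act_mul comp) ?src_conj_tau// (act_conj_tau gy)// (act_conj_tau gxy)//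
  (act_conj_tau gx)/=; last first.
  by rewrite q_act ?tgt_tau// q_act// ?src_tau ?src_iso_val ?tgt_iso_val ?ly// q_act
    ?src_inv ?tgt_tau// tgt_inv src_tau l1y.
rewrite act_invK; last by rewrite q_act ?src_tau ?tgt_iso_val ?ly// q_act ?src_inv
  ?tgt_tau// tgt_inv src_tau src_iso_val l1y.
by rewrite act_bmul// q_act ?src_inv ?tgt_tau// tgt_inv src_tau l1y.
Qed.

Lemma conj_tau_cocycle t l : conj_tau (l, psi t l, cocycle_fun t l) = iso_phi t l.
Proof.
have g : grpd (l, psi t l, cocycle_fun t l).
  by split; rewrite /= bproj_cocycle ?fixed_factor_mapE.
apply: isometry_ext; first by rewrite src_conj_tau.
  by rewrite tgt_conj_tau.
move=> x; rewrite src_conj_tau//= => xl;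
  rewrite act_conj_tau//= act_phi// act_tau_cocycle ?act_invKV ?tgt_tau//.
by rewrite q_act ?src_inv ?tgt_tau// tgt_inv src_tau.
Qed.

(** For a closed subsemigroupoid [Q] containing the cocycle, the image of [Q] under [conj_tau]
    contains every enveloping isometry by minimality, in particular [conj_tau z] for each [z] of the
    groupoid; injectivity puts [z] in [Q]. *)
Lemma cocycle_ergodic : ergodic_cocycle cocycle.
Proof.
have [cH hH] := isotropy_compact_hausdorff;
  have [ciso hiso] := isometry_compact_hausdorff.
rewrite /ergodic_cocycle eqEsubset; split.
  apply: smallest_sub.
    split => //; first exact: grpd_closed.
    move=> l l1 l2 x y [/= lx l2x] [/= l1y ly].
    have xy : bproj x = bproj y by rewrite -lx ly.
    by split=> /=; rewrite bproj_mul// xy.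
  move=> _ [l [t ->]]; split=> /=; rewrite bproj_cocycle//.
  exact: fixed_factor_mapE.
move=> z gz Q [[Qg cQ mQ] gQ].
have cim : closed (conj_tau @` Q).
  apply: compact_closed => //; apply: continuous_compact; last first.
    apply: (@subclosed_compact _ _ setT) => //.
    by rewrite -!setXTT; apply: compact_setX => //; exact: compact_setX.
  exact: continuous_subspaceW Qg conj_tau_continuous.
have [z' Qz' zz'] : (conj_tau @` Q) (conj_tau z).
  apply: (@enveloping_sub (conj_tau @` Q)) (enveloping_conj_tau gz).
    split => // e2 e1 e12 [[[l l2] x] Qx e2E] [[[l1 l'] y] Qy e1E].
    have ll' : l' = l.
      by move: e12; rewrite -e1E -e2E (tgt_conj_tau (Qg _ Qy)) (src_conj_tau (Qg _ Qx)).
    subst l'; exists (l1, l2, bmul x y); first exact: mQ Qx Qy.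
    by rewrite -e1E -e2E (conj_tau_mul (Qg _ Qx) (Qg _ Qy)).
  move=> t l; exists (l, psi t l, cocycle_fun t l); last exact: conj_tau_cocycle.
  by apply: gQ; exists l, t.
by rewrite -(conj_tau_inj (Qg _ Qz') gz zz').
Qed.

(* The points at which bproj is open form a closed subgroup bundle H', since the
   base is Stonean, and the cocycle takes values in H'; conclude by ergodicity. *)
Lemma bproj_open : open_map bproj.
Proof.
have [cH hH] := isotropy_compact_hausdorff.
pose H' : set H := [set h | forall W, nbhs h W -> nbhs (bproj h) (bproj @` W)].
suff H'T h : H' h.
  move=> A oA; rewrite openE => _ [h Ah <-]; apply: H'T.
  exact: open_nbhs_nbhs.
have cH' : closed H'.
  move=> x clx W /(compact_hausdorff_shrink isotropy_compact_hausdorff) [V [oV Vx VW]].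
  (* The closure of [O] contains [bproj x], is open since the base is Stonean, and stays inside the
     closed image of [closure V]. *)
  pose O := (bproj @` closure V)°.
  have clO : closure O (bproj x).
    move=> N /bproj_continuous Nx.
    have Nx' : nbhs x (bproj @^-1` N) by exact: Nx.
    have [h0 [H'h [Nh Vh]]] := clx _ (filterI Nx' (open_nbhs_nbhs (conj oV Vx))).
    exists (bproj h0); split => //.
    apply: filterS (H'h V (open_nbhs_nbhs (conj oV Vh))).
    by apply: image_subset; exact: subset_closure.
  have cV : closed (bproj @` closure V).
    by apply: closed_image => //; [exact: bproj_continuous|exact: closed_closure].
  have : nbhs (bproj x) (closure O).
    by apply: open_nbhs_nbhs; split => //; apply: sM.2; exact: open_interior.
  apply: filterS => m Om; have [|x' Vx' <-] := cV m; last by exists x' => //; exact: VW.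
  by move: m Om; apply: closure_subset; exact: interior_subset.
have mH' x y : bproj x = bproj y -> H' x -> H' y -> H' (bmul x y).
  move=> xy H'x H'y W Wxy.
  have /within_continuousP := bmul_continuous =>
    /(_ (x, y) W xy Wxy) [[W1 W2] /= [W1x W2y] W12].
  rewrite bproj_mul//; have := H'y _ W2y; rewrite -xy.
  apply: filterS2 (H'x _ W1x) => m [h1 W1h1 h1m] [h2 W2h2 h2m].
  have h12 : bproj h1 = bproj h2 by rewrite h1m h2m.
  exists (bmul h1 h2); last by rewrite bproj_mul.
  by apply: (W12 (h1, h2)).
have cocH' t l : H' (cocycle_fun t l).
  move=> W /(@cocycle_continuous t) Wc; rewrite bproj_cocycle.
  have : nbhs l (cocycle_fun t @^-1` W) by exact: Wc.
  rewrite nbhsE => -[V [oV Vl] VW].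
  have : nbhs (qf l) (qf @` V).
    by apply: open_nbhs_nbhs; split; [exact: fixed_factor_map_open|exists l].
  apply: filterS => _ [l' Vl' <-]; exists (cocycle_fun t l'); first exact: VW.
  exact: bproj_cocycle.
have : grpd `<=` [set z | grpd z /\ H' z.2].
  rewrite -[X in X `<=` _]cocycle_ergodic; apply: smallest_sub.
    split=> [z []//||].
      apply: closedI; first exact: grpd_closed.
      by apply: preimage_closed => // z _; exact: cvg_snd.
    move=> l l1 l2 x y [[/= lx l2x] /= H'x] [[/= l1y ly] /= H'y].
    have xy : bproj x = bproj y by rewrite -lx ly.
    split; last exact: mH'.
    by split=> /=; rewrite bproj_mul// xy.
  move=> _ [l [t ->]]; split; last exact: cocH'.
  split=> /=; rewrite bproj_cocycle//.
  exact: fixed_factor_mapE.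
(* Every [h] occurs as the last component of a groupoid element. *)
move=> /(_ (sigma (bproj h), sigma (bproj h), h)) [|_ //].
by split; rewrite /= sigmaK.
Qed.

(** * Transitivity of the isotropy groups *)

Section orbit_sup.
Variable g : K -> R.
Hypothesis cg : continuous g.

Let Cf : set (K * isotropy_space) := [set kh | bproj kh.2 = qf (q kh.1)].
Let gf (kh : K * isotropy_space) : R :=
  g (act (iso_val kh.2) (act (iso_inv (tau (q kh.1))) kh.1)).

Let cqfq : continuous (fun k => qf (q k)).
Proof. exact: comp_continuous cq cqf. Qed.

Let cH : compact [set: isotropy_space].
Proof. by have [] := isotropy_compact_hausdorff. Qed.

Let Cf_closed : closed Cf.
Proof.
apply: eq_closed => //; first exact: comp_continuous (@continuous_snd _ _)
  bproj_continuous.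
exact: comp_continuous (@continuous_fst _ _) cqfq.
Qed.

Let Cf_nonempty k : setT k -> exists h, Cf (k, h).
Proof. by move=> _; exists (bone (qf (q k))); rewrite /Cf /= bproj_one. Qed.

Let Cf_open k h W : setT k -> Cf (k, h) -> nbhs h W ->
  \forall k' \near k, setT k' -> exists2 h', W h' & Cf (k', h').
Proof.
move=> _ /= kh; rewrite nbhsE => -[V [oV Vh] VW].
have : nbhs (qf (q k)) (bproj @` V).
  by apply: open_nbhs_nbhs; split; [exact: bproj_open|exists h].
move=> /cqfq; rewrite /nbhs /=; apply: filterS => k' [h' Vh' h'k'] _.
by exists h' => //; exact: VW.
Qed.

Lemma untwist_continuous : continuous (fun k => act (iso_inv (tau (q k))) k).
Proof.
apply: (within_continuous_at act_continuous (g := fun k => (k, iso_inv (tau (q k))))).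
  apply: pair_continuous; first exact: id_continuous.
  exact: comp_continuous (comp_continuous cq tau_continuous) iso_inv_continuous.
by move=> k /=; rewrite src_inv tgt_tau.
Qed.

Lemma q_untwist k : q (act (iso_inv (tau (q k))) k) = sigma (qf (q k)).
Proof. by rewrite q_act ?src_inv ?tgt_tau// tgt_inv src_tau. Qed.

Let gf_continuous : {within Cf, continuous gf}.
Proof.
have cact : {within Cf, continuous (fun kh =>
  act (iso_val kh.2) (act (iso_inv (tau (q kh.1))) kh.1))}.
  apply: (within_continuous_comp2 act_continuous (g := fun kh : K * isotropy_space =>
    (act (iso_inv (tau (q kh.1))) kh.1, iso_val kh.2))).
    apply: continuous_subspaceT; apply: pair_continuous.
      exact: comp_continuous (@continuous_fst _ _) untwist_continuous.
    exact: comp_continuous (@continuous_snd _ _) iso_val_continuous.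
  by move=> [k h] kh /=; rewrite q_untwist src_iso_val kh.
move/within_continuousP in cact; apply/within_continuousP => kh W Ckh Wkh.
by have := cact kh _ Ckh (cg Wkh); apply: filterS => kh' H1 /H1.
Qed.

(** The supremum of [g] over the isotropy orbit of the point obtained by pulling [k] back along
    [tau]. It turns orbits into continuous functions on [K] to which topological ergodicity applies;
    its continuity uses openness of the bundle. *)
Definition orbit_sup : K -> R := sup_fiber Cf gf.

Lemma orbit_sup_continuous : continuous orbit_sup.
Proof.
have := sup_fiber_continuous cH Cf_closed Cf_nonempty Cf_open gf_continuous.
move=> /within_continuousP cs k W Wk; have := cs k W Logic.I Wk.
by apply: filterS => k'; apply.
Qed.

Lemma orbit_sup_le k a :
  (forall h, bproj h = qf (q k) -> g (act (iso_val h) (act (iso_inv (tau (q k))) k)) <=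
    a) ->
  orbit_sup k <= a.
Proof. by move=> ka; apply: (sup_fiber_le Cf_nonempty). Qed.

Lemma orbit_sup_ge k h : bproj h = qf (q k) ->
  g (act (iso_val h) (act (iso_inv (tau (q k))) k)) <= orbit_sup k.
Proof.
by move=> kh; apply: (sup_fiber_ge cH Cf_closed Cf_nonempty gf_continuous (z := h)).
Qed.

(** The cocycle carries the pullback of [k] to the pullback of [phi t k], so both lie in one orbit.
    One inequality for all group elements suffices, as [phi t] is invertible. *)
Lemma orbit_sup_invariant t k : orbit_sup (phi t k) = orbit_sup k.
Proof.
have le s x : orbit_sup (phi s x) <= orbit_sup x.
  apply: orbit_sup_le => h; rewrite qE fixed_factor_mapE => hx.
  have hc : bproj h = bproj (cocycle_fun s (q x)) by rewrite bproj_cocycle.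
  have -> : act (iso_inv (tau (psi s (q x)))) (phi s x) =
      act (iso_val (cocycle_fun s (q x))) (act (iso_inv (tau (q x))) x).
    by rewrite act_cocycle ?q_untwist// act_invKV ?tgt_tau.
  rewrite -act_bmul ?bproj_cocycle ?q_untwist//.
  by apply: orbit_sup_ge; rewrite bproj_mul.
by apply/eqP; rewrite eq_le le/= -{1}[k](actionK phi_system t) le.
Qed.

(** By topological ergodicity the invariant function [orbit_sup] comes from a fixed function on [L],
    which does not separate points with the same image in the fixed factor. *)
Lemma orbit_sup_fixed k k' : qf (q k) = qf (q k') -> orbit_sup k = orbit_sup k'.
Proof.
move=> kk'.
have : fixed_functions R phi (fun k => (orbit_sup k)%:C%C : cplx R).
  split=> [x|t]; last by apply/funext => x /=; rewrite orbit_sup_invariant.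
  exact: comp_continuous orbit_sup_continuous (@real_complex_continuous R) x.
rewrite -q_ergodic => -[f fixf fE].
have := (fixed_factor_map_eqP R psi _ _).1 kk' f fixf.
by rewrite -[f (q k)]/((f \o q) k) -[f (q k')]/((f \o q) k') fE => -[].
Qed.

End orbit_sup.

(** Distinct orbits would be disjoint closed sets. A Urysohn function, 0 on one and 1 on the other,
    would have different orbit suprema over the same point of the fixed factor. *)
Lemma isotropy_transitive m x y : q x = sigma m -> q y = sigma m ->
  exists h : isotropy_space, bproj h = m /\ act (iso_val h) x = y.
Proof.
move=> xm ym; apply: contrapT => nh.
have [cH hH] := isotropy_compact_hausdorff.
pose orb z := (fun h => act (iso_val h) z) @` [set h | bproj h = m].
have corb z : q z = sigma m -> closed (orb z).
  move=> zm; apply: compact_closed => //; apply: continuous_compact.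
    apply: (within_continuous_comp2 act_continuous (g := fun h => (z, iso_val h))).
      by apply: continuous_subspaceT; apply: pair_continuous;
        [exact: cst_continuous|exact: iso_val_continuous].
    by move=> h /= hm; rewrite src_iso_val hm.
  apply: (subclosed_compact _ cH) => //; apply: eq_closed => //;
    first exact: bproj_continuous.
  exact: cst_continuous.
have dis : orb x `&` orb y = set0.
  rewrite -subset0 => _ [[h1 /= h1m <-] [h2 /= h2m h12]]; apply: nh.
  exists (bmul (binv h2) h1); split; first by rewrite bproj_mul ?bproj_inv ?h1m.
  rewrite act_bmul ?bproj_inv ?h1m// -h12 /= act_invK//.
  by rewrite src_iso_val h2m.
have /(normal_separatorP (R := R)) nsep : normal_space K by exact: compact_normal.
have /(@uniform_separatorP _ R) [f [cf _ f0 f1]] := nsep _ _ (corb x xm) (corb y ym) dis.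
(* Every point over [sigma m] is the pullback of its own image under [tau (sigma m)]. *)
have untw z : q z = sigma m ->
    exists k, qf (q k) = m /\ act (iso_inv (tau (q k))) k = z.
  move=> zm; exists (act (tau (sigma m)) z).
  have qz : q (act (tau (sigma m)) z) = sigma m by rewrite q_act ?src_tau ?sigmaK//
    tgt_tau.
  by rewrite qz sigmaK act_invK// src_tau sigmaK.
have [k [km kx]] := untw x xm; have [k' [k'm k'y]] := untw y ym.
have E : orbit_sup f k = orbit_sup f k' by apply: orbit_sup_fixed => //; rewrite km k'm.
have le0 : orbit_sup f k <= 0.
  apply: orbit_sup_le => h; rewrite kx km => hm.
  by rewrite (f0 (f (act (iso_val h) x)))//; exists (act (iso_val h) x) => //; exists h.
have ge1 : 1 <= orbit_sup f k'.
  have := @orbit_sup_ge f cf k' (bone m); rewrite bproj_one k'm k'y => /(_ erefl).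
  rewrite (f1 (f (act (iso_val (bone m)) y)))//.
  by exists (act (iso_val (bone m)) y) => //; exists (bone m) => //; exact: bproj_one.
by have := le_trans ge1 (eq_ind _ (fun r => r <= 0) le0 _ E); rewrite ler10.
Qed.

(** * Base points, stabilizers and cosets *)

Let base_exists : {u : Sections | True}.
Proof.
apply: cid.
have [l|u [cu _ uq]] := @stonean_section K L q setT L_stonean (conj cK hK) cq closedT.
  by have [_ /(_ l) [k kl] _] := q_extension; exists k.
have Su : Sections u by [].
by exists (Sub u (mem_set Su)).
Qed.

Definition base (m : M) : K := \val (sval base_exists) (sigma m).

Let q_base m : q (base m) = sigma m.
Proof. exact: sectionK. Qed.

Let base_continuous : continuous base.
Proof. exact: comp_continuous sigma_continuous (@section_continuous _). Qed.

Definition orbit_map (h : isotropy_space) : K := act (iso_val h) (base (bproj h)).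

Lemma orbit_map_continuous : continuous orbit_map.
Proof.
apply: (within_continuous_at act_continuous (g := fun h => (base (bproj h), iso_val h))).
  apply: pair_continuous; last exact: iso_val_continuous.
  exact: comp_continuous bproj_continuous base_continuous.
by move=> h /=; rewrite q_base src_iso_val.
Qed.

Lemma q_orbit_map h : q (orbit_map h) = sigma (bproj h).
Proof. by rewrite q_act ?tgt_iso_val// q_base src_iso_val. Qed.

Lemma orbit_map_mul h1 h2 : bproj h1 = bproj h2 ->
  orbit_map (bmul h1 h2) = act (iso_val h1) (orbit_map h2).
Proof.
by move=> h12; rewrite /orbit_map bproj_mul// h12 act_bmul// q_base.
Qed.

Lemma orbit_map_surj k : q k = sigma (qf (q k)) -> exists h, orbit_map h = k.
Proof.
move=> kk; have [h [hm hk]] := isotropy_transitive (q_base (qf (q k))) kk.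
by exists h; rewrite /orbit_map hm.
Qed.

Definition stabilizer : set H := [set h | orbit_map h = base (bproj h)].

Lemma orbit_map_eqP (h1 h2 : isotropy_space) : orbit_map h1 = orbit_map h2 <->
  bproj h1 = bproj h2 /\ stabilizer (bmul (binv h1) h2).
Proof.
have stabE : bproj h1 = bproj h2 -> stabilizer (bmul (binv h1) h2) <->
    act (iso_inv (iso_val h1)) (orbit_map h2) = base (bproj h1).
  by move=> h12; rewrite /stabilizer /= orbit_map_mul ?bproj_mul bproj_inv.
split=> [E|[h12 /(stabE h12) E]].
  have h12 : bproj h1 = bproj h2 by rewrite -[LHS]sigmaK -q_orbit_map E q_orbit_map
    sigmaK.
  by split=> //; apply/stabE => //; rewrite -E act_invK// q_base src_iso_val.
rewrite /orbit_map -E act_invKV// q_orbit_map tgt_iso_val h12//.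
Qed.

Lemma stabilizer_closed : closed stabilizer.
Proof.
apply: eq_closed => //; first exact: orbit_map_continuous.
exact: comp_continuous bproj_continuous base_continuous.
Qed.

Lemma stabilizer_subgroup : fiberwise_subgroup stabilizer.
Proof.
split=> [m|x y xy /= Ux Uy|x /= Ux].
- by rewrite /stabilizer /= /orbit_map /= act_one// q_base bproj_one.
- have xy' : bproj x = bproj y := xy.
  by rewrite /stabilizer /= orbit_map_mul// bproj_mul// Uy -xy'; exact: Ux.
rewrite /stabilizer /= {1}/orbit_map /= bproj_inv -{1}Ux act_invK//.
by rewrite q_base src_iso_val.
Qed.

Definition stabilizer_bundle : subgroup_bundle H :=
  SubgroupBundle stabilizer_closed stabilizer_subgroup.
Local Notation U := stabilizer_bundle.

(* A normal subgroup fixing one point of a transitive action fixes every point. *)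
Lemma stabilizer_core_free : core_free U.
Proof.
move=> m N [Nm N1 _ _ Nconj] NU; rewrite eqEsubset; split=> [n Nn|_ ->//].
have nm : bproj n = m by exact: Nm.
apply: isotropy_ext; first by rewrite bproj_one.
move=> x; rewrite nm => xm.
have [h [hm hx]] := isotropy_transitive (q_base m) xm.
rewrite [in RHS]/= act_one//.
have inm : bproj (binv h) = m by rewrite bproj_inv.
have : N (bmul (bmul (binv h) n) (binv (binv h))) by exact: Nconj.
have -> : binv (binv h) = h by exact: (@gb_invK M H).
have pin : bproj (binv h) = bproj n by rewrite inm.
have pmh : bproj (bmul (binv h) n) = bproj h by rewrite bproj_mul// inm.
move=> /NU; rewrite /= /stabilizer /= orbit_map_mul// {1}/orbit_map hm hx act_bmul//;
  last by rewrite nm.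
move=> /(congr1 (act (iso_val h))); rewrite bproj_mul// bproj_mul// inm hx.
by rewrite [iso_val (binv h)]/= act_invKV// tgt_iso_val hm q_act ?tgt_iso_val
  ?src_iso_val ?nm.
Qed.

(** By [orbit_map_eqP] the point does not depend on the representative and determines the coset; by
    transitivity all points over the chosen points [sigma m] are reached. *)
Definition coset_map (z : coset_space U) : K := orbit_map (coset_repr z).

Lemma coset_mapE h : coset_map (coset U h) = orbit_map h.
Proof. by apply/orbit_map_eqP; apply/(@coset_eqP _ _ U); rewrite coset_reprK. Qed.

Lemma coset_map_inj : injective coset_map.
Proof.
move=> z z' /orbit_map_eqP E; rewrite -[z]coset_reprK -[z']coset_reprK.
exact/(@coset_eqP _ _ U).
Qed.

Lemma coset_map_continuous : continuous coset_map.
Proof.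
apply/quotient_continuous.
have -> : coset_map \o \pi_({eq_quot (coset_equiv U)})%qT = orbit_map.
  by apply/funext => h; exact: coset_mapE.
exact: orbit_map_continuous.
Qed.

Lemma coset_space_compact : compact [set: coset_space U].
Proof.
have [cH _] := isotropy_compact_hausdorff.
have -> : [set: coset_space U] = coset U @` setT.
  by rewrite eqEsubset; split=> // z _; exists (coset_repr z) => //; exact: coset_reprK.
by apply: continuous_compact => //; apply: continuous_subspaceT; exact: pi_continuous.
Qed.

Lemma q_coset_map z : q (coset_map z) = sigma (coset_proj z).
Proof. exact: q_orbit_map. Qed.

Let coset_inv_exists : {f : K -> coset_space U |
  forall k, q k = sigma (qf (q k)) -> coset_map (f k) = k}.
Proof.
apply: cid.
have H1 k : exists z, q k = sigma (qf (q k)) -> coset_map z = k.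
  have [kk|nk] := pselect (q k = sigma (qf (q k))).
    by have [h hk] := orbit_map_surj kk; exists (coset U h) => _; rewrite coset_mapE.
  (* An arbitrary value away from the fibres over the points [sigma m]. *)
  by exists (coset U (bone (qf (q k)))).
have [f fP] := choice H1; by exists f.
Qed.

Definition coset_inv : K -> coset_space U := sval coset_inv_exists.
Let coset_invK k : q k = sigma (qf (q k)) -> coset_map (coset_inv k) = k.
Proof. exact: (svalP coset_inv_exists). Qed.

(** The inverse of a continuous injection of a compact space has a closed graph. *)
Lemma coset_inv_continuous :
  {within [set k | q k = sigma (qf (q k))], continuous coset_inv}.
Proof.
apply: (closed_graph_continuous coset_space_compact (C :=
  [set kz | kz.1 = coset_map kz.2])).
- apply: eq_closed => //; first exact: continuous_fst.
  exact: comp_continuous (@continuous_snd _ _) coset_map_continuous.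
- by move=> k /= kk; rewrite coset_invK.
- by move=> k z /= kk kz; apply: coset_map_inj; rewrite coset_invK.
Qed.

(** * The isomorphism with the skew-product *)

Let untwist k := act (iso_inv (tau (q k))) k.

Let untwist_base k : q (untwist k) = sigma (qf (q (untwist k))).
Proof. by rewrite q_untwist sigmaK. Qed.

Lemma skew_iso_subproof k : (@skew_set R G L psi H U) (q k, coset_inv (untwist k)).
Proof.
rewrite /skew_set /=; apply: (can_inj sigmaK).
by rewrite -q_coset_map coset_invK// q_untwist.
Qed.

Definition skew_iso (k : K) : skew_space U :=
  exist (fun lz => lz \in (@skew_set R G L psi H U)) _ (mem_set (skew_iso_subproof k)).

Definition skew_iso_inv (w : skew_space U) : K :=
  act (tau (\val w).1) (coset_map (\val w).2).

Lemma skew_isoK : cancel skew_iso skew_iso_inv.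
Proof.
move=> k; rewrite /skew_iso_inv /= coset_invK// act_invKV// tgt_tau//.
Qed.

Let skew_src (w : skew_space U) : q (coset_map (\val w).2) = src (tau (\val w).1).
Proof.
have : (@skew_set R G L psi H U) (\val w) := set_mem (svalP w).
by rewrite /skew_set /= q_coset_map src_tau => ->.
Qed.

Lemma skew_iso_invK : cancel skew_iso_inv skew_iso.
Proof.
move=> w; apply: val_inj; rewrite /= /untwist /skew_iso_inv.
have sw := skew_src w.
rewrite q_act// tgt_tau act_invK//.
rewrite [RHS]surjective_pairing; congr (_, _); apply: coset_map_inj.
by rewrite coset_invK// sw src_tau sigmaK.
Qed.

Lemma skew_iso_homeomorphism : homeomorphism skew_iso.
Proof.
split.
  apply: continuous_comp_initial; apply: pair_continuous => //.
  by apply: (within_continuous_at coset_inv_continuous) => //; exact: untwist_continuous.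
exists skew_iso_inv; split; [|exact: skew_isoK|exact: skew_iso_invK].
have cv : continuous (fun w : skew_space U =>
  \val w) := @set_type_val_continuous _ ((@skew_set R G L psi H U)).
apply: (within_continuous_at act_continuous (g := fun w : skew_space U =>
  (coset_map (\val w).2, tau (\val w).1))).
  apply: pair_continuous.
    exact: comp_continuous (comp_continuous cv (@continuous_snd _ _))
      coset_map_continuous.
  exact: comp_continuous (comp_continuous cv (@continuous_fst _ _)) tau_continuous.
by move=> w /=; exact: skew_src.
Qed.

(** After applying the injective [coset_map], the second components agree because the cocycle was
    defined as [phi t] conjugated by [tau]. *)
Lemma skew_iso_equivariant t k : skew_iso (phi t k) = skew_act U cocycle t (skew_iso k).
Proof.
apply: val_inj; rewrite /= qE; congr (_, _); apply: coset_map_inj.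
have kk := untwist_base k.
rewrite coset_invK//.
set z := coset_inv (untwist k).
have zE : orbit_map (coset_repr z) = untwist k by exact: coset_invK.
have pz : bproj (coset_repr z) = qf (q k).
  by apply: (can_inj sigmaK); rewrite -q_orbit_map zE q_untwist.
rewrite /coset_act coset_mapE (orbit_map_mul (h1 := cocycle_fun t (q k)) (h2 :=
  coset_repr z)) ?bproj_cocycle//.
rewrite zE act_cocycle ?q_untwist// /untwist qE act_invKV// tgt_tau//.
Qed.

Theorem skew_product_representation :
  exists (H : group_bundle M) (U : subgroup_bundle H) (c : relative_cocycle H),
    [/\ open_map (@gb_proj _ H), core_free U, ergodic_cocycle c &
        extension_isomorphic phi q (skew_act U c) (skew_proj U)].
Proof.
exists H, U, cocycle; split.
- exact: bproj_open.
- exact: stabilizer_core_free.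
- exact: cocycle_ergodic.
- exists skew_iso; split => //; first exact: skew_iso_homeomorphism.
  exact: skew_iso_equivariant.
Qed.

End isometry_groupoid.

Theorem theorem4p23 (R : realType) (G : groupType) (K L : topologicalType)
    (phi : G -> K -> K) (psi : G -> L -> L) (q : K -> L)
    (phi_system : dynamical_system phi) (psi_system : dynamical_system psi)
    (L_stonean : stonean L)
    (q_extension : extension phi psi q)
    (q_open : open_map q)
    (q_ergodic : topologically_ergodic R phi psi q)
    (q_discrete : relative_discrete_spectrum R phi q) :
  exists (H : group_bundle (fixed_factor R psi)) (U : subgroup_bundle H)
      (c : relative_cocycle H),
    [/\ open_map (@gb_proj _ H),
        core_free U,
        ergodic_cocycle c &
        extension_isomorphic phi q (skew_act U c) (skew_proj U)].
Proof.
(* One pseudometric is chosen for each of the generating modules; together they separate the points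
   of each fibre. *)
pose I := {M : set (K -> cplx R) | discrete_spectrum_module phi q M}.
have /choice[d dP] (i : I) :=
  discrete_spectrum_metric phi_system psi_system q_extension q_open (svalP i).
apply: (skew_product_representation phi_system psi_system L_stonean q_extension
  q_open (d := d)) => //.
- by move=> i; case: (dP i).
- by move=> i; case: (dP i).
- by move=> i; case: (dP i).
- by move=> i; case: (dP i).
- move=> x y xy d0; apply: (discrete_spectrum_separates phi_system q_discrete).
  move=> M f dM Mf; pose i : I := exist _ M dM.
  by have [_ _ _ _ [_ sep]] := dP i; exact: (sep f x y Mf xy (d0 i)).
- by move=> i; have [_ _ _ _ []] := dP i.
Qed.
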